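(* For every $\mu\in\mathbb{C}$ and $z\in\mathbb{C}\setminus(-\infty,0]$, the Hankel function of the first kind satisfies $$-\mathrm{i}\,H^{(1)}_\mu(z)=\mathcal{H}^{(1)}_\mu(z)+T_-(\mu)\,\frac{\chi_{[-\mu\,\mathrm{sgn}(\mathrm{Re}\,\mu)]}(z)}{\sin\mu\pi},$$ where $T_-(\mu)=e^{-\mathrm{i}\mu\pi}$ if $\mathrm{Re}\,\mu<0$, $T_-(\mu)=-1$ if $\mathrm{Re}\,\mu\geq0$, and the integral term is $$\mathcal{H}^{(1)}_\mu(z):=\frac{e^{-\mathrm{i}\mu\pi}B_\mu(z)-B_{-\mu}(z)}{\sin\mu\pi}=\frac{\mathrm{i}^{-\mu}}{\pi\sin\mu\pi}\int_0^\pi e^{-\mathrm{i}z\cos\theta}\Big[P\big(\{\mu\},-\mathrm{i}z(1+\cos\theta)\big)-P\big(-\{\mu\},-\mathrm{i}z(1+\cos\theta)\big)\Big]\cos(\mu\theta)\,\mathrm{d}\theta$$ (for $\mu\in\mathbb{Z}$ the right-hand sides are understood as limits).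
   Context: Integral and fractional parts: for $\mu\in\mathbb{C}$, $\langle\mathrm{Re}\,\mu\rangle$ is the nearest integer to $\mathrm{Re}\,\mu$, with $\langle n+\frac12\rangle=n$ for $n\in\mathbb{Z}$; $\{\mu\}:=\mu-\langle\mathrm{Re}\,\mu\rangle$, so $-\frac12<\mathrm{Re}\{\mu\}\leq\frac12$. $\mathrm{sgn}$ is the sign function with $\mathrm{sgn}(0)=0$. $J_\mu(z)=(z/2)^\mu\sum_{k\ge0}\frac{(-1)^k(z/2)^{2k}}{k!\,\Gamma(\mu+k+1)}$; $Y_\mu(z)=\frac{J_\mu(z)\cos\mu\pi-J_{-\mu}(z)}{\sin\mu\pi}$ (limit for integer $\mu$); $H^{(1)}_\mu=J_\mu+\mathrm{i}Y_\mu$, equivalently $H_\mu^{(1)}(z)=\mathrm{i}\,\frac{e^{-\mathrm{i}\mu\pi}J_\mu(z)-J_{-\mu}(z)}{\sin\mu\pi}$ (limit for integer $\mu$). $P(a,w)=w^a\gamma^*(a,w)$ with $\gamma^*(a,w)=e^{-w}\sum_{k\ge0}\frac{w^k}{\Gamma(a+k+1)}$ (normalised lower incomplete gamma function). $z^a$ is the principal power, $\mathrm{i}^a=e^{\mathrm{i}\pi a/2}$, and for $c>0$ the power $(-\mathrm{i}cz)^a$ (including in $P(a,-\mathrm{i}cz)$) means $e^{-\mathrm{i}\pi a/2}c^az^a$. For $\mu\in\mathbb{C}$: $B_\mu(z):=\frac{\mathrm{i}^{\mu}}{\pi}\int_{0}^\pi e^{-\mathrm{i} z\cos\theta}P(\{\mu\},-\mathrm{i}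 z(1+\cos\theta))\cos(\mu\theta)\,\mathrm{d}\theta$; and $\chi_\mu(z):=\frac{\mathrm{i}^\mu}{\sqrt{\pi}}e^{\mathrm{i} z}\sum_{j=1}^{-\langle\mathrm{Re}\,\mu\rangle}\frac{\Gamma(j+\mu-\frac12)}{\Gamma(j)\Gamma(j+2\mu)}(-2\mathrm{i} z)^{j+\mu-1}$ if $\mathrm{Re}\,\mu\leq-\frac12$, $\chi_\mu(z):=0$ if $\mathrm{Re}\,\mu>-\frac12$. For $\mu=m+\frac12$ with $m$ a negative integer, $\Gamma(j+\mu-\frac12)/\Gamma(j+2\mu)$ is understood as its limit $2(-1)^{m+1}\Gamma(-j-2m)/\Gamma(-j-m+1)$.
   Formalization: The integral expression with P(−{μ},·) is false or divergent when Re μ ∈ Z+1/2 (e.g. μ=1/2), so it is stated only for Re μ ∉ Z+1/2; for all μ the expression is stated with {−μ} in place of −{μ}; the main identity holds for all μ. *)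

(* Defs.v *)
From Stdlib Require Import Reals ZArith.
From Coquelicot Require Import Coquelicot.

Open Scope R_scope.

(** Limits.  As for [RInt_gen], the value of a total operator is meaningful
    only when the limit it denotes exists. *)

Definition Climit {T : Type} (F : (T -> Prop) -> Prop) (f : T -> C) : C :=
  iota (fun l : C_R_CompleteNormedModule =>
          filterlim f F (locally (l : C_UniformSpace))).

Definition Cseries (a : nat -> C) : C := Climit eventually (fun n => sum_n a n).

(** Nearest integer, with n + 1/2 rounded down to n. *)
Definition nint (x : R) : Z := Zceil (x - / 2).

Definition cfrac (mu : C) : C := (mu - IZR (nint (Re mu)))%C.

(** [l] is the value at [mu] of [f], an expression that is read as a limit
    when [mu] is an integer. *)
Definition is_int_lim (f : C -> C) (mu l : C) : Prop :=
  if Ceq_dec mu (IZR (nint (Re mu)))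
  then filterlim f (locally' (mu : C_UniformSpace)) (locally (l : C_UniformSpace))
  else f mu = l.

Definition int_lim (f : C -> C) (mu : C) : C :=
  iota (T := C_R_CompleteNormedModule) (is_int_lim f mu).

Definition Cexp (z : C) : C := (exp (Re z) * (cos (Im z) + Ci * sin (Im z)))%C.
Definition Ccos (z : C) : C := ((Cexp (Ci * z) + Cexp (- (Ci * z))) / 2)%C.
Definition Csin (z : C) : C := ((Cexp (Ci * z) - Cexp (- (Ci * z))) / (2 * Ci))%C.

(** Principal argument, in (-PI, PI], of a nonzero number. *)
Definition Carg (z : C) : R :=
  if Rle_dec 0 (Im z) then acos (Re z / Cmod z) else - acos (Re z / Cmod z).

Definition Clog (z : C) : C := (ln (Cmod z) + Ci * Carg z)%C.

Definition cpow (z a : C) : C := Cexp (a * Clog z)%C.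

(** i^a *)
Definition ipow (a : C) : C := Cexp (Ci * PI * a / 2)%C.

(** (- i c z)^a for c > 0.  This is not the principal power of [- i c z] when
    Arg z <= - PI / 2. *)
Definition micpow (c : R) (z a : C) : C :=
  (Cexp (- (Ci * PI * a / 2)) * cpow c a * cpow z a)%C.

Fixpoint rising (s : C) (n : nat) : C :=
  match n with
  | O => RtoC 1
  | S n' => (rising s n' * (s + INR n'))%C
  end.

(** 1 / Gamma as an entire function, by the Euler-Gauss product:
    s (s+1) ... (s+n) / (n! n^s), n -> oo. *)
Definition rGamma (s : C) : C :=
  Climit eventually
    (fun n => rising s (S n) / (INR (fact n) * cpow (INR n) s))%C.

Definition Gamma (s : C) : C := (/ rGamma s)%C.

Definition BesselJ (mu z : C) : C :=
  (cpow (z / 2) mu *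
   Cseries (fun k => RtoC ((-1) ^ k) * (z / 2) ^ (2 * k) / INR (fact k)
                     * rGamma (mu + INR k + 1)))%C.

Definition BesselY (mu z : C) : C :=
  int_lim (fun nu => (BesselJ nu z * Ccos (nu * PI) - BesselJ (- nu) z)
                     / Csin (nu * PI))%C mu.

Definition Hankel1 (mu z : C) : C := (BesselJ mu z + Ci * BesselY mu z)%C.

(** gamma^* (a, w) *)
Definition gammastar (a w : C) : C :=
  (Cexp (- w) * Cseries (fun k => w ^ k * rGamma (a + INR k + 1)))%C.

(** P (a, - i c z) for c > 0 *)
Definition Pmic (a : C) (c : R) (z : C) : C :=
  (micpow c z a * gammastar a (- (Ci * c * z)))%C.

(** Integral over [0, PI], improper at PI: the integrands below contain
    (1 + cos theta)^a, where Re a may be negative. *)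
Definition is_convergent_0_PI (f : R -> C) : Prop :=
  ex_RInt_gen (V := C_R_NormedModule) f (at_point 0) (at_left PI).

Definition integral_0_PI (f : R -> C) : C :=
  RInt_gen (V := C_R_CompleteNormedModule) f (at_point 0) (at_left PI).

Definition B_integrand (mu z : C) (theta : R) : C :=
  (Cexp (- (Ci * z * cos theta)) * Pmic (cfrac mu) (1 + cos theta) z
   * Ccos (mu * theta))%C.

Definition B (mu z : C) : C :=
  (ipow mu / PI * integral_0_PI (B_integrand mu z))%C.

(** Gamma(j + mu - 1/2) / Gamma(j + 2 mu), with its limit at
    mu = m + 1/2, m a negative integer. *)
Definition chi_coef (mu : C) (j : nat) : C :=
  let m := nint (Re mu) in
  if Ceq_dec mu (IZR m + / 2)%R
  then (2 * powerRZ (-1) (m + 1) * Gamma (IZR (- Z.of_nat j - 2 * m))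
        / Gamma (IZR (- Z.of_nat j - m + 1)))%C
  else (Gamma (INR j + mu - / 2) * rGamma (INR j + 2 * mu))%C.

Definition chi (mu z : C) : C :=
  if Rle_dec (Re mu) (- / 2) then
    (ipow mu / sqrt PI * Cexp (Ci * z) *
     sum_n_m (fun j => chi_coef mu j / Gamma (INR j)
                       * micpow 2 z (INR j + mu - 1))
             1 (Z.to_nat (- nint (Re mu))))%C
  else RtoC 0.

Definition Tminus (mu : C) : C :=
  if Rlt_dec (Re mu) 0 then Cexp (- (Ci * mu * PI))%C else RtoC (-1).

(** e^{-i nu PI} B_nu - B_{-nu} over sin (nu PI) *)
Definition calH_quot (z nu : C) : C :=
  ((Cexp (- (Ci * nu * PI)) * B nu z - B (- nu) z) / Csin (nu * PI))%C.

(** The integral term of the Hankel function. *)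
Definition calH (mu z : C) : C := int_lim (calH_quot z) mu.

(** e^{-i z cos theta} [P({mu}, w) - P(b, w)] cos (mu theta),
    w = - i z (1 + cos theta) *)
Definition diff_integrand (mu b z : C) (theta : R) : C :=
  (Cexp (- (Ci * z * cos theta)) *
   (Pmic (cfrac mu) (1 + cos theta) z - Pmic b (1 + cos theta) z) *
   Ccos (mu * theta))%C.

Definition calH_integral (mu b z : C) : C :=
  (ipow (- mu) / (PI * Csin (mu * PI)) *
   integral_0_PI (diff_integrand mu b z))%C.

Definition chi_quot (z nu : C) : C :=
  (Tminus nu * (chi (- (nu * sign (Re nu))) z / Csin (nu * PI)))%C.

Definition chi_term (mu z : C) : C := int_lim (chi_quot z) mu.

(* Main.v *)
Require Import Defs.
From Stdlib Require Import Reals ZArith Lra Lia Classical.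
From Coquelicot Require Import Coquelicot.
Open Scope R_scope.

(* Each of [B_mu], [chi_mu] and [J_mu] is a sum of the same terms
     t_j = e^(i z) (z/2)^mu (- i z/2)^j (2 mu + j + 1)_j / (j! Gamma (mu + j + 1)).
   For [J_mu] this is Kummer's transformation, all [j >= 0] being present.  Expanding [P] in the integrand of [B_mu]
   and integrating termwise with Cauchy's formula
     int_0^PI (2 + 2 cos t)^s cos (nu t) dt = PI Gamma (2 s + 1) / (Gamma (s + nu + 1) Gamma (s - nu + 1)),  Re s > -1/2,
   gives the [t_j] with [j >= - <Re mu>], since 1/Gamma vanishes at the nonpositive integers; by the duplication formula
   [chi_mu] consists of the remaining ones.  Hence [J_mu = B_mu + chi_mu], and the theorem is the definition of
   [H^(1)_mu] for non-integral [mu].  At an integer all quotients by [sin (mu PI)] have limits, because 1/Gamma, hence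
   [J_mu] and the finite sum of the [t_j], is complex differentiable in [mu].
   Cauchy's formula is obtained by integrating by parts, which relates [s] to [s + 1], and by letting the exponent
   tend to infinity, where [(2 + 2 cos t)^n] concentrates at [t = 0]; [s = 1/2] gives Gamma (1/2). *)

(** * Limits of complex functions *)

(** The bound - 1/2 < Re {mu} is the condition of Cauchy's formula for the lowest exponent {mu}; all
    higher exponents {mu} + k are then harmless. As {mu} jumps, the dependence of B_mu on mu is
    never studied. At an integer the quotient of the B's gets its limit from the identity with J_mu
    and chi_mu at the non-integral points nearby. Derivatives in mu come from two-point estimates:
    if f - g has a small Lipschitz constant seen from a point, with g differentiable there, then the
    difference quotients of f are close to those of g and hence Cauchy. This serves both for
    1/Gamma, with g a partial Euler-Gauss product, and for J_mu, with g a partial sum. The terms t_j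
    are written without denominators that depend on mu, so identities proved for generic mu pass to
    the exceptional ones by continuity. If Re mu is a half-integer, {- mu} differs from - {mu},
    because halves are always rounded down. The integral with P at {- mu} is therefore the one
    treated for every mu, and the one with - {mu} is reduced to it off these lines. *)

Definition Clim {T : Type} (F : (T -> Prop) -> Prop) (f : T -> C) (l : C) : Prop :=
  forall eps : R, 0 < eps -> F (fun x => Cmod (f x - l)%C < eps).

(** Neighbourhoods in [C] come from the product structure on pairs, whose balls and the discs of
    [Cmod] contain each other up to a factor sqrt 2. Estimates below use moduli; this is the passage
    to and from the filters of the definitions. *)
Lemma Clim_iff {T : Type} {F : (T -> Prop) -> Prop} {HF : Filter F} (f : T -> C) (l : C) :
  Clim F f l <-> filterlim f F (locally (l : C_UniformSpace)).
Proof.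
  split.
  - intros H P [e He]. change (F (fun x => P (f x))).
    apply (filter_imp (fun x => Cmod (f x - l)%C < e)).
    + intros x Hx. apply He. apply C_NormedModule_mixin_compat1. exact Hx.
    + apply H, cond_pos.
  - intros H e He.
    assert (Hs : 0 < sqrt 2) by (apply sqrt_lt_R0; lra).
    assert (He' : 0 < e / sqrt 2) by (apply Rdiv_lt_0_compat; lra).
    specialize (H (fun y => Cmod (y - l)%C < e)).
    apply H. exists (mkposreal _ He'). intros y Hy.
    apply C_NormedModule_mixin_compat2 in Hy. simpl in Hy.
    replace (sqrt 2 * (e / sqrt 2)) with e in Hy by (field; lra).
    exact Hy.
Qed.

Lemma Clim_ext {T : Type} {F : (T -> Prop) -> Prop} {HF : Filter F} (f g : T -> C) (l : C) :
  F (fun x => f x = g x) -> Clim F f l -> Clim F g l.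
Proof.
  intros H Hf e He. generalize (filter_and (F := F) _ _ H (Hf e He)). apply filter_imp.
  intros x [-> Hx]; exact Hx.
Qed.

Lemma Clim_const {T : Type} {F : (T -> Prop) -> Prop} {HF : Filter F} (l : C) :
  Clim F (fun _ => l) l.
Proof.
  intros e He. apply filter_forall; intros _.
  replace (l - l)%C with (RtoC 0) by ring. rewrite Cmod_0; exact He.
Qed.

Lemma Clim_plus {T : Type} {F : (T -> Prop) -> Prop} {HF : Filter F} (f g : T -> C) (l m : C) :
  Clim F f l -> Clim F g m -> Clim F (fun x => f x + g x)%C (l + m)%C.
Proof.
  intros Hf Hg e He. generalize (filter_and (F := F) _ _ (Hf (e/2) ltac:(lra)) (Hg (e/2) ltac:(lra))).
  apply filter_imp; intros x [H1 H2].
  replace (f x + g x - (l + m))%C with ((f x - l) + (g x - m))%C by ring.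
  eapply Rle_lt_trans; [apply Cmod_triangle|lra].
Qed.

Lemma Clim_mult {T : Type} {F : (T -> Prop) -> Prop} {HF : Filter F} (f g : T -> C) (l m : C) :
  Clim F f l -> Clim F g m -> Clim F (fun x => f x * g x)%C (l * m)%C.
Proof.
  intros Hf Hg e He.
  (* If both errors are below d <= 1, the error of the product is below d d + Cmod l d + Cmod m d <=
     d K. *)
  set (K := 1 + Cmod l + Cmod m).
  assert (HK : 1 <= K) by (unfold K; generalize (Cmod_ge_0 l) (Cmod_ge_0 m); lra).
  set (d := Rmin 1 (e / K)).
  assert (Hd : 0 < d) by (apply Rmin_pos; [lra|apply Rdiv_lt_0_compat; lra]).
  assert (Hd1 : d <= 1) by apply Rmin_l.
  assert (Hd2 : d * K <= e).
  { apply Rle_trans with (e / K * K); [apply Rmult_le_compat_r; [lra|apply Rmin_r]|].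
    apply Req_le; field; lra. }
  generalize (filter_and (F := F) _ _ (Hf d Hd) (Hg d Hd)).
  apply filter_imp; intros x [H1 H2].
  replace (f x * g x - l * m)%C
    with ((f x - l) * (g x - m) + (l * (g x - m) + m * (f x - l)))%C by ring.
  eapply Rle_lt_trans; [apply Cmod_triangle|].
  eapply Rle_lt_trans; [apply Rplus_le_compat_l, Cmod_triangle|].
  rewrite !Cmod_mult.
  generalize (Cmod_ge_0 l) (Cmod_ge_0 m) (Cmod_ge_0 (f x - l)) (Cmod_ge_0 (g x - m)).
  unfold K in Hd2. intros. nra.
Qed.

Lemma Clim_opp {T : Type} {F : (T -> Prop) -> Prop} {HF : Filter F} (f : T -> C) (l : C) :
  Clim F f l -> Clim F (fun x => - f x)%C (- l)%C.
Proof.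
  intros H e He. generalize (H e He); apply filter_imp; intros x Hx.
  replace (- f x - - l)%C with (- (f x - l))%C by ring. rewrite Cmod_opp; exact Hx.
Qed.

Lemma Clim_minus {T : Type} {F : (T -> Prop) -> Prop} {HF : Filter F} (f g : T -> C) (l m : C) :
  Clim F f l -> Clim F g m -> Clim F (fun x => f x - g x)%C (l - m)%C.
Proof.
  intros Hf Hg. apply Clim_plus; [exact Hf|]. apply Clim_opp; assumption.
Qed.

Lemma Clim_neq0 {T : Type} {F : (T -> Prop) -> Prop} {HF : Filter F} (f : T -> C) (l : C) :
  l <> 0 -> Clim F f l -> F (fun x => f x <> 0 /\ Cmod l / 2 < Cmod (f x)).
Proof.
  intros Hl H. apply Cmod_gt_0 in Hl.
  generalize (H (Cmod l / 2) ltac:(lra)). apply filter_imp; intros x Hx.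
  assert (Cmod l / 2 < Cmod (f x)).
  { generalize (Cmod_triangle (f x) (- (f x - l)))%C. rewrite Cmod_opp.
    replace (f x + - (f x - l))%C with l by ring. lra. }
  split; [apply Cmod_gt_0; lra|assumption].
Qed.

Lemma Clim_inv {T : Type} {F : (T -> Prop) -> Prop} {HF : Filter F} (f : T -> C) (l : C) :
  l <> 0 -> Clim F f l -> Clim F (fun x => / f x)%C (/ l)%C.
Proof.
  intros Hl H e He. assert (Hl' := proj1 (Cmod_gt_0 _) Hl).
  assert (He' : 0 < e * (Cmod l / 2 * Cmod l)) by (apply Rmult_lt_0_compat; nra).
  generalize (filter_and (F := F) _ _ (Clim_neq0 f l Hl H) (H _ He')).
  apply filter_imp; intros x [[H1 H2] H3].
  replace (/ f x - / l)%C with (- (f x - l) / (f x * l))%C by (field; auto).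
  rewrite Cmod_div, Cmod_opp, Cmod_mult by (apply Cmult_neq_0; assumption).
  apply Rlt_div_l; [nra|].
  eapply Rlt_trans; [exact H3|]. apply Rmult_lt_compat_l; [lra|]. nra.
Qed.

Lemma Clim_div {T : Type} {F : (T -> Prop) -> Prop} {HF : Filter F} (f g : T -> C) (l m : C) :
  m <> 0 -> Clim F f l -> Clim F g m -> Clim F (fun x => f x / g x)%C (l / m)%C.
Proof. intros Hm Hf Hg. apply Clim_mult; auto. apply Clim_inv; auto. Qed.

Lemma Clim_unique {T : Type} {F : (T -> Prop) -> Prop} {HF : ProperFilter F} (f : T -> C) (l m : C) :
  Clim F f l -> Clim F f m -> l = m.
Proof.
  intros Hl Hm.
  destruct (Rle_lt_dec (Cmod (l - m)) 0) as [H|H].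
  - assert (E : Cmod (l - m) = 0) by (generalize (Cmod_ge_0 (l - m)); lra).
    apply Cmod_eq_0 in E. replace l with ((l - m) + m)%C by ring. rewrite E; ring.
  - destruct (filter_ex _ (filter_and (F := F) _ _ (Hl (Cmod (l - m) / 2) ltac:(lra)) (Hm (Cmod (l - m) / 2) ltac:(lra)))) as [x [H1 H2]].
    exfalso. generalize (Cmod_triangle (f x - m) (- (f x - l)))%C. rewrite Cmod_opp.
    replace (f x - m + - (f x - l))%C with (l - m)%C by ring. lra.
Qed.

Lemma Climit_eq {T : Type} {F : (T -> Prop) -> Prop} {HF : ProperFilter F} (f : T -> C) (l : C) :
  Clim F f l -> Climit F f = l.
Proof.
  intros H. apply (iota_unique (V := C_R_CompleteNormedModule)).
  - intros y Hy. apply (Clim_unique f); [|exact H]. apply Clim_iff; [exact Hy].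
  - apply Clim_iff; [exact H].
Qed.

Lemma Clim_le {T : Type} {F : (T -> Prop) -> Prop} {HF : ProperFilter F} (f : T -> C) (l : C) (b : R) :
  F (fun x => Cmod (f x) <= b) -> Clim F f l -> Cmod l <= b.
Proof.
  intros Hb Hl. destruct (Rle_lt_dec (Cmod l) b) as [H|H]; [exact H|exfalso].
  destruct (filter_ex _ (filter_and (F := F) _ _ Hb (Hl (Cmod l - b) ltac:(lra)))) as [x [H1 H2]].
  generalize (Cmod_triangle (f x) (- (f x - l)))%C. rewrite Cmod_opp.
  replace (f x + - (f x - l))%C with l by ring. lra.
Qed.

Lemma Clim_squeeze {T : Type} {F : (T -> Prop) -> Prop} {HF : Filter F} (f : T -> C) (l : C) (g : T -> R) :
  F (fun x => Cmod (f x - l)%C <= g x) -> filterlim g F (locally 0) -> Clim F f l.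
Proof.
  intros H Hg e He.
  specialize (Hg (fun y => Rabs (y - 0) < e)).
  assert (F (fun x => Rabs (g x - 0) < e)).
  { apply Hg. exists (mkposreal e He). intros y Hy; exact Hy. }
  generalize (filter_and (F := F) _ _ H H0). apply filter_imp. intros x [H1 H2].
  rewrite Rminus_0_r in H2. apply Rabs_def2 in H2. lra.
Qed.

Lemma Clim_RtoC {T : Type} {F : (T -> Prop) -> Prop} {HF : Filter F} (f : T -> R) (l : R) :
  filterlim f F (locally l) -> Clim F (fun x => RtoC (f x)) (RtoC l).
Proof.
  intros H e He.
  apply (H (fun y => Cmod (RtoC y - RtoC l)%C < e)).
  exists (mkposreal e He). intros y Hy. rewrite <- RtoC_minus, Cmod_R. exact Hy.
Qed.

Lemma Clim_comp {T U : Type} (F : (T -> Prop) -> Prop) (G : (U -> Prop) -> Prop)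
  (f : T -> U) (g : U -> C) (l : C) :
  filterlim f F G -> Clim G g l -> Clim F (fun x => g (f x)) l.
Proof. intros Hf Hg e He. apply (Hf (fun y => Cmod (g y - l)%C < e)). apply Hg, He. Qed.

Lemma Clim_cauchy {T : Type} {F : (T -> Prop) -> Prop} {HF : ProperFilter F} (f : T -> C) :
  (forall eps, 0 < eps -> exists P : T -> Prop,
     F P /\ forall u v, P u -> P v -> Cmod (f u - f v)%C < eps) ->
  exists l, Clim F f l.
Proof.
  intros H.
  destruct (proj1 (filterlim_locally_cauchy (U := C_CompleteNormedModule) (F := F) f)) as [l Hl].
  - intros e. destruct (H e (cond_pos e)) as [P [HP HP']]. exists P; split; [exact HP|].
    intros u v Hu Hv. apply C_NormedModule_mixin_compat1. apply (HP' v u Hv Hu).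
  - exists l. apply Clim_iff; [exact Hl].
Qed.

Definition Cnear (s0 : C) (P : C -> Prop) : Prop :=
  exists d, 0 < d /\ forall s, Cmod (s - s0)%C < d -> P s.

Lemma locally_Cnear (s0 : C) (P : C -> Prop) :
  locally (s0 : C_UniformSpace) P <-> Cnear s0 P.
Proof.
  split.
  - intros [e He]. exists e; split; [apply cond_pos|]. intros s Hs. apply He.
    apply C_NormedModule_mixin_compat1. exact Hs.
  - intros [d [Hd H]].
    assert (Hs : 0 < sqrt 2) by (apply sqrt_lt_R0; lra).
    assert (He' : 0 < d / sqrt 2) by (apply Rdiv_lt_0_compat; lra).
    exists (mkposreal _ He'). intros y Hy. apply H.
    apply C_NormedModule_mixin_compat2 in Hy. simpl in Hy.
    replace (sqrt 2 * (d / sqrt 2)) with d in Hy by (field; lra). exact Hy.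
Qed.

Notation Cpunct s0 := (locally' (s0 : C_UniformSpace)).

Lemma Cpunct_intro (s0 : C) (P : C -> Prop) (d : R) :
  0 < d -> (forall s, Cmod (s - s0)%C < d -> s <> s0 -> P s) -> Cpunct s0 P.
Proof. intros Hd H. apply locally_Cnear. exists d; split; auto. Qed.

#[global] Instance Cpunct_proper (s0 : C) : ProperFilter (Cpunct s0).
Proof.
  constructor; [|typeclasses eauto].
  intros P HP. apply locally_Cnear in HP. destruct HP as [d [Hd H]].
  exists (s0 + RtoC (d / 2))%C. apply H.
  - replace (s0 + RtoC (d/2) - s0)%C with (RtoC (d/2)) by ring. rewrite Cmod_R, Rabs_pos_eq; lra.
  - intros E. assert (E' : RtoC (d/2) = 0) by (replace (RtoC (d/2)) with (s0 + RtoC (d/2) - s0)%C by ring; rewrite E; ring).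
    apply RtoC_inj in E'. lra.
Qed.

Lemma Clim_Cpunct_id (s0 : C) : Clim (Cpunct s0) (fun s => s) s0.
Proof. intros e He. apply Cpunct_intro with e; auto. Qed.

(** * Complex derivatives *)

Definition is_Cderiv (f : C -> C) (s0 l : C) : Prop :=
  Clim (Cpunct s0) (fun s => (f s - f s0) / (s - s0))%C l.

Lemma Cpunct_neq (s0 : C) : Cpunct s0 (fun s => s <> s0).
Proof. apply Cpunct_intro with 1; [lra|auto]. Qed.

Lemma is_Cderiv_cont (f : C -> C) (s0 l : C) :
  is_Cderiv f s0 l -> Clim (Cpunct s0) f (f s0).
Proof.
  intros H.
  assert (H1 : Clim (Cpunct s0) (fun s => (f s - f s0) / (s - s0) * (s - s0) + f s0)%C (l * (s0 - s0) + f s0)%C).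
  { apply Clim_plus; [|apply Clim_const].
    apply Clim_mult; [exact H|].
    apply Clim_minus; [apply Clim_Cpunct_id|apply Clim_const]. }
  replace (l * (s0 - s0) + f s0)%C with (f s0) in H1 by ring.
  revert H1. apply Clim_ext.
  generalize (Cpunct_neq s0). apply filter_imp. intros s Hs. field. apply Cminus_eq_contra, Hs.
Qed.

Lemma is_Cderiv_ext_loc (f g : C -> C) (s0 l : C) :
  Cnear s0 (fun s => f s = g s) -> is_Cderiv f s0 l -> is_Cderiv g s0 l.
Proof.
  intros [d [Hd H]]. apply Clim_ext.
  apply Cpunct_intro with d; [exact Hd|]. intros s Hs _.
  rewrite (H s Hs), (H s0); [reflexivity|].
  replace (s0 - s0)%C with (RtoC 0) by ring. rewrite Cmod_0; exact Hd.
Qed.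

Lemma is_Cderiv_ext (f g : C -> C) (s0 l : C) :
  (forall s, f s = g s) -> is_Cderiv f s0 l -> is_Cderiv g s0 l.
Proof. intros H. apply is_Cderiv_ext_loc. exists 1; split; [lra|auto]. Qed.

Lemma is_Cderiv_const (c s0 : C) : is_Cderiv (fun _ => c) s0 0.
Proof.
  apply Clim_ext with (f := fun _ => RtoC 0); [|apply Clim_const].
  generalize (Cpunct_neq s0). apply filter_imp. intros s Hs. field. apply Cminus_eq_contra, Hs.
Qed.

Lemma is_Cderiv_id (s0 : C) : is_Cderiv (fun s => s) s0 1.
Proof.
  apply Clim_ext with (f := fun _ => RtoC 1); [|apply Clim_const].
  generalize (Cpunct_neq s0). apply filter_imp. intros s Hs. field. apply Cminus_eq_contra, Hs.
Qed.

Lemma is_Cderiv_plus (f g : C -> C) (s0 l m : C) :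
  is_Cderiv f s0 l -> is_Cderiv g s0 m -> is_Cderiv (fun s => f s + g s)%C s0 (l + m)%C.
Proof.
  intros Hf Hg.
  generalize (Clim_plus _ _ _ _ Hf Hg). apply Clim_ext.
  generalize (Cpunct_neq s0). apply filter_imp. intros s Hs. field. apply Cminus_eq_contra, Hs.
Qed.

Lemma is_Cderiv_mult (f g : C -> C) (s0 l m : C) :
  is_Cderiv f s0 l -> is_Cderiv g s0 m ->
  is_Cderiv (fun s => f s * g s)%C s0 (l * g s0 + f s0 * m)%C.
Proof.
  intros Hf Hg.
  assert (H := Clim_plus _ _ _ _ (Clim_mult _ _ _ _ Hf (is_Cderiv_cont _ _ _ Hg))
                 (Clim_mult _ _ _ _ (Clim_const (f s0)) Hg)).
  revert H. apply Clim_ext.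
  generalize (Cpunct_neq s0). apply filter_imp. intros s Hs. field. apply Cminus_eq_contra, Hs.
Qed.

Lemma is_Cderiv_scal (c : C) (f : C -> C) (s0 l : C) :
  is_Cderiv f s0 l -> is_Cderiv (fun s => c * f s)%C s0 (c * l)%C.
Proof.
  intros Hf. generalize (is_Cderiv_mult _ _ _ _ _ (is_Cderiv_const c s0) Hf).
  replace (0 * f s0 + c * l)%C with (c * l)%C by ring. auto.
Qed.

(** [c <> 0] makes the affine map send punctured neighbourhoods to punctured neighbourhoods, so the
    limit of the difference quotient can be composed with it. *)
Lemma is_Cderiv_affine (f : C -> C) (c d s0 l : C) : c <> 0 ->
  is_Cderiv f (c * s0 + d)%C l -> is_Cderiv (fun s => f (c * s + d)%C) s0 (c * l)%C.
Proof.
  intros Hc H.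
  assert (H1 : filterlim (fun s => c * s + d)%C (Cpunct s0) (Cpunct (c * s0 + d)%C)).
  { intros P HP. apply locally_Cnear in HP. destruct HP as [e [He HP]].
    assert (Hc' := proj1 (Cmod_gt_0 c) Hc).
    apply Cpunct_intro with (e / Cmod c); [apply Rdiv_lt_0_compat; lra|].
    intros s Hs Hne. apply HP.
    - replace (c * s + d - (c * s0 + d))%C with (c * (s - s0))%C by ring.
      rewrite Cmod_mult, Rmult_comm. apply Rlt_div_r; assumption.
    - intros E. apply (Cminus_eq_contra _ _ Hne).
      replace (s - s0)%C with ((c * s + d - (c * s0 + d)) / c)%C by (field; exact Hc).
      rewrite E. field; exact Hc. }
  assert (H2 := Clim_mult _ _ _ _ (Clim_const c) (Clim_comp _ _ _ _ _ H1 H)).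
  revert H2. apply Clim_ext.
  generalize (Cpunct_neq s0). apply filter_imp. intros s Hs.
  replace (c * s + d - (c * s0 + d))%C with (c * (s - s0))%C by ring.
  field; repeat split; try exact Hc; apply Cminus_eq_contra, Hs.
Qed.

(** Since f and g vanish at s0, f / g is the quotient of their difference quotients (L'Hopital's
    rule). It produces the limits at integers. *)
Lemma Cderiv_quot (f g : C -> C) (s0 l m : C) :
  f s0 = 0 -> g s0 = 0 -> m <> 0 -> is_Cderiv f s0 l -> is_Cderiv g s0 m ->
  Clim (Cpunct s0) (fun s => f s / g s)%C (l / m)%C.
Proof.
  intros Hf0 Hg0 Hm Hf Hg.
  assert (H := Clim_div _ _ _ _ Hm Hf Hg).
  revert H. apply Clim_ext.
  assert (Hn := Clim_neq0 _ _ Hm Hg).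
  generalize (filter_and (F := Cpunct s0) _ _ Hn (Cpunct_neq s0)). apply filter_imp. intros s [[H1 _] H2].
  rewrite Hf0, Hg0 in *. apply Cminus_eq_contra in H2.
  assert (g s <> 0).
  { intros E; apply H1; rewrite E. field. exact H2. }
  field; repeat split; auto.
Qed.

(** Exchange of limit and derivative: near s0 the difference quotient of f stays within eps of that
    of a differentiable g, so it is Cauchy. One g for each eps is enough, and nothing is asked of
    the derivatives of the g's. *)
Lemma Clim_switch (f : C -> C) (s0 : C) :
  (forall eps, 0 < eps -> exists (g : C -> C) (l : C), is_Cderiv g s0 l /\
     Cnear s0 (fun s => Cmod ((f s - g s) - (f s0 - g s0))%C <= eps * Cmod (s - s0)%C)) ->
  exists l, is_Cderiv f s0 l.
Proof.
  intros H. apply Clim_cauchy.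
  intros eps He. destruct (H (eps / 4) ltac:(lra)) as [g [l [Hg [d [Hd Hn]]]]].
  exists (fun s => Cmod ((g s - g s0) / (s - s0) - l)%C < eps / 4
           /\ Cmod ((f s - g s) - (f s0 - g s0))%C <= eps / 4 * Cmod (s - s0)%C /\ s <> s0).
  split.
  - apply filter_and; [apply (Hg (eps/4)); lra|].
    apply Cpunct_intro with d; auto.
  - assert (K : forall s, Cmod ((g s - g s0) / (s - s0) - l)%C < eps / 4
           /\ Cmod ((f s - g s) - (f s0 - g s0))%C <= eps / 4 * Cmod (s - s0)%C /\ s <> s0
           -> Cmod ((f s - f s0) / (s - s0) - l)%C < eps / 2).
    { intros s [H1 [H2 H3]]. apply Cminus_eq_contra in H3.
      replace ((f s - f s0) / (s - s0) - l)%C with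
        (((f s - g s) - (f s0 - g s0)) / (s - s0) + ((g s - g s0) / (s - s0) - l))%C by (field; auto).
      eapply Rle_lt_trans; [apply Cmod_triangle|].
      rewrite Cmod_div by auto.
      assert (Cmod (f s - g s - (f s0 - g s0)) / Cmod (s - s0) <= eps / 4)%C.
      { apply Rle_div_l; [apply Cmod_gt_0, H3|exact H2]. }
      lra. }
    intros u v Hu Hv. apply K in Hu, Hv.
    replace ((f u - f s0) / (u - s0) - (f v - f s0) / (v - s0))%C with
      (((f u - f s0) / (u - s0) - l) + - ((f v - f s0) / (v - s0) - l))%C by ring.
    eapply Rle_lt_trans; [apply Cmod_triangle|]. rewrite Cmod_opp. lra.
Qed.

(** * The complex exponential, and derivatives of complex functions of a real variable *)

Lemma C_eq (z w : C) : Re z = Re w -> Im z = Im w -> z = w.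
Proof. destruct z, w; simpl; intros -> ->; reflexivity. Qed.

Lemma Re_Cexp (z : C) : Re (Cexp z) = exp (Re z) * cos (Im z).
Proof. unfold Cexp; simpl; ring. Qed.

Lemma Im_Cexp (z : C) : Im (Cexp z) = exp (Re z) * sin (Im z).
Proof. unfold Cexp; simpl; ring. Qed.

Lemma Cexp_plus (z w : C) : Cexp (z + w)%C = (Cexp z * Cexp w)%C.
Proof.
  apply C_eq; rewrite ?Re_Cexp, ?Im_Cexp, ?re_mult, ?im_mult, ?Re_Cexp, ?Im_Cexp, ?re_plus, ?im_plus.
  - rewrite exp_plus, cos_plus; ring.
  - rewrite exp_plus, sin_plus; ring.
Qed.

Lemma Cexp_RtoC (x : R) : Cexp (RtoC x) = RtoC (exp x).
Proof. apply C_eq; rewrite ?Re_Cexp, ?Im_Cexp; simpl; rewrite ?cos_0, ?sin_0; ring. Qed.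

Lemma Cexp_0 : Cexp 0 = 1.
Proof. rewrite Cexp_RtoC, exp_0; reflexivity. Qed.

Lemma Cmod_Cexp (z : C) : Cmod (Cexp z) = exp (Re z).
Proof.
  unfold Cmod. change (fst (Cexp z)) with (Re (Cexp z)). change (snd (Cexp z)) with (Im (Cexp z)).
  rewrite Re_Cexp, Im_Cexp.
  replace ((exp (Re z) * cos (Im z)) ^ 2 + (exp (Re z) * sin (Im z)) ^ 2) with (exp (Re z) ^ 2).
  - apply sqrt_pow2. left; apply exp_pos.
  - generalize (sin2_cos2 (Im z)); unfold Rsqr; intros E.
    replace (exp (Re z) ^ 2) with (exp (Re z) ^ 2 * (sin (Im z) * sin (Im z) + cos (Im z) * cos (Im z))) by (rewrite E; ring).
    ring.
Qed.

Lemma Cexp_neq0 (z : C) : Cexp z <> 0.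
Proof. apply Cmod_gt_0. rewrite Cmod_Cexp. apply exp_pos. Qed.

Lemma Cexp_opp (z : C) : Cexp (- z)%C = (/ Cexp z)%C.
Proof.
  assert (H : (Cexp (- z) * Cexp z = 1)%C).
  { rewrite <- Cexp_plus. replace (- z + z)%C with (RtoC 0) by ring. apply Cexp_0. }
  replace (/ Cexp z)%C with (Cexp (- z) * Cexp z * / Cexp z)%C by (rewrite H; ring).
  field. apply Cexp_neq0.
Qed.

Lemma Cexp_minus (z w : C) : Cexp (z - w)%C = (Cexp z / Cexp w)%C.
Proof. unfold Cminus, Cdiv. rewrite Cexp_plus, Cexp_opp. reflexivity. Qed.

Lemma Cexp_nat (z : C) (n : nat) : Cexp (RtoC (INR n) * z)%C = (Cexp z ^ n)%C.
Proof.
  induction n as [|n IH].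
  - simpl. replace (0 * z)%C with (RtoC 0) by ring. apply Cexp_0.
  - rewrite S_INR, RtoC_plus. replace ((INR n + 1) * z)%C with (z + INR n * z)%C by ring.
    rewrite Cexp_plus, IH. reflexivity.
Qed.

Lemma Cexp_Cmod_le (z : C) : Cmod (Cexp z) <= exp (Cmod z).
Proof.
  rewrite Cmod_Cexp. generalize (re_le_Cmod z) (Rle_abs (Re z)); intros H1 H2.
  destruct (Rle_lt_or_eq_dec (Re z) (Cmod z)) as [H|H]; [lra| |rewrite H; lra].
  left; apply exp_increasing, H.
Qed.

Lemma is_derive_C (f : R -> C) (x : R) (l : C) :
  is_derive (fun t => Re (f t)) x (Re l) -> is_derive (fun t => Im (f t)) x (Im l) ->
  is_derive (V := C_R_NormedModule) f x l.
Proof.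
  intros H1 H2.
  apply (is_derive_scal_l (V := C_R_NormedModule) _ _ _ (RtoC 1)) in H1.
  apply (is_derive_scal_l (V := C_R_NormedModule) _ _ _ Ci) in H2.
  generalize (is_derive_plus _ _ _ _ _ H1 H2). intros H.
  replace l with (plus (scal (Re l) (RtoC 1 : C_R_NormedModule)) (scal (Im l) (Ci : C_R_NormedModule))).
  - revert H. apply is_derive_ext. intros t. apply injective_projections; simpl; unfold Re, Im, scal, plus; simpl; unfold mult; simpl; ring.
  - apply injective_projections; simpl; unfold Re, Im, scal, plus; simpl; unfold mult; simpl; ring.
Qed.

Lemma is_derive_C_inv (f : R -> C) (x : R) (l : C) :
  is_derive (V := C_R_NormedModule) f x l ->
  is_derive (fun t => Re (f t)) x (Re l) /\ is_derive (fun t => Im (f t)) x (Im l).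
Proof.
  intros H; split.
  - apply (filterdiff_comp' (K := R_AbsRing) (U := R_NormedModule) (V := C_R_NormedModule) (W := R_NormedModule) f (fun z => fst z) x (fun y => scal y l) (fun z => fst z)) in H.
    + exact H.
    + apply filterdiff_linear. apply is_linear_fst.
  - apply (filterdiff_comp' (K := R_AbsRing) (U := R_NormedModule) (V := C_R_NormedModule) (W := R_NormedModule) f (fun z => snd z) x (fun y => scal y l) (fun z => snd z)) in H.
    + exact H.
    + apply filterdiff_linear. apply is_linear_snd.
Qed.

(** * Taylor's formula for the exponential *)

Lemma is_derive_RtoC (f : R -> R) (x l : R) :
  is_derive f x l -> is_derive (V := C_R_NormedModule) (fun t => RtoC (f t)) x (RtoC l).
Proof. intros H. apply is_derive_C; simpl; [exact H|]. apply (is_derive_const (V := R_NormedModule)). Qed.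

Lemma is_derive_Cconst (c : C) (x : R) :
  is_derive (V := C_R_NormedModule) (fun _ => c) x (RtoC 0).
Proof. apply is_derive_C; apply (is_derive_const (V := R_NormedModule)). Qed.

Lemma is_derive_Cmult (f g : R -> C) (x : R) (l m : C) :
  is_derive (V := C_R_NormedModule) f x l -> is_derive (V := C_R_NormedModule) g x m ->
  is_derive (V := C_R_NormedModule) (fun t => f t * g t)%C x (l * g x + f x * m)%C.
Proof.
  intros Hf Hg. apply is_derive_C_inv in Hf, Hg. destruct Hf as [F1 F2], Hg as [G1 G2].
  apply is_derive_C.
  - apply is_derive_ext with (f := fun t => Re (f t) * Re (g t) - Im (f t) * Im (g t)).
    { intros t; rewrite re_mult; reflexivity. }
    rewrite re_plus, !re_mult.
    apply filterdiff_ext_lin with (l1 := fun y => scal y (minus (Re l * Re (g x) + Re (f x) * Re m) (Im l * Im (g x) + Im (f x) * Im m))).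
    + apply (is_derive_minus (V := R_NormedModule)); apply (is_derive_mult (K := R_AbsRing)); auto; apply Rmult_comm.
    + intros y; unfold scal, minus, plus, opp; simpl; unfold mult; simpl; ring.
  - apply is_derive_ext with (f := fun t => Re (f t) * Im (g t) + Im (f t) * Re (g t)).
    { intros t; rewrite im_mult; reflexivity. }
    rewrite im_plus, !im_mult.
    apply filterdiff_ext_lin with (l1 := fun y => scal y (plus (Re l * Im (g x) + Re (f x) * Im m) (Im l * Re (g x) + Im (f x) * Re m))).
    + apply (is_derive_plus (V := R_NormedModule)); apply (is_derive_mult (K := R_AbsRing)); auto; apply Rmult_comm.
    + intros y; unfold scal, minus, plus, opp; simpl; unfold mult; simpl; ring.
Qed.

Lemma is_derive_Cplus (f g : R -> C) (x : R) (l m : C) :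
  is_derive (V := C_R_NormedModule) f x l -> is_derive (V := C_R_NormedModule) g x m ->
  is_derive (V := C_R_NormedModule) (fun t => f t + g t)%C x (l + m)%C.
Proof. apply (is_derive_plus (V := C_R_NormedModule)). Qed.

Lemma is_derive_Cscal (c : C) (f : R -> C) (x : R) (l : C) :
  is_derive (V := C_R_NormedModule) f x l ->
  is_derive (V := C_R_NormedModule) (fun t => c * f t)%C x (c * l)%C.
Proof.
  intros H. replace (c * l)%C with (0 * f x + c * l)%C by ring.
  apply is_derive_Cmult; [apply is_derive_Cconst|exact H].
Qed.

Lemma is_derive_Cexp (f : R -> C) (x : R) (l : C) :
  is_derive (V := C_R_NormedModule) f x l ->
  is_derive (V := C_R_NormedModule) (fun t => Cexp (f t)) x (l * Cexp (f x))%C.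
Proof.
  intros H. apply is_derive_C_inv in H. destruct H as [H1 H2].
  assert (E := is_derive_comp exp (fun t => Re (f t)) x _ _ (is_derive_exp _) H1).
  assert (Cs := is_derive_comp cos (fun t => Im (f t)) x _ _ (is_derive_cos _) H2).
  assert (Sn := is_derive_comp sin (fun t => Im (f t)) x _ _ (is_derive_sin _) H2).
  apply is_derive_C.
  - apply is_derive_ext with (f := fun t => exp (Re (f t)) * cos (Im (f t))).
    { intros t; rewrite Re_Cexp; reflexivity. }
    rewrite re_mult, Re_Cexp, Im_Cexp.
    eapply filterdiff_ext_lin; [apply (is_derive_mult (K := R_AbsRing)); [exact E|exact Cs|apply Rmult_comm]|].
    intros y; unfold scal, minus, plus, opp; simpl; unfold mult, scal; simpl; unfold mult; simpl; ring.
  - apply is_derive_ext with (f := fun t => exp (Re (f t)) * sin (Im (f t))).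
    { intros t; rewrite Im_Cexp; reflexivity. }
    rewrite im_mult, Re_Cexp, Im_Cexp.
    eapply filterdiff_ext_lin; [apply (is_derive_mult (K := R_AbsRing)); [exact E|exact Sn|apply Rmult_comm]|].
    intros y; unfold scal, minus, plus, opp; simpl; unfold mult, scal; simpl; unfold mult; simpl; ring.
Qed.

Lemma is_derive_Clin (c : C) (x : R) :
  is_derive (V := C_R_NormedModule) (fun t => RtoC t * c)%C x c.
Proof.
  assert (H := is_derive_Cmult _ _ _ _ _ (is_derive_RtoC _ x _ (is_derive_id (K := R_AbsRing) x)) (is_derive_Cconst c x)).
  cbv beta in H. change (RtoC (@one R_AbsRing)) with (RtoC 1) in H.
  replace (1 * c + x * 0)%C with c in H by ring. exact H.
Qed.

Lemma is_derive_Cpow (c : C) (n : nat) (x : R) :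
  is_derive (V := C_R_NormedModule) (fun t => (RtoC t * c) ^ S n)%C x (INR (S n) * c * (RtoC x * c) ^ n)%C.
Proof.
  assert (H1 := is_derive_Clin c x).
  induction n as [|n IH].
  - replace (INR 1 * c * (x * c) ^ 0)%C with c by (simpl; ring).
    revert H1. apply is_derive_ext. intros t. simpl. symmetry. apply Cmult_1_r.
  - assert (H2 := is_derive_Cmult _ _ _ _ _ H1 IH).
    revert H2.
    replace (INR (S (S n)) * c * (x * c) ^ S n)%C with (c * (x * c) ^ S n + x * c * (INR (S n) * c * (x * c) ^ n))%C.
    + apply is_derive_ext. intros t. reflexivity.
    + rewrite (S_INR (S n)), RtoC_plus. simpl. ring.
Qed.

Lemma Csum_0 (a : nat -> C) : @eq C (sum_n a 0) (a 0%nat).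
Proof. exact (sum_O a). Qed.

Lemma Csum_S (a : nat -> C) (n : nat) : @eq C (sum_n a (S n)) (sum_n a n + a (S n))%C.
Proof. exact (sum_Sn a n). Qed.

Lemma norm_C_R (z : C) : norm (z : C_R_NormedModule) = Cmod z.
Proof.
  unfold norm; simpl. unfold prod_norm, Cmod. f_equal.
  change (Rabs (fst z) ^ 2 + Rabs (snd z) ^ 2 = fst z ^ 2 + snd z ^ 2).
  rewrite !pow2_abs. reflexivity.
Qed.

(** Both increments are integrals of the derivatives, and the pointwise bound integrates; for
    complex values only such an inequality is available. *)
Lemma C_mean_value (f df : R -> C) (g dg : R -> R) (a b : R) : a <= b ->
  (forall x, a <= x <= b -> is_derive (V := C_R_NormedModule) f x (df x)) ->
  (forall x, a <= x <= b -> continuous (U := C_R_NormedModule) df x) ->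
  (forall x, a <= x <= b -> is_derive g x (dg x)) ->
  (forall x, a <= x <= b -> continuous dg x) ->
  (forall x, a <= x <= b -> Cmod (df x) <= dg x) ->
  Cmod (f b - f a)%C <= g b - g a.
Proof.
  intros Hab Hf Hcf Hg Hcg Hle.
  assert (I1 : is_RInt (V := C_R_NormedModule) df a b (f b - f a)%C).
  { apply (is_RInt_derive (V := C_R_CompleteNormedModule)); intros x Hx; rewrite Rmin_left, Rmax_right in Hx by exact Hab; auto. }
  assert (I2 : is_RInt dg a b (g b - g a)).
  { apply (is_RInt_derive (V := R_CompleteNormedModule)); intros x Hx; rewrite Rmin_left, Rmax_right in Hx by exact Hab; auto. }
  rewrite <- norm_C_R.
  apply (norm_RInt_le (V := C_R_NormedModule) df dg a b _ _ Hab); auto.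
  intros x Hx. rewrite norm_C_R. auto.
Qed.

Definition exp_term (z : C) (k : nat) : C := (z ^ k / INR (fact k))%C.

Lemma INR_fact_neq0C (n : nat) : RtoC (INR (fact n)) <> 0.
Proof. intros E. apply RtoC_inj in E. revert E. apply INR_fact_neq_0. Qed.

Lemma RtoC_INR_S_neq0 (n : nat) : RtoC (INR (S n)) <> 0.
Proof. intros E. apply RtoC_inj in E. revert E. apply not_0_INR; lia. Qed.

Lemma fact_S_C (n : nat) : RtoC (INR (fact (S n))) = (INR (S n) * INR (fact n))%C.
Proof. rewrite fact_simpl, mult_INR, RtoC_mult. reflexivity. Qed.

Lemma is_derive_exp_sum (z : C) (n : nat) (x : R) :
  is_derive (V := C_R_NormedModule) (fun t => sum_n (exp_term (RtoC t * z)) (S n)) x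
    (z * sum_n (exp_term (RtoC x * z)) n)%C.
Proof.
  assert (Hk : forall k, is_derive (V := C_R_NormedModule) (fun t => exp_term (RtoC t * z) (S k)) x (z * exp_term (RtoC x * z) k)%C).
  { intros k. unfold exp_term.
    apply is_derive_ext with (f := fun t => (/ INR (fact (S k)) * (RtoC t * z) ^ S k)%C).
    { intros t. unfold Cdiv. apply Cmult_comm. }
    replace (z * ((x * z) ^ k / INR (fact k)))%C with (/ INR (fact (S k)) * (INR (S k) * z * (x * z) ^ k))%C.
    - apply is_derive_Cscal, is_derive_Cpow.
    - rewrite fact_S_C. field. split; [apply INR_fact_neq0C|apply RtoC_INR_S_neq0]. }
  induction n as [|n IH].
  - apply is_derive_ext with (f := fun t => (1 + exp_term (RtoC t * z) 1)%C).
    { intros t. rewrite Csum_S, Csum_0. unfold exp_term at 2. simpl. f_equal. field. }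
    rewrite Csum_0. replace (z * exp_term (x * z) 0)%C with (0 + z * exp_term (x * z) 0)%C by ring.
    apply is_derive_Cplus; [apply is_derive_Cconst|apply Hk].
  - apply is_derive_ext with (f := fun t => (sum_n (exp_term (RtoC t * z)) (S n) + exp_term (RtoC t * z) (S (S n)))%C).
    { intros t. rewrite (Csum_S _ (S n)). reflexivity. }
    rewrite Csum_S.
    replace (z * (sum_n (exp_term (x * z)) n + exp_term (x * z) (S n)))%C with
     (z * sum_n (exp_term (x * z)) n + z * exp_term (x * z) (S n))%C by ring.
    apply is_derive_Cplus; [exact IH|apply Hk].
Qed.

Lemma is_derive_continuous_C (f : R -> C) (x : R) (l : C) :
  is_derive (V := C_R_NormedModule) f x l -> continuous (U := C_R_NormedModule) f x.
Proof. intros H. apply (ex_derive_continuous (V := C_R_NormedModule)). exists l; exact H. Qed.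

Lemma is_derive_Cexp_lin (z : C) (x : R) :
  is_derive (V := C_R_NormedModule) (fun t => Cexp (RtoC t * z)) x (z * Cexp (RtoC x * z))%C.
Proof.
  apply (is_derive_Cexp (fun t => RtoC t * z)%C). apply is_derive_Clin.
Qed.

(** Along t -> t z the remainder of order n + 1 has as derivative z times the remainder of order n,
    so the induction hypothesis integrates over [0, 1], with a power of t in the majorant. *)
Lemma Cexp_taylor (n : nat) (z : C) :
  Cmod (Cexp z - sum_n (exp_term z) n)%C <= Cmod z ^ S n / INR (fact (S n)) * exp (Cmod z).
Proof.
  revert z; induction n as [|n IH]; intros z.
  - assert (H := C_mean_value (fun t => Cexp (RtoC t * z)) (fun t => (z * Cexp (RtoC t * z))%C)
       (fun t => t * (Cmod z * exp (Cmod z))) (fun t => Cmod z * exp (Cmod z)) 0 1 ltac:(lra)).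
    rewrite Csum_0. unfold exp_term. simpl (fact _). simpl pow. simpl INR. simpl Cpow.
    cbv beta in H. replace (1 * z)%C with z in H by ring. replace (0 * z)%C with (RtoC 0) in H by ring.
    rewrite Cexp_0 in H. replace (1 / 1)%C with (RtoC 1) by field.
    eapply Rle_trans; [apply H|apply Req_le; field].
    + intros x _. apply is_derive_Cexp_lin.
    + intros x _. eapply is_derive_continuous_C. apply is_derive_Cscal, is_derive_Cexp_lin.
    + intros x _. auto_derive; [trivial|ring].
    + intros x _. apply continuous_const.
    + intros x Hx. rewrite Cmod_mult. apply Rmult_le_compat_l; [apply Cmod_ge_0|].
      eapply Rle_trans; [apply Cexp_Cmod_le|].
      rewrite Cmod_mult, Cmod_R, Rabs_pos_eq by lra.
      assert (H0 := Cmod_ge_0 z). destruct (Rle_lt_or_eq_dec (x * Cmod z) (Cmod z) ltac:(nra)) as [L|L]; [left; apply exp_increasing, L|rewrite L; lra].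
  - assert (H := C_mean_value (fun t => Cexp (RtoC t * z) + (-1) * sum_n (exp_term (RtoC t * z)) (S n))%C
       (fun t => (z * Cexp (RtoC t * z) + (-1) * (z * sum_n (exp_term (RtoC t * z)) n))%C)
       (fun t => t ^ S (S n) * (Cmod z ^ S (S n) / INR (fact (S (S n))) * exp (Cmod z)))
       (fun t => t ^ S n * (Cmod z ^ S (S n) / INR (fact (S n)) * exp (Cmod z))) 0 1 ltac:(lra)).
    assert (E0 : @eq C (sum_n (exp_term 0) (S n)) 1).
    { clear. induction n as [|n IH]; rewrite Csum_S.
      - rewrite Csum_0. unfold exp_term; simpl. field.
      - rewrite IH. unfold exp_term. simpl Cpow. unfold Cdiv. ring. }
    cbv beta in H. replace (1 * z)%C with z in H by ring. replace (0 * z)%C with (RtoC 0) in H by ring.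
    rewrite Cexp_0, E0, pow1, pow_i in H by lia.
    replace (Cexp z - sum_n (exp_term z) (S n))%C with (Cexp z + -1 * sum_n (exp_term z) (S n) - (1 + -1 * 1))%C by ring.
    eapply Rle_trans; [apply H|apply Req_le; ring].
    + intros x _. apply is_derive_Cplus; [apply is_derive_Cexp_lin|]. apply is_derive_Cscal, is_derive_exp_sum.
    + intros x _.
      (* [is_derive_exp_sum] covers sums with a successor as upper index; the sum up to 0 is the
         constant 1. *)
      assert (D : exists m, is_derive (V := C_R_NormedModule) (fun t => sum_n (exp_term (RtoC t * z)) n) x m).
      { destruct n as [|n]; [exists (RtoC 0)|eexists; apply is_derive_exp_sum].
        apply (is_derive_ext (V := C_R_NormedModule) (fun _ => RtoC 1)); [|apply is_derive_Cconst].
        intros t. change (@eq C 1 (sum_n (exp_term (RtoC t * z)) 0)). rewrite Csum_0. unfold exp_term; simpl. field. }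
      destruct D as [m Dm].
      eapply is_derive_continuous_C. apply is_derive_Cplus; [apply is_derive_Cscal, is_derive_Cexp_lin|].
      apply is_derive_Cscal, is_derive_Cscal. exact Dm.
    + intros x _.
      replace (x ^ S n * (Cmod z ^ S (S n) / INR (fact (S n)) * exp (Cmod z)))
        with (INR (S (S n)) * x ^ S n * (Cmod z ^ S (S n) / INR (fact (S (S n))) * exp (Cmod z))).
      * set (K := Cmod z ^ S (S n) / INR (fact (S (S n))) * exp (Cmod z)).
        auto_derive; [trivial|]. clearbody K. destruct n; simpl; ring.
      * rewrite (fact_simpl (S n)), mult_INR. field.
        split; [apply INR_fact_neq_0|apply not_0_INR; lia].
    + intros x _. apply (ex_derive_continuous (V := R_NormedModule)). auto_derive. trivial.
    + intros x Hx.
      replace (z * Cexp (x * z) + -1 * (z * sum_n (exp_term (x * z)) n))%C with (z * (Cexp (x * z) - sum_n (exp_term (x * z)) n))%C by ring.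
      rewrite Cmod_mult.
      assert (H0 := Cmod_ge_0 z).
      eapply Rle_trans; [apply Rmult_le_compat_l; [exact H0|apply IH]|].
      rewrite Cmod_mult, Cmod_R, Rabs_pos_eq, Rpow_mult_distr by lra.
      assert (exp (x * Cmod z) <= exp (Cmod z)).
      { destruct (Rle_lt_or_eq_dec (x * Cmod z) (Cmod z) ltac:(nra)) as [L|L]; [left; apply exp_increasing, L|rewrite L; lra]. }
      replace (x ^ S n * (Cmod z ^ S (S n) / INR (fact (S n)) * exp (Cmod z))) with
        (Cmod z * (x ^ S n * Cmod z ^ S n / INR (fact (S n)) * exp (Cmod z))) by (change (Cmod z ^ S (S n)) with (Cmod z * Cmod z ^ S n); field; apply INR_fact_neq_0).
      apply Rmult_le_compat_l; [exact H0|]. apply Rmult_le_compat_l; [|exact H1].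
      apply Rmult_le_pos; [apply Rmult_le_pos; apply pow_le; lra|]. left. apply Rinv_0_lt_compat, INR_fact_lt_0.
Qed.

Lemma exp_le (x y : R) : x <= y -> exp x <= exp y.
Proof. intros [H|H]; [left; apply exp_increasing, H|rewrite H; apply Rle_refl]. Qed.

(** * The Euler-Gauss product *)

Lemma Cexp_sub1_le (h : C) : Cmod (Cexp h - 1)%C <= Cmod h * exp (Cmod h).
Proof.
  generalize (Cexp_taylor 0 h). rewrite Csum_0. unfold exp_term; simpl.
  replace (1 / 1)%C with (RtoC 1) by field. intros H. eapply Rle_trans; [exact H|]. apply Req_le; field.
Qed.

Lemma Cexp_sub2_le (h : C) : Cmod (Cexp h - 1 - h)%C <= Cmod h ^ 2 * exp (Cmod h).
Proof.
  generalize (Cexp_taylor 1 h). rewrite Csum_S, Csum_0. unfold exp_term; simpl.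
  replace (Cexp h - (1 / 1 + h * 1 / 1))%C with (Cexp h - 1 - h)%C by field.
  intros H. eapply Rle_trans; [exact H|].
  apply Rmult_le_compat_r; [left; apply exp_pos|].
  assert (H0 := Cmod_ge_0 h). replace (1 + 1) with 2 by ring. nra.
Qed.

(** The function e^x - 1 - x has derivative e^x - 1, which is small near 0, so its Lipschitz
    constant shrinks with the arguments. This gains the second factor 1/n in
    [gauss_factor_lipschitz]. *)
Lemma Cexp_sub2_lipschitz (x y : C) :
  Cmod ((Cexp x - 1 - x) - (Cexp y - 1 - y))%C
    <= Cmod (x - y)%C * (Cmod (x - y)%C + Cmod y) * exp (Cmod y + Cmod (x - y)%C).
Proof.
  set (h := (x - y)%C).
  replace ((Cexp x - 1 - x) - (Cexp y - 1 - y))%C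
    with (Cexp y * (Cexp h - 1 - h) + (Cexp y - 1) * h)%C.
  2:{ replace (Cexp x) with (Cexp y * Cexp h)%C by (rewrite <- Cexp_plus; f_equal; unfold h; ring).
      unfold h; ring. }
  eapply Rle_trans; [apply Cmod_triangle|]. rewrite !Cmod_mult.
  assert (Hh := Cmod_ge_0 h). assert (Hy := Cmod_ge_0 y).
  assert (H1 : Cmod (Cexp y) * Cmod (Cexp h - 1 - h) <= exp (Cmod y) * (Cmod h ^ 2 * exp (Cmod h))).
  { apply Rmult_le_compat; try apply Cmod_ge_0; [apply Cexp_Cmod_le|apply Cexp_sub2_le]. }
  assert (H2 : Cmod (Cexp y - 1) * Cmod h <= Cmod y * exp (Cmod y + Cmod h) * Cmod h).
  { apply Rmult_le_compat_r; [exact Hh|]. eapply Rle_trans; [apply Cexp_sub1_le|].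
    apply Rmult_le_compat_l; [exact Hy|]. apply exp_le; lra. }
  rewrite exp_plus in *. nra.
Qed.

(* Quotient of consecutive terms of the Euler-Gauss product. *)
Definition gauss_factor (n : nat) (s : C) : C :=
  ((1 + s / INR (S n)) * Cexp (s * ln (INR n / INR (S n))))%C.

Lemma ln_le_sub1 (x : R) : 0 < x -> ln x <= x - 1.
Proof.
  intros Hx. rewrite <- (ln_exp (x - 1)).
  apply ln_le; [exact Hx|]. generalize (exp_ineq1_le (x - 1)); lra.
Qed.

(** Both bounds are ln x <= x - 1, applied to the ratio and to its inverse. The leading term -
    1/(n+1) is the one that cancels s/(n+1) in [gauss_factor]. *)
Lemma ln_ratio_bounds (n : nat) : (1 <= n)%nat ->
  - / INR (S n) - 2 / INR (S n) ^ 2 <= ln (INR n / INR (S n)) <= - / INR (S n).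
Proof.
  intros Hn. assert (H1 : 1 <= INR n) by (apply (le_INR 1); exact Hn).
  rewrite S_INR. set (x := INR n) in *.
  assert (Hp : 0 < x / (x + 1)) by (apply Rdiv_lt_0_compat; lra). split.
  - replace (ln (x / (x + 1))) with (- ln (/ (x / (x + 1)))) by (rewrite ln_Rinv by exact Hp; ring).
    assert (H := ln_le_sub1 (/ (x / (x + 1))) (Rinv_0_lt_compat _ Hp)).
    assert (E : / (x / (x + 1)) - 1 <= / (x + 1) + 2 / (x + 1) ^ 2).
    { replace (/ (x / (x + 1)) - 1) with (/ x) by (field; lra).
      replace (/ (x + 1) + 2 / (x + 1) ^ 2) with ((x + 3) / (x + 1) ^ 2) by (field; lra).
      apply Rle_div_r; [nra|]. replace (/ x * (x + 1) ^ 2) with (x + 2 + / x) by (field; lra).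
      assert (/ x <= 1) by (rewrite <- Rinv_1; apply Rinv_le_contravar; lra). lra. }
    lra.
  - eapply Rle_trans; [apply ln_le_sub1, Hp|]. apply Req_le; field; lra.
Qed.

(** The first-order terms of 1 + s/(n+1) and of (n/(n+1))^s cancel, in the factor itself and in its
    differences with respect to s. The summable bound 1/(n+1)^2 is what makes the product
    converge. *)
Lemma gauss_factor_lipschitz (r : R) : 0 < r ->
  exists K, 0 < K /\ forall n s t, (1 <= n)%nat -> Cmod s <= r -> Cmod t <= r ->
    Cmod (gauss_factor n s - gauss_factor n t)%C <= K / INR (S n) ^ 2 * Cmod (s - t)%C.
Proof.
  intros Hr.
  (* The three summands are the constants of the bounds [A1], [A2] and [A3] below. *)
  exists (4 * r ^ 2 * exp r + (1 + r) * (12 * r * exp (3 * r)) + (2 + 4 * r)).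
  assert (P1 := exp_pos r). assert (P3 := exp_pos (3 * r)). split; [nra|].
  intros n s t Hn Hs Ht.
  assert (Hb := ln_ratio_bounds n Hn).
  set (l := ln (INR n / INR (S n))) in *.
  assert (Hk : 2 <= INR (S n)) by (rewrite S_INR; generalize (le_INR 1 n Hn); simpl; lra).
  set (k := INR (S n)) in *.
  set (u := / k).
  assert (Hu : 0 < u) by (apply Rinv_0_lt_compat; lra).
  assert (Hu2 : u <= 1 / 2) by (unfold u; replace (1/2) with (/ 2) by field; apply Rinv_le_contravar; lra).
  replace (2 / k ^ 2) with (2 * u ^ 2) in Hb by (unfold u; field; lra).
  replace ((4 * r ^ 2 * exp r + (1 + r) * (12 * r * exp (3 * r)) + (2 + 4 * r)) / k ^ 2)
    with ((4 * r ^ 2 * exp r + (1 + r) * (12 * r * exp (3 * r)) + (2 + 4 * r)) * u ^ 2) by (unfold u; field; lra).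
  fold u in Hb.
  assert (Hl : Rabs l <= 2 * u) by (apply Rabs_le; nra).
  assert (Hd : Rabs (u + l) <= 2 * u ^ 2) by (apply Rabs_le; nra).
  assert (Hku : RtoC k <> 0) by (intros E; apply RtoC_inj in E; lra).
  assert (Eu : RtoC u = (/ k)%C) by (unfold u; rewrite RtoC_inv; [reflexivity|lra]).
  set (E := fun x : C => (Cexp x - 1 - x)%C).
  set (D := Cmod (s - t)%C). assert (HD : 0 <= D) by apply Cmod_ge_0.
  unfold gauss_factor. fold k l.
  (* With exp x = 1 + x + E x the first-order parts collect into (s - t) (u + l), where u + l =
     O(u^2); every other term carries at least two small factors. *)
  replace ((1 + s / k) * Cexp (s * l) - (1 + t / k) * Cexp (t * l))%C
    with ((s - t) * u * E (s * l)%C + (1 + t * u) * (E (s * l)%C - E (t * l)%C)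
          + ((s - t) * (RtoC (u + l)) + (s - t) * (s + t) * (u * l)))%C.
  2:{ unfold E. rewrite RtoC_plus, Eu. field. exact Hku. }
  assert (Hsl : forall x, Cmod x <= r -> Cmod (x * l)%C <= 2 * r * u).
  { intros x Hx. rewrite Cmod_mult, Cmod_R. generalize (Cmod_ge_0 x) (Rabs_pos l); nra. }
  assert (A1 : Cmod ((s - t) * u * E (s * l))%C <= 4 * r ^ 2 * exp r * u ^ 2 * D).
  { rewrite !Cmod_mult, Cmod_R, (Rabs_pos_eq u) by lra. fold D.
    assert (Cmod (E (s * l)%C) <= (2 * r * u) ^ 2 * exp r).
    { eapply Rle_trans; [apply Cexp_sub2_le|]. specialize (Hsl s Hs).
      apply Rmult_le_compat; [apply pow_le, Cmod_ge_0|left; apply exp_pos| |apply exp_le; nra].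
      apply pow_incr; split; [apply Cmod_ge_0|exact Hsl]. }
    apply Rle_trans with (D * u * ((2 * r * u) ^ 2 * exp r)).
    - apply Rmult_le_compat_l; [nra|assumption].
    - replace (D * u * ((2 * r * u) ^ 2 * exp r)) with (4 * r ^ 2 * exp r * u ^ 2 * D * u) by ring.
      assert (0 <= 4 * r ^ 2 * exp r * u ^ 2 * D) by (repeat apply Rmult_le_pos; try apply pow_le; lra).
      nra. }
  assert (A2 : Cmod ((1 + t * u) * (E (s * l) - E (t * l)))%C <= (1 + r) * (12 * r * exp (3 * r)) * u ^ 2 * D).
  { rewrite Cmod_mult.
    assert (B1 : Cmod (1 + t * u)%C <= 1 + r).
    { eapply Rle_trans; [apply Cmod_triangle|]. rewrite Cmod_1, Cmod_mult, Cmod_R, (Rabs_pos_eq u) by lra.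
      generalize (Cmod_ge_0 t); nra. }
    assert (B2 : Cmod (E (s * l) - E (t * l))%C <= (2 * u * D) * (6 * r * u) * exp (3 * r)).
    { unfold E. eapply Rle_trans; [apply Cexp_sub2_lipschitz|].
      assert (Q1 : Cmod (s * l - t * l)%C <= 2 * u * D).
      { replace (s * l - t * l)%C with ((s - t) * l)%C by ring. rewrite Cmod_mult, Cmod_R. fold D.
        generalize (Rabs_pos l); nra. }
      assert (Q2 : D <= 2 * r).
      { unfold D. eapply Rle_trans; [apply Cmod_triangle|]. rewrite Cmod_opp. lra. }
      assert (Q3 := Hsl t Ht). assert (Q4 := Cmod_ge_0 (s * l - t * l)%C). assert (Q5 := Cmod_ge_0 (t * l)%C).
      assert (Q6 : u * D <= u * (2 * r)) by (apply Rmult_le_compat_l; lra).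
      apply Rmult_le_compat; [nra|left; apply exp_pos| |apply exp_le; nra].
      apply Rmult_le_compat; try nra. }
    eapply Rle_trans; [apply Rmult_le_compat; [apply Cmod_ge_0|apply Cmod_ge_0|exact B1|exact B2]|].
    apply Req_le; ring. }
  assert (A3 : Cmod ((s - t) * (RtoC (u + l)) + (s - t) * (s + t) * (u * l))%C <= (2 + 4 * r) * u ^ 2 * D).
  { eapply Rle_trans; [apply Cmod_triangle|]. rewrite !Cmod_mult, !Cmod_R, (Rabs_pos_eq u) by lra. fold D.
    assert (Cmod (s + t)%C <= 2 * r) by (eapply Rle_trans; [apply Cmod_triangle|lra]).
    assert (D * Rabs (u + l) <= D * (2 * u ^ 2)) by (apply Rmult_le_compat_l; lra).
    assert (u * Rabs l <= u * (2 * u)) by (apply Rmult_le_compat_l; lra).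
    assert (Cmod (s + t) * (u * Rabs l) <= 2 * r * (u * (2 * u))).
    { apply Rmult_le_compat; auto; [apply Cmod_ge_0|]. generalize (Rabs_pos l); nra. }
    assert (D * (Cmod (s + t) * (u * Rabs l)) <= D * (2 * r * (u * (2 * u)))) by (apply Rmult_le_compat_l; assumption).
    lra. }
  eapply Rle_trans; [apply Cmod_triangle|].
  eapply Rle_trans; [apply Rplus_le_compat_r, Cmod_triangle|]. lra.
Qed.

Lemma Carg_pos (x : R) : 0 < x -> Carg (RtoC x) = 0.
Proof.
  intros Hx. unfold Carg. simpl. destruct (Rle_dec 0 0) as [_|H]; [|lra].
  rewrite Cmod_R, Rabs_pos_eq by lra. replace (x / x) with 1 by (field; lra). apply acos_1.
Qed.

Lemma cpow_pos (x : R) (a : C) : 0 < x -> cpow (RtoC x) a = Cexp (a * ln x)%C.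
Proof.
  intros Hx. unfold cpow, Clog. rewrite Carg_pos, Cmod_R, Rabs_pos_eq by lra.
  f_equal. ring.
Qed.

Lemma cpow_neq0 (z a : C) : cpow z a <> 0.
Proof. apply Cexp_neq0. Qed.

Definition gauss_prod (n : nat) (s : C) : C :=
  (rising s (S n) / (INR (fact n) * cpow (INR n) s))%C.

Lemma INR_S_pos (n : nat) : 0 < INR (S n).
Proof. apply lt_0_INR; lia. Qed.

Lemma gauss_prod_S (n : nat) (s : C) : (1 <= n)%nat ->
  gauss_prod (S n) s = (gauss_prod n s * gauss_factor n s)%C.
Proof.
  intros Hn. assert (Hp : 0 < INR n) by (apply lt_0_INR; lia). assert (Hp' := INR_S_pos n).
  unfold gauss_prod, gauss_factor. rewrite !cpow_pos by assumption.
  rewrite ln_div by assumption. rewrite fact_S_C.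
  change (rising s (S (S n))) with (rising s (S n) * (s + INR (S n)))%C.
  rewrite RtoC_minus. replace (s * (ln (INR n) - ln (INR (S n))))%C with (s * ln (INR n) - s * ln (INR (S n)))%C by ring.
  rewrite Cexp_minus. field. repeat split; try apply Cexp_neq0; try apply INR_fact_neq0C; apply RtoC_INR_S_neq0.
Qed.

Lemma gauss_prod_1 (s : C) : gauss_prod 1 s = (s * (s + 1))%C.
Proof.
  unfold gauss_prod. rewrite cpow_pos by (simpl; lra). simpl. rewrite ln_1.
  replace (s * 0)%C with (RtoC 0) by ring. rewrite Cexp_0. field.
Qed.

Lemma gauss_factor_0 (n : nat) : gauss_factor n 0 = 1.
Proof.
  unfold gauss_factor. replace (0 * ln (INR n / INR (S n)))%C with (RtoC 0) by ring. rewrite Cexp_0.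
  field. apply RtoC_INR_S_neq0.
Qed.

Lemma inv_sq_telescope (n : nat) : (1 <= n)%nat ->
  / INR (S n) ^ 2 <= / INR n - / INR (S n).
Proof.
  intros Hn. assert (Hp : 1 <= INR n) by (apply (le_INR 1); lia). rewrite S_INR.
  replace (/ INR n - / (INR n + 1)) with (/ (INR n * (INR n + 1))) by (field; lra).
  apply Rinv_le_contravar; nra.
Qed.

(** A discrete Gronwall inequality: the product of the 1 + c / k^2 is at most the exponential of c
    times a telescoping sum below 1. *)
Lemma growth_bound (d : nat -> R) (c : R) : 0 <= c ->
  (forall n, (1 <= n)%nat -> 0 <= d n) ->
  (forall n, (1 <= n)%nat -> d (S n) <= d n * (1 + c / INR (S n) ^ 2)) ->
  forall n, (1 <= n)%nat -> d n <= d 1%nat * exp c.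
Proof.
  intros Hc Hd HS.
  assert (H : forall n, (1 <= n)%nat -> d n <= d 1%nat * exp (c * (1 - / INR n))).
  { intros n Hn. induction Hn as [|n Hn IH].
    - simpl. replace (c * (1 - / 1)) with 0 by field. rewrite exp_0; lra.
    - eapply Rle_trans; [apply HS, Hn|].
      replace (c * (1 - / INR (S n))) with (c * (1 - / INR n) + c * (/ INR n - / INR (S n))) by ring.
      rewrite exp_plus, <- Rmult_assoc.
      assert (H2 := inv_sq_telescope n Hn).
      apply Rmult_le_compat; [apply Hd, Hn| |exact IH|].
      + assert (0 <= c / INR (S n) ^ 2); [|lra]. apply Rmult_le_pos; [exact Hc|].
        left. apply Rinv_0_lt_compat, pow_lt, INR_S_pos.
      + eapply Rle_trans; [|apply exp_ineq1_le]. apply Rplus_le_compat_l.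
        apply Rmult_le_compat_l; assumption. }
  intros n Hn. eapply Rle_trans; [apply H, Hn|].
  apply Rmult_le_compat_l; [apply Hd; lia|]. apply exp_le.
  assert (0 < / INR n) by (apply Rinv_0_lt_compat, lt_0_INR; lia). nra.
Qed.

(** The second estimate says that the increments of the product from n to m are not only small but
    have a small Lipschitz constant in s. Letting m tend to infinity turns it into the hypothesis of
    [Clim_switch] for 1/Gamma. *)
Lemma gauss_prod_diff_lipschitz (r : R) : 0 < r ->
  exists K, 0 < K /\
   (forall n s t, (1 <= n)%nat -> Cmod s <= r -> Cmod t <= r ->
      Cmod (gauss_prod n s - gauss_prod n t)%C <= K * Cmod (s - t)%C) /\
   (forall n m s t, (1 <= n <= m)%nat -> Cmod s <= r -> Cmod t <= r ->
      Cmod ((gauss_prod m s - gauss_prod n s) - (gauss_prod m t - gauss_prod n t))%C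
        <= K / INR n * Cmod (s - t)%C).
Proof.
  intros Hr. destruct (gauss_factor_lipschitz r Hr) as [K [HK HL]].
  assert (H0 : Cmod 0 <= r) by (rewrite Cmod_0; lra).
  assert (Hpp : forall n, 0 < / INR (S n) ^ 2) by (intros n; apply Rinv_0_lt_compat, pow_lt, INR_S_pos).
  assert (HL1 : forall n s, (1 <= n)%nat -> Cmod s <= r -> Cmod (gauss_factor n s - 1)%C <= K * r / INR (S n) ^ 2).
  { intros n s Hn Hs. rewrite <- (gauss_factor_0 n). eapply Rle_trans; [apply (HL n s 0 Hn Hs H0)|].
    replace (s - 0)%C with s by ring. unfold Rdiv. specialize (Hpp n).
    apply Rle_trans with (K * / INR (S n) ^ 2 * r); [apply Rmult_le_compat_l; [nra|exact Hs]|apply Req_le; ring]. }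
  assert (HL2 : forall n s, (1 <= n)%nat -> Cmod s <= r -> Cmod (gauss_factor n s)%C <= 1 + K * r / INR (S n) ^ 2).
  { intros n s Hn Hs. replace (gauss_factor n s) with (1 + (gauss_factor n s - 1))%C by ring.
    eapply Rle_trans; [apply Cmod_triangle|]. rewrite Cmod_1. apply Rplus_le_compat_l, HL1; assumption. }
  set (M := r * (r + 1) * exp (K * r)).
  assert (Pe := exp_pos (K * r)).
  assert (HM0 : 0 < M) by (unfold M; apply Rmult_lt_0_compat; [nra|exact Pe]).
  assert (HM : forall n s, (1 <= n)%nat -> Cmod s <= r -> Cmod (gauss_prod n s) <= M).
  { intros n s Hn Hs.
    eapply Rle_trans; [apply (growth_bound (fun n => Cmod (gauss_prod n s)) (K * r))|].
    - nra.
    - intros; apply Cmod_ge_0.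
    - intros k Hk. rewrite gauss_prod_S, Cmod_mult by exact Hk.
      apply Rmult_le_compat_l; [apply Cmod_ge_0|apply HL2; assumption].
    - exact Hn.
    - rewrite gauss_prod_1, Cmod_mult. unfold M.
      apply Rmult_le_compat_r; [lra|].
      apply Rmult_le_compat; try apply Cmod_ge_0; [exact Hs|].
      eapply Rle_trans; [apply Cmod_triangle|]. rewrite Cmod_1; lra. }
  set (L := (2 * r + 1 + M / r) * exp (K * r)).
  assert (HMr : 0 < M / r) by (apply Rdiv_lt_0_compat; lra).
  assert (HL0 : 0 < L) by (unfold L; apply Rmult_lt_0_compat; lra).
  assert (HLip : forall n s t, (1 <= n)%nat -> Cmod s <= r -> Cmod t <= r ->
      Cmod (gauss_prod n s - gauss_prod n t)%C <= L * Cmod (s - t)%C).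
  { intros n s t Hn Hs Ht. assert (HD := Cmod_ge_0 (s - t)%C).
    (* The recursion for the difference has the inhomogeneous term M K / (k + 1)^2 Cmod (s - t).
       Adding the constant M / r Cmod (s - t) to the difference makes it homogeneous with rate K r,
       as [growth_bound] requires. *)
    apply Rle_trans with (Cmod (gauss_prod n s - gauss_prod n t)%C + M / r * Cmod (s - t)%C); [nra|].
    eapply Rle_trans; [apply (growth_bound (fun n => Cmod (gauss_prod n s - gauss_prod n t)%C + M / r * Cmod (s - t)%C) (K * r))|].
    - nra.
    - intros k _. generalize (Cmod_ge_0 (gauss_prod k s - gauss_prod k t)%C). nra.
    - intros k Hk. rewrite !gauss_prod_S by exact Hk.
      replace (gauss_prod k s * gauss_factor k s - gauss_prod k t * gauss_factor k t)%C with
       ((gauss_prod k s - gauss_prod k t) * gauss_factor k s + gauss_prod k t * (gauss_factor k s - gauss_factor k t))%C by ring.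
      assert (T1 : Cmod ((gauss_prod k s - gauss_prod k t) * gauss_factor k s)%C <= Cmod (gauss_prod k s - gauss_prod k t)%C * (1 + K * r / INR (S k) ^ 2)).
      { rewrite Cmod_mult. apply Rmult_le_compat_l; [apply Cmod_ge_0|apply HL2; assumption]. }
      assert (T2 : Cmod (gauss_prod k t * (gauss_factor k s - gauss_factor k t))%C <= M * (K / INR (S k) ^ 2 * Cmod (s - t)%C)).
      { rewrite Cmod_mult. apply Rmult_le_compat; try apply Cmod_ge_0; [apply HM; assumption|apply HL; assumption]. }
      eapply Rle_trans; [apply Rplus_le_compat_r, Cmod_triangle|].
      replace (M * (K / INR (S k) ^ 2 * Cmod (s - t)%C)) with (M / r * Cmod (s - t)%C * (K * r / INR (S k) ^ 2)) in T2.
      2:{ field. split; [generalize (INR_S_pos k); lra|lra]. }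
      lra.
    - exact Hn.
    - rewrite !gauss_prod_1. unfold L.
      replace (s * (s + 1) - t * (t + 1))%C with ((s - t) * (s + t + 1))%C by ring. rewrite Cmod_mult.
      assert (Cmod (s + t + 1)%C <= 2 * r + 1).
      { eapply Rle_trans; [apply Cmod_triangle|]. rewrite Cmod_1. apply Rplus_le_compat_r.
        eapply Rle_trans; [apply Cmod_triangle|]. lra. }
      replace ((2 * r + 1 + M / r) * exp (K * r) * Cmod (s - t)%C) with ((Cmod (s - t)%C * (2 * r + 1) + M / r * Cmod (s - t)%C) * exp (K * r)) by ring.
      apply Rmult_le_compat_r; [lra|]. apply Rplus_le_compat_r, Rmult_le_compat_l; assumption. }
  (* An increment is the product times (factor - 1); its difference between s and t splits into two
     terms, bounded by L K r and by M K. *)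
  set (Q := L * (K * r) + M * K).
  assert (HQ : 0 < Q) by (unfold Q; apply Rplus_lt_0_compat; repeat apply Rmult_lt_0_compat; lra).
  assert (Hstep : forall n s t, (1 <= n)%nat -> Cmod s <= r -> Cmod t <= r ->
      Cmod ((gauss_prod (S n) s - gauss_prod n s) - (gauss_prod (S n) t - gauss_prod n t))%C
        <= Q * (/ INR n - / INR (S n)) * Cmod (s - t)%C).
  { intros n s t Hn Hs Ht. rewrite !gauss_prod_S by exact Hn.
    assert (HD := Cmod_ge_0 (s - t)%C).
    replace ((gauss_prod n s * gauss_factor n s - gauss_prod n s) - (gauss_prod n t * gauss_factor n t - gauss_prod n t))%C
      with ((gauss_prod n s - gauss_prod n t) * (gauss_factor n s - 1) + gauss_prod n t * (gauss_factor n s - gauss_factor n t))%C by ring.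
    apply Rle_trans with (Q * / INR (S n) ^ 2 * Cmod (s - t)%C).
    2:{ apply Rmult_le_compat_r; [exact HD|]. apply Rmult_le_compat_l; [lra|]. apply inv_sq_telescope, Hn. }
    eapply Rle_trans; [apply Cmod_triangle|]. rewrite !Cmod_mult.
    assert (T1 : Cmod (gauss_prod n s - gauss_prod n t)%C * Cmod (gauss_factor n s - 1)%C <= L * Cmod (s - t)%C * (K * r / INR (S n) ^ 2)).
    { apply Rmult_le_compat; try apply Cmod_ge_0; [apply HLip; assumption|apply HL1; assumption]. }
    assert (T2 : Cmod (gauss_prod n t)%C * Cmod (gauss_factor n s - gauss_factor n t)%C <= M * (K / INR (S n) ^ 2 * Cmod (s - t)%C)).
    { apply Rmult_le_compat; try apply Cmod_ge_0; [apply HM; assumption|apply HL; assumption]. }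
    unfold Q. unfold Rdiv in T1, T2. lra. }
  exists (L + Q). split; [lra|]. split.
  - intros n s t Hn Hs Ht. eapply Rle_trans; [apply HLip; assumption|].
    apply Rmult_le_compat_r; [apply Cmod_ge_0|lra].
  - intros n m s t [Hn Hm] Hs Ht. assert (HD := Cmod_ge_0 (s - t)%C).
    assert (Hn' : 0 < / INR n) by (apply Rinv_0_lt_compat, lt_0_INR; lia).
    apply Rle_trans with (Q * (/ INR n - / INR m) * Cmod (s - t)%C).
    + induction Hm as [|m Hm IH].
      * replace (gauss_prod n s - gauss_prod n s - (gauss_prod n t - gauss_prod n t))%C with (RtoC 0) by ring.
        rewrite Cmod_0. apply Req_le; ring.
      * replace (gauss_prod (S m) s - gauss_prod n s - (gauss_prod (S m) t - gauss_prod n t))%C with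
         ((gauss_prod m s - gauss_prod n s - (gauss_prod m t - gauss_prod n t)) + (gauss_prod (S m) s - gauss_prod m s - (gauss_prod (S m) t - gauss_prod m t)))%C by ring.
        eapply Rle_trans; [apply Cmod_triangle|]. specialize (Hstep m s t ltac:(lia) Hs Ht). lra.
    + apply Rmult_le_compat_r; [exact HD|].
      assert (0 < / INR m) by (apply Rinv_0_lt_compat, lt_0_INR; lia).
      unfold Rdiv. nra.
Qed.

Lemma rising_0_S (n : nat) : rising 0 (S n) = 0.
Proof.
  induction n as [|n IH]; [simpl; ring|].
  change (rising 0 (S (S n))) with (rising 0 (S n) * (0 + INR (S n)))%C. rewrite IH; ring.
Qed.

Lemma gauss_prod_0 (n : nat) : gauss_prod n 0 = 0.
Proof. unfold gauss_prod. rewrite rising_0_S. unfold Cdiv. ring. Qed.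

Lemma Clim_eventually_le (a : nat -> C) (l : C) :
  (exists K, forall n, (1 <= n)%nat -> Cmod (a n - l)%C <= K / INR n) -> Clim eventually a l.
Proof.
  intros [K H]. apply Clim_squeeze with (g := fun n => K * / INR n).
  - exists 1%nat. intros n Hn. apply H, Hn.
  - replace (locally 0) with (Rbar_locally (Rbar_mult (Finite K) (Finite 0))) by (simpl; rewrite Rmult_0_r; reflexivity).
    apply (is_lim_seq_scal_l (fun n => / INR n) K 0).
    apply (is_lim_seq_inv INR p_infty is_lim_seq_INR). discriminate.
Qed.

Lemma gauss_prod_cv (s : C) : Clim eventually (fun n => gauss_prod n s) (rGamma s).
Proof.
  assert (H : exists l, Clim eventually (fun n => gauss_prod n s) l).
  { apply Clim_cauchy.
    set (r := Cmod s + 1). assert (Hs := Cmod_ge_0 s).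
    destruct (gauss_prod_diff_lipschitz r ltac:(unfold r; lra)) as [K [HK [_ HL]]].
    intros e He.
    destruct (archimed_cor1 (e / (2 * K * r)) ltac:(apply Rdiv_lt_0_compat; unfold r; nra)) as [N [HN1 HN2]].
    assert (B : forall n, (N <= n)%nat -> Cmod (gauss_prod n s - gauss_prod N s)%C < e / 2).
    { intros n Hn. specialize (HL N n s 0 ltac:(lia) ltac:(unfold r; lra) ltac:(rewrite Cmod_0; unfold r; lra)).
      rewrite !gauss_prod_0 in HL.
      replace (gauss_prod n s - gauss_prod N s - (0 - 0))%C with (gauss_prod n s - gauss_prod N s)%C in HL by ring.
      replace (s - 0)%C with s in HL by ring.
      eapply Rle_lt_trans; [exact HL|].
      assert (0 < / INR N) by (apply Rinv_0_lt_compat, lt_0_INR; lia).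
      apply Rle_lt_trans with (K * / INR N * r).
      - apply Rmult_le_compat_l; [unfold Rdiv; nra|unfold r; lra].
      - apply Rmult_lt_compat_l with (r := K * r) in HN1; [|unfold r; nra].
        replace (K * r * (e / (2 * K * r))) with (e / 2) in HN1 by (field; unfold r; lra). lra. }
    exists (fun n => (N <= n)%nat). split; [exists N; auto|].
    intros u v Hu Hv.
    replace (gauss_prod u s - gauss_prod v s)%C with ((gauss_prod u s - gauss_prod N s) + - (gauss_prod v s - gauss_prod N s))%C by ring.
    eapply Rle_lt_trans; [apply Cmod_triangle|]. rewrite Cmod_opp.
    generalize (B u Hu) (B v Hv); lra. }
  destruct H as [l Hl]. replace (rGamma s) with l; [exact Hl|].
  symmetry. apply Climit_eq; [exact Hl].
Qed.

Lemma rGamma_approx (r : R) : 0 < r ->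
  exists K, 0 < K /\
   (forall s t, Cmod s <= r -> Cmod t <= r ->
      Cmod (rGamma s - rGamma t)%C <= K * Cmod (s - t)%C) /\
   (forall n s t, (1 <= n)%nat -> Cmod s <= r -> Cmod t <= r ->
      Cmod ((rGamma s - gauss_prod n s) - (rGamma t - gauss_prod n t))%C
        <= K / INR n * Cmod (s - t)%C).
Proof.
  intros Hr. destruct (gauss_prod_diff_lipschitz r Hr) as [K [HK [H1 H2]]].
  exists K. split; [exact HK|]. split.
  - intros s t Hs Ht. apply (Clim_le (F := eventually) (fun n => (gauss_prod n s - gauss_prod n t)%C)).
    + exists 1%nat. intros n Hn. apply H1; auto.
    + apply Clim_minus; [|]; apply gauss_prod_cv.
  - intros n s t Hn Hs Ht. apply (Clim_le (F := eventually) (fun m => ((gauss_prod m s - gauss_prod n s) - (gauss_prod m t - gauss_prod n t))%C)).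
    + exists n. intros m Hm. apply H2; auto; lia.
    + apply Clim_minus; apply Clim_minus; try apply gauss_prod_cv; apply Clim_const.
Qed.

Lemma is_Cderiv_Cexp_lin (c s0 : C) : is_Cderiv (fun s => Cexp (s * c))%C s0 (c * Cexp (s0 * c))%C.
Proof.
  assert (H1 : is_Cderiv Cexp 0 1).
  { apply Clim_ext with (f := fun s => (1 + (Cexp s - 1 - s) / s)%C).
    - generalize (Cpunct_neq 0). apply filter_imp. intros s Hs. rewrite Cexp_0. field.
      repeat split; auto.
    - cut (Clim (Cpunct (RtoC 0)) (fun s => (1 + (Cexp s - 1 - s) / s)%C) (1 + 0)%C).
      { replace (1 + 0)%C with (RtoC 1) by ring. auto. }
      apply Clim_plus; [apply Clim_const|].
      intros e He.
      apply Cpunct_intro with (Rmin 1 (e / (2 * exp 1))).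
      { apply Rmin_pos; [lra|]. apply Rdiv_lt_0_compat; [exact He|]. generalize (exp_pos 1); lra. }
      intros s Hs Hne. replace (s - 0)%C with s in Hs by ring.
      replace ((Cexp s - 1 - s) / s - 0)%C with ((Cexp s - 1 - s) / s)%C by ring.
      rewrite Cmod_div by exact Hne. assert (Hm := proj1 (Cmod_gt_0 s) Hne).
      apply Rlt_div_l; [exact Hm|].
      eapply Rle_lt_trans; [apply Cexp_sub2_le|].
      assert (A1 := Rmin_l 1 (e / (2 * exp 1))). assert (A2 := Rmin_r 1 (e / (2 * exp 1))).
      assert (A3 : exp (Cmod s) <= exp 1) by (apply exp_le; lra).
      assert (A4 : Cmod s * (2 * exp 1) < e).
      { apply Rlt_div_r; [generalize (exp_pos 1); lra|lra]. }
      assert (A5 := exp_pos (Cmod s)).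
      apply Rle_lt_trans with (Cmod s * (Cmod s * exp 1)); [|nra].
      replace (Cmod s ^ 2 * exp (Cmod s)) with (Cmod s * (Cmod s * exp (Cmod s))) by ring.
      apply Rmult_le_compat_l; [lra|]. apply Rmult_le_compat_l; lra. }
  (* The change of variable in the other case needs a nonzero factor. *)
  destruct (Ceq_dec c 0) as [->|Hc].
  - apply is_Cderiv_ext with (fun _ => RtoC 1).
    + intros s. replace (s * 0)%C with (RtoC 0) by ring. symmetry; apply Cexp_0.
    + replace (0 * Cexp (s0 * 0))%C with (RtoC 0) by ring. apply is_Cderiv_const.
  - apply is_Cderiv_ext with (fun s => (Cexp (s0 * c) * Cexp (c * s + (- s0 * c)))%C).
    + intros s. rewrite <- Cexp_plus. f_equal. ring.
    + replace (c * Cexp (s0 * c))%C with (Cexp (s0 * c) * (c * 1))%C by ring.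
      apply is_Cderiv_scal. apply (is_Cderiv_affine Cexp c (- s0 * c) s0 1 Hc).
      replace (c * s0 + - s0 * c)%C with (RtoC 0) by ring. exact H1.
Qed.

Lemma ex_Cderiv_rising (n : nat) (s0 : C) : exists l, is_Cderiv (fun s => rising s n) s0 l.
Proof.
  induction n as [|n [l IH]].
  - exists 0. apply (is_Cderiv_const 1).
  - eexists. apply (is_Cderiv_mult (fun s => rising s n) (fun s => s + INR n)%C).
    + exact IH.
    + apply is_Cderiv_plus; [apply is_Cderiv_id|apply is_Cderiv_const].
Qed.

Lemma ex_Cderiv_gauss_prod (n : nat) (s0 : C) : (1 <= n)%nat ->
  exists l, is_Cderiv (gauss_prod n) s0 l.
Proof.
  intros Hn. destruct (ex_Cderiv_rising (S n) s0) as [l Hl].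
  eexists. apply is_Cderiv_ext with (fun s => (/ INR (fact n) * (rising s (S n) * Cexp (s * (- ln (INR n)))))%C).
  - intros s. unfold gauss_prod. rewrite cpow_pos by (apply lt_0_INR; lia).
    replace (s * (- ln (INR n)))%C with (- (s * ln (INR n)))%C by ring. rewrite Cexp_opp.
    field. split; [apply Cexp_neq0|apply INR_fact_neq0C].
  - apply is_Cderiv_scal. apply is_Cderiv_mult; [exact Hl|apply is_Cderiv_Cexp_lin].
Qed.

(** [Clim_switch] with the partial products: by [rGamma_approx] the error has Lipschitz constant K /
    N near s0. *)
Lemma ex_Cderiv_rGamma (s0 : C) : exists l, is_Cderiv rGamma s0 l.
Proof.
  apply Clim_switch. intros e He. set (r := Cmod s0 + 1). assert (Hs := Cmod_ge_0 s0).
  destruct (rGamma_approx r ltac:(unfold r; lra)) as [K [HK [_ HL]]].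
  destruct (archimed_cor1 (e / K) ltac:(apply Rdiv_lt_0_compat; lra)) as [N [HN1 HN2]].
  destruct (ex_Cderiv_gauss_prod N s0 ltac:(lia)) as [l Hl].
  exists (gauss_prod N), l. split; [exact Hl|].
  exists 1. split; [lra|]. intros s Hs1.
  assert (Cmod s <= r).
  { replace s with ((s - s0) + s0)%C by ring. eapply Rle_trans; [apply Cmod_triangle|]. unfold r; lra. }
  eapply Rle_trans; [apply HL; [lia|assumption|unfold r; lra]|].
  apply Rmult_le_compat_r; [apply Cmod_ge_0|].
  apply Rmult_lt_compat_l with (r := K) in HN1; [|exact HK].
  replace (K * (e / K)) with e in HN1 by (field; lra). unfold Rdiv; lra.
Qed.

Lemma Clim_Cexp {T : Type} {F : (T -> Prop) -> Prop} {HF : Filter F} (f : T -> C) (l : C) :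
  Clim F f l -> Clim F (fun x => Cexp (f x)) (Cexp l).
Proof.
  intros H e He.
  assert (P1 := exp_pos 1). assert (Pl := exp_pos (Re l)).
  set (d := Rmin 1 (e / (2 * exp 1 * exp (Re l)))).
  assert (Hd : 0 < d) by (apply Rmin_pos; [lra|apply Rdiv_lt_0_compat; [lra|nra]]).
  generalize (H d Hd). apply filter_imp. intros x Hx.
  replace (Cexp (f x) - Cexp l)%C with (Cexp l * (Cexp (f x - l) - 1))%C.
  2:{ rewrite Cexp_minus. field. apply Cexp_neq0. }
  rewrite Cmod_mult, Cmod_Cexp.
  assert (A1 := Rmin_l 1 (e / (2 * exp 1 * exp (Re l)))). assert (A2 := Rmin_r 1 (e / (2 * exp 1 * exp (Re l)))).
  fold d in A1, A2.
  assert (H0 := Cmod_ge_0 (f x - l)%C).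
  assert (A3 : exp (Cmod (f x - l)%C) <= exp 1) by (apply exp_le; lra).
  assert (A4 : Cmod (Cexp (f x - l) - 1)%C <= d * exp 1).
  { eapply Rle_trans; [apply Cexp_sub1_le|]. apply Rmult_le_compat; try lra. left; apply exp_pos. }
  apply Rle_lt_trans with (exp (Re l) * (d * exp 1)); [apply Rmult_le_compat_l; lra|].
  apply Rle_lt_trans with (exp (Re l) * (e / (2 * exp 1 * exp (Re l)) * exp 1)).
  - apply Rmult_le_compat_l; [lra|]. apply Rmult_le_compat_r; lra.
  - replace (exp (Re l) * (e / (2 * exp 1 * exp (Re l)) * exp 1)) with (e / 2) by (field; lra). lra.
Qed.

(** * Functional equation, special values and zeros of 1/Gamma *)

Lemma rising_shift (s : C) (n : nat) : rising s (S n) = (s * rising (s + 1) n)%C.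
Proof.
  induction n as [|n IH]; [simpl; ring|].
  change (rising s (S (S n))) with (rising s (S n) * (s + INR (S n)))%C.
  change (rising (s + 1) (S n)) with (rising (s + 1) n * (s + 1 + INR n))%C.
  rewrite IH, S_INR, RtoC_plus. ring.
Qed.

Lemma rising_1 (n : nat) : rising 1 n = INR (fact n).
Proof.
  induction n as [|n IH]; [reflexivity|].
  change (rising 1 (S n)) with (rising 1 n * (1 + INR n))%C. rewrite IH, fact_S_C, S_INR, RtoC_plus. ring.
Qed.

Lemma Clim_inv_INR : Clim eventually (fun n => / RtoC (INR n))%C 0.
Proof.
  apply Clim_eventually_le. exists 1. intros n Hn.
  assert (0 < INR n) by (apply lt_0_INR; lia).
  replace (/ INR n - 0)%C with (/ INR n)%C by ring. rewrite <- RtoC_inv by lra.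
  rewrite Cmod_R, Rabs_pos_eq; [lra|]. left; apply Rinv_0_lt_compat; lra.
Qed.

Lemma Clim_ratio_INR (a : C) : Clim eventually (fun n => (a + INR n) / INR n)%C 1.
Proof.
  apply Clim_ext with (fun n => (a * / INR n + 1)%C).
  - exists 1%nat. intros n Hn. field. intros E; apply RtoC_inj in E. assert (0 < INR n) by (apply lt_0_INR; lia). lra.
  - cut (Clim eventually (fun n => (a * / INR n + 1)%C) (a * 0 + 1)%C).
    { replace (a * 0 + 1)%C with (RtoC 1) by ring. auto. }
    apply Clim_plus; [|apply Clim_const].
    apply Clim_mult; [apply Clim_const|apply Clim_inv_INR].
Qed.

Lemma RtoC_INR_neq0 (n : nat) : (1 <= n)%nat -> RtoC (INR n) <> 0.
Proof. intros Hn. destruct n; [lia|apply RtoC_INR_S_neq0]. Qed.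

(** The product for s, times (s + 1 + n) / n, is exactly s times the product for s + 1, and the
    extra factor tends to 1. *)
Lemma rGamma_rec (s : C) : rGamma s = (s * rGamma (s + 1))%C.
Proof.
  apply (Clim_unique (F := eventually) (fun n => gauss_prod n s * ((s + 1 + INR n) / INR n))%C).
  - replace (rGamma s) with (rGamma s * 1)%C by ring.
    apply Clim_mult; [apply gauss_prod_cv|apply Clim_ratio_INR].
  - apply Clim_ext with (fun n => (s * gauss_prod n (s + 1))%C).
    + exists 1%nat. intros n Hn. assert (0 < INR n) by (apply lt_0_INR; lia).
      unfold gauss_prod. rewrite (rising_shift s).
      change (rising (s + 1) (S n)) with (rising (s + 1) n * (s + 1 + INR n))%C.
      rewrite !cpow_pos by assumption.
      replace ((s + 1) * ln (INR n))%C with (s * ln (INR n) + ln (INR n))%C by ring.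
      rewrite Cexp_plus, (Cexp_RtoC (ln (INR n))), exp_ln by assumption.
      field. repeat split; [apply RtoC_INR_neq0, Hn|apply Cexp_neq0|apply INR_fact_neq0C].
    + apply Clim_mult; [apply Clim_const|apply gauss_prod_cv].
Qed.

Lemma rGamma_1 : rGamma 1 = 1.
Proof.
  apply (Clim_unique (F := eventually) (fun n => gauss_prod n 1)); [apply gauss_prod_cv|].
  apply Clim_ext with (fun n => ((1 + INR n) / INR n)%C); [|apply Clim_ratio_INR].
  exists 1%nat. intros n Hn. assert (0 < INR n) by (apply lt_0_INR; lia).
  unfold gauss_prod. rewrite rising_1, cpow_pos, fact_S_C, S_INR, RtoC_plus by assumption.
  replace (1 * ln (INR n))%C with (RtoC (ln (INR n))) by ring.
  rewrite Cexp_RtoC, exp_ln by assumption. field. split; [apply RtoC_INR_neq0, Hn|apply INR_fact_neq0C].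
Qed.

Lemma rGamma_rising (s : C) (n : nat) : rGamma s = (rising s n * rGamma (s + INR n))%C.
Proof.
  induction n as [|n IH].
  - simpl. replace (s + 0)%C with s by ring. ring.
  - rewrite IH, (rGamma_rec (s + INR n)). rewrite S_INR, RtoC_plus.
    replace (s + (INR n + 1))%C with (s + INR n + 1)%C by ring. simpl. ring.
Qed.

Lemma rGamma_nat (n : nat) : rGamma (INR n + 1)%C = (/ INR (fact n))%C.
Proof.
  assert (H := rGamma_rising 1 n). rewrite rGamma_1, rising_1 in H.
  replace (INR n + 1)%C with (1 + INR n)%C by ring.
  transitivity (INR (fact n) * rGamma (1 + INR n) * / INR (fact n))%C; [field; apply INR_fact_neq0C|].
  rewrite <- H. ring.
Qed.

Lemma rGamma_neg_nat (n : nat) : rGamma (- INR n)%C = 0.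
Proof.
  rewrite (rGamma_rising _ (S n)).
  change (rising (- INR n) (S n)) with (rising (- INR n) n * (- INR n + INR n))%C. ring.
Qed.

Lemma rGamma_0 : rGamma 0 = 0.
Proof. rewrite rGamma_rec. ring. Qed.

Lemma Clim_ge {T : Type} {F : (T -> Prop) -> Prop} {HF : ProperFilter F} (f : T -> C) (l : C) (b : R) :
  F (fun x => b <= Cmod (f x)) -> Clim F f l -> b <= Cmod l.
Proof.
  intros Hb Hl. destruct (Rle_lt_dec b (Cmod l)) as [H|H]; [exact H|exfalso].
  destruct (filter_ex _ (filter_and (F := F) _ _ Hb (Hl (b - Cmod l) ltac:(lra)))) as [x [H1 H2]].
  generalize (Cmod_triangle l (f x - l))%C.
  replace (l + (f x - l))%C with (f x) by ring. lra.
Qed.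

Lemma rising_neq0 (s : C) (n : nat) : (forall k, (k < n)%nat -> s <> - INR k)%C -> rising s n <> 0.
Proof.
  induction n as [|n IH]; intros H; simpl.
  - intros E; apply RtoC_inj in E; lra.
  - apply Cmult_neq_0; [apply IH; intros; apply H; lia|].
    intros E. apply (H n); [lia|]. replace s with (s + INR n - INR n)%C by ring. rewrite E; ring.
Qed.

(* Weierstrass' inequality [prod (1 - c / k^2) >= 1 - sum c / k^2] keeps the product away from 0. *)
Lemma rGamma_neq0 (s : C) : (forall n : nat, s <> - INR n)%C -> rGamma s <> 0.
Proof.
  intros Hs.
  assert (Hm := Cmod_ge_0 s). set (r := Cmod s + 1).
  destruct (gauss_factor_lipschitz r ltac:(unfold r; lra)) as [K [HK HL]].
  set (c := K * r). assert (Hc : 0 < c) by (unfold c, r; nra).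
  (* Beyond N the sum of the c / k^2 stays below c / N < 1/2, so at least half of the modulus of the
     Nth product survives in the limit. *)
  destruct (archimed_cor1 (/ (2 * c)) ltac:(apply Rinv_0_lt_compat; lra)) as [N [HN1 HN2]].
  assert (HP : 0 < Cmod (gauss_prod N s)).
  { apply Cmod_gt_0. unfold gauss_prod, Cdiv. apply Cmult_neq_0; [apply rising_neq0; auto|].
    intros E. assert (Q : (INR (fact N) * cpow (INR N) s)%C <> 0) by (apply Cmult_neq_0; [apply INR_fact_neq0C|apply cpow_neq0]).
    apply C1_nz. rewrite <- (Cinv_r _ Q), E. ring. }
  assert (HI : c * / INR N < 1 / 2).
  { apply Rmult_lt_compat_l with (r := c) in HN1; [|exact Hc].
    replace (c * / (2 * c)) with (1 / 2) in HN1 by (field; lra). exact HN1. }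
  assert (Hlow : forall n, (N <= n)%nat -> Cmod (gauss_prod N s) * (1 - c * (/ INR N - / INR n)) <= Cmod (gauss_prod n s)).
  { intros n Hn. induction Hn as [|n Hn IH].
    - apply Req_le; ring.
    - rewrite gauss_prod_S, Cmod_mult by lia.
      assert (Hp2 : 0 < / INR (S n) ^ 2) by (apply Rinv_0_lt_compat, pow_lt, INR_S_pos).
      assert (HF : 1 - c * / INR (S n) ^ 2 <= Cmod (gauss_factor n s)).
      { assert (H1 := HL n s 0 ltac:(lia) ltac:(unfold r; lra) ltac:(rewrite Cmod_0; unfold r; lra)).
        rewrite gauss_factor_0 in H1. replace (s - 0)%C with s in H1 by ring.
        assert (H2 := Cmod_triangle (gauss_factor n s) (- (gauss_factor n s - 1))%C).
        rewrite Cmod_opp in H2. replace (gauss_factor n s + - (gauss_factor n s - 1))%C with (RtoC 1) in H2 by ring.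
        rewrite Cmod_1 in H2.
        assert (K / INR (S n) ^ 2 * Cmod s <= c * / INR (S n) ^ 2); [|lra].
        unfold c, Rdiv. apply Rle_trans with (K * / INR (S n) ^ 2 * r); [|apply Req_le; ring].
        apply Rmult_le_compat_l; [nra|unfold r; lra]. }
      assert (Hsq := inv_sq_telescope n ltac:(lia)).
      assert (Hn0 : 0 < / INR n) by (apply Rinv_0_lt_compat, lt_0_INR; lia).
      assert (Hn1 : / INR n <= / INR N) by (apply Rinv_le_contravar; [apply lt_0_INR; lia|apply le_INR, Hn]).
      assert (Hn2 : 0 < / INR (S n)) by (apply Rinv_0_lt_compat, INR_S_pos).
      set (p := / INR (S n) ^ 2) in *. set (a := / INR N) in *. set (b := / INR n) in *. set (d := / INR (S n)) in *.
      assert (Hcp : c * p <= c * (b - d)) by (apply Rmult_le_compat_l; lra).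
      assert (0 <= c * (a - b)) by (apply Rmult_le_pos; lra).
      assert (c * (a - d) <= c * a) by (apply Rmult_le_compat_l; lra).
      assert (0 < c * p) by (apply Rmult_lt_0_compat; lra).
      apply Rle_trans with (Cmod (gauss_prod N s) * (1 - c * (a - b)) * (1 - c * p)).
      + rewrite Rmult_assoc. apply Rmult_le_compat_l; [lra|]. nra.
      + apply Rmult_le_compat; [|nra|exact IH|exact HF]. apply Rmult_le_pos; [lra|].
        assert (c * (a - b) <= c * a) by (apply Rmult_le_compat_l; lra). lra. }
  apply Cmod_gt_0. apply Rlt_le_trans with (Cmod (gauss_prod N s) * (1 / 2)); [lra|].
  apply (Clim_ge (F := eventually) (fun n => gauss_prod n s)); [|apply gauss_prod_cv].
  exists N. intros n Hn. eapply Rle_trans; [|apply Hlow, Hn]. apply Rmult_le_compat_l; [lra|].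
  assert (0 < / INR n) by (apply Rinv_0_lt_compat, lt_0_INR; lia). nra.
Qed.

Lemma rGamma_neq0_Re (s : C) : 0 < Re s -> rGamma s <> 0.
Proof.
  intros H. apply rGamma_neq0. intros n E. rewrite E in H. rewrite re_opp, re_RtoC in H.
  generalize (pos_INR n); lra.
Qed.

(** * Growth of 1/Gamma under integer shifts *)

Lemma eventually_decr_bounded (x : nat -> R) (N : nat) :
  (forall k, (N <= k)%nat -> x (S k) <= x k) -> exists B, forall k, x k <= B.
Proof.
  revert x; induction N as [|N IH]; intros x H.
  - exists (x 0%nat). intros k; induction k as [|k IHk]; [lra|]. eapply Rle_trans; [apply H; lia|exact IHk].
  - destruct (IH (fun k => x (S k))) as [B HB].
    { intros k Hk. apply H; lia. }
    exists (Rmax B (x 0%nat)). intros [|k]; [apply Rmax_r|]. eapply Rle_trans; [apply HB|apply Rmax_l].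
Qed.

Lemma nat_ge (x : R) : exists n : nat, x <= INR n.
Proof.
  destruct (INR_unbounded x) as [n Hn]. exists n; lra.
Qed.

Lemma Cmod_add_INR_ge (a : C) (k : nat) : INR k - Cmod a <= Cmod (a + INR k)%C.
Proof.
  assert (H := Cmod_triangle (a + INR k)%C (- a)%C). rewrite Cmod_opp in H.
  replace (a + INR k + - a)%C with (RtoC (INR k)) in H by ring.
  rewrite Cmod_R, Rabs_pos_eq in H by apply pos_INR. lra.
Qed.

(** Once k >= 2 Cmod a, each step divides by a number of modulus at least (k + 1) / 2. The resulting
    2^k / k! is crude, but it lets the series below be dominated by exponential series. *)
Lemma rGamma_decay (a : C) : exists B, 0 < B /\
  forall k : nat, Cmod (rGamma (a + INR k + 1)%C) <= B * (2 ^ k / INR (fact k)).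
Proof.
  destruct (nat_ge (2 * Cmod a)) as [N HN].
  assert (P2 : forall k, 0 < 2 ^ k) by (intros; apply pow_lt; lra).
  assert (Pf : forall k, 0 < INR (fact k)) by (intros; apply INR_fact_lt_0).
  destruct (eventually_decr_bounded (fun k => Cmod (rGamma (a + INR k + 1)%C) * (INR (fact k) / 2 ^ k)) N) as [B HB].
  - intros k Hk. rewrite (rGamma_rec (a + INR k + 1)%C), Cmod_mult.
    assert (H1 := Cmod_add_INR_ge a (S k)).
    rewrite S_INR, RtoC_plus in *. replace (a + (INR k + 1))%C with (a + INR k + 1)%C in * by ring.
    assert (INR N <= INR k) by (apply le_INR, Hk).
    rewrite fact_simpl, mult_INR, S_INR. simpl (2 ^ S k).
    assert (H0 := Cmod_ge_0 (rGamma (a + INR k + 1 + 1)%C)).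
    assert (H2 : 0 <= INR (fact k) / 2 ^ k) by (left; apply Rdiv_lt_0_compat; auto).
    replace (Cmod (rGamma (a + INR k + 1 + 1)%C) * ((INR k + 1) * INR (fact k) / (2 * 2 ^ k))) with
      ((INR k + 1) / 2 * (Cmod (rGamma (a + INR k + 1 + 1)%C) * (INR (fact k) / 2 ^ k))) by (field; apply Rgt_not_eq, P2).
    rewrite Rmult_assoc. apply Rmult_le_compat_r; [apply Rmult_le_pos; assumption|]. lra.
  - exists (Rmax B 1). split; [apply Rlt_le_trans with 1; [lra|apply Rmax_r]|].
    intros k. specialize (HB k). simpl in HB.
    assert (HB' := Rmax_l B 1).
    apply Rle_trans with (Cmod (rGamma (a + INR k + 1)%C) * (INR (fact k) / 2 ^ k) * (2 ^ k / INR (fact k))).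
    + apply Req_le. field. split; apply Rgt_not_eq; [apply Pf|apply P2].
    + apply Rmult_le_compat_r; [|lra]. left; apply Rdiv_lt_0_compat; auto.
Qed.

(** For k >= N one step of the shift divides by a number of modulus at least 1, and the variation of
    this divisor adds at most M Cmod (s - t) to the difference; hence the linear growth in k. It is
    absorbed by k! when J is differentiated in its order. *)
Lemma rGamma_shift_lipschitz (r : R) : 0 < r -> exists L, 0 < L /\
  forall (k : nat) (s t : C), Cmod s <= r -> Cmod t <= r ->
    Cmod (rGamma (s + INR k + 1) - rGamma (t + INR k + 1))%C <= L * (INR k + 1) * Cmod (s - t)%C.
Proof.
  intros Hr. destruct (nat_ge (r + 1)) as [N HN].
  (* A radius for which the disc contains s + k + 1 whenever Cmod s <= r and k <= N; there the
     Lipschitz bound of 1/Gamma applies directly. *)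
  set (q := r + INR N + 2).
  assert (HN0 := pos_INR N).
  destruct (rGamma_approx q ltac:(unfold q; lra)) as [L0 [HL0 [HL _]]].
  set (M := L0 * q). assert (HM0 : 0 < M) by (unfold M, q; nra).
  assert (Hball : forall k s, (k <= N)%nat -> Cmod s <= r -> Cmod (s + INR k + 1)%C <= q).
  { intros k s Hk Hs. eapply Rle_trans; [apply Cmod_triangle|]. rewrite Cmod_1.
    eapply Rle_trans; [apply Rplus_le_compat_r, Cmod_triangle|]. rewrite Cmod_R, Rabs_pos_eq by apply pos_INR.
    apply le_INR in Hk. unfold q; lra. }
  assert (Hge : forall k s, (N <= k)%nat -> Cmod s <= r -> 1 <= Cmod (s + INR k + 1)%C).
  { intros k s Hk Hs. replace (s + INR k + 1)%C with (s + INR (S k))%C by (rewrite S_INR, RtoC_plus; ring).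
    eapply Rle_trans; [|apply Cmod_add_INR_ge]. apply le_INR in Hk. rewrite S_INR. lra. }
  assert (HS : forall s k, (s + INR (S k) + 1 = s + INR k + 1 + 1)%C) by (intros; rewrite S_INR, RtoC_plus; ring).
  assert (HM : forall k s, Cmod s <= r -> Cmod (rGamma (s + INR k + 1)%C) <= M).
  { intros k s Hs. destruct (Nat.le_gt_cases k N) as [Hk|Hk].
    - assert (H := HL (s + INR k + 1)%C 0 (Hball k s Hk Hs) ltac:(rewrite Cmod_0; unfold q; lra)).
      rewrite rGamma_0 in H.
      replace (rGamma (s + INR k + 1) - 0)%C with (rGamma (s + INR k + 1)) in H by ring.
      replace (s + INR k + 1 - 0)%C with (s + INR k + 1)%C in H by ring.
      eapply Rle_trans; [exact H|]. apply Rmult_le_compat_l; [lra|apply Hball; assumption].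
    - assert (Hk' : (N <= k)%nat) by lia. clear Hk. induction Hk' as [|k Hk IH].
      + assert (H := HL (s + INR N + 1)%C 0 (Hball N s (le_n N) Hs) ltac:(rewrite Cmod_0; unfold q; lra)).
        rewrite rGamma_0 in H.
        replace (rGamma (s + INR N + 1) - 0)%C with (rGamma (s + INR N + 1)) in H by ring.
        replace (s + INR N + 1 - 0)%C with (s + INR N + 1)%C in H by ring.
        eapply Rle_trans; [exact H|]. apply Rmult_le_compat_l; [lra|apply Hball; auto].
      + rewrite HS. rewrite rGamma_rec, Cmod_mult in IH. specialize (Hge k s Hk Hs).
        generalize (Cmod_ge_0 (rGamma (s + INR k + 1 + 1)%C)). nra. }
  exists (L0 + M). split; [lra|]. intros k s t Hs Ht. assert (HD := Cmod_ge_0 (s - t)%C).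
  destruct (Nat.le_gt_cases k N) as [Hk|Hk].
  - eapply Rle_trans; [apply HL; auto|].
    replace (s + INR k + 1 - (t + INR k + 1))%C with (s - t)%C by ring.
    apply Rmult_le_compat_r; [exact HD|]. generalize (pos_INR k); nra.
  - assert (Hk' : (N <= k)%nat) by lia. clear Hk. induction Hk' as [|k Hk IH].
    + eapply Rle_trans; [apply HL; auto|].
      replace (s + INR N + 1 - (t + INR N + 1))%C with (s - t)%C by ring.
      apply Rmult_le_compat_r; [exact HD|]. generalize (pos_INR N); nra.
    + rewrite !HS. assert (Hw := Hge k s Hk Hs). assert (Hv := Hge k t Hk Ht). assert (HMt := HM k t Ht).
      set (w := (s + INR k + 1)%C) in *. set (v := (t + INR k + 1)%C) in *.
      assert (W0 : w <> 0) by (apply Cmod_gt_0; lra). assert (V0 : v <> 0) by (apply Cmod_gt_0; lra).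
      assert (Ew : rGamma (w + 1) = (rGamma w / w)%C) by (rewrite (rGamma_rec w); field; exact W0).
      assert (Ev : rGamma (v + 1) = (rGamma v / v)%C) by (rewrite (rGamma_rec v); field; exact V0).
      rewrite Ew, Ev.
      replace (rGamma w / w - rGamma v / v)%C with ((rGamma w - rGamma v) / w + rGamma v * (t - s) / (w * v))%C.
      2:{ replace (t - s)%C with (v - w)%C by (unfold v, w; ring). field; auto. }
      eapply Rle_trans; [apply Cmod_triangle|].
      rewrite !Cmod_div, !Cmod_mult by (try apply Cmult_neq_0; assumption).
      replace (t - s)%C with (- (s - t))%C by ring. rewrite Cmod_opp.
      assert (T1 : Cmod (rGamma w - rGamma v)%C / Cmod w <= (L0 + M) * (INR k + 1) * Cmod (s - t)%C).
      { apply Rle_div_l; [lra|]. assert (0 <= Cmod (rGamma w - rGamma v)%C) by apply Cmod_ge_0. nra. }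
      assert (T2 : Cmod (rGamma v) * Cmod (s - t)%C / (Cmod w * Cmod v) <= M * Cmod (s - t)%C).
      { apply Rle_div_l; [nra|]. assert (0 <= Cmod (rGamma v)) by apply Cmod_ge_0.
        assert (1 <= Cmod w * Cmod v) by nra.
        assert (Cmod (rGamma v) * Cmod (s - t)%C <= M * Cmod (s - t)%C) by (apply Rmult_le_compat_r; lra).
        assert (0 <= M * Cmod (s - t)%C) by nra. nra. }
      rewrite S_INR. generalize (pos_INR k). nra.
Qed.

(** * The duplication formula, up to the value at 1/2 *)

Lemma rising_double (s : C) (n : nat) :
  rising (2 * s) (2 * n) = (4 ^ n * (rising s n * rising (s + / 2) n))%C.
Proof.
  induction n as [|n IH]; [simpl; ring|].
  replace (2 * S n)%nat with (S (S (2 * n))) by lia.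
  change (rising (2 * s) (S (S (2 * n)))) with (rising (2 * s) (2 * n) * (2 * s + INR (2 * n)) * (2 * s + INR (S (2 * n))))%C.
  rewrite IH, S_INR, mult_INR. simpl (INR 2). simpl rising. simpl Cpow.
  rewrite RtoC_plus, RtoC_mult. replace (1 + 1) with 2 by ring. field.
Qed.

(** The numerators combine exactly by [rising_double]. The last factor does not depend on s, so its
    limit can be found from a single value of s. *)
Lemma gauss_double (n : nat) (s : C) : (1 <= n)%nat ->
  (gauss_prod n s * gauss_prod n (s + / 2) =
   gauss_prod (2 * n + 1) (2 * s) * Cexp (2 * s * ln (INR (2 * n + 1) / INR n))
   * (INR (fact (2 * n + 1)) / (4 ^ (S n) * INR (fact n) ^ 2 * Cexp (/ 2 * ln (INR n)))))%C.
Proof.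
  intros Hn. assert (Hp : 0 < INR n) by (apply lt_0_INR; lia). assert (Hp' : 0 < INR (2 * n + 1)) by (apply lt_0_INR; lia).
  unfold gauss_prod. rewrite !cpow_pos by assumption.
  replace (S (2 * n + 1)) with (2 * S n)%nat by lia. rewrite rising_double.
  rewrite ln_div, RtoC_minus by assumption.
  replace (2 * s * (ln (INR (2 * n + 1)) - ln (INR n)))%C with (2 * s * ln (INR (2 * n + 1)) - (s * ln (INR n) + s * ln (INR n)))%C by ring.
  rewrite Cexp_minus, Cexp_plus.
  replace ((s + / 2) * ln (INR n))%C with (s * ln (INR n) + / 2 * ln (INR n))%C by ring. rewrite Cexp_plus.
  field. repeat split; try apply Cexp_neq0; try apply INR_fact_neq0C.
  apply Cpow_nz. intros E; apply RtoC_inj in E; lra.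
Qed.

Lemma Clim_double_factor (s : C) :
  Clim eventually (fun n => Cexp (2 * s * ln (INR (2 * n + 1) / INR n))%C) (Cexp (2 * s * ln 2)%C).
Proof.
  apply Clim_Cexp.
  apply Clim_mult; [apply Clim_const|].
  apply Clim_RtoC.
  apply (filterlim_comp _ _ _ (fun n => INR (2 * n + 1) / INR n) ln eventually (locally 2)).
  - apply filterlim_ext_loc with (fun n => 2 + / INR n).
    + exists 1%nat. intros n Hn. rewrite plus_INR, mult_INR. simpl INR. field. apply not_0_INR; lia.
    + replace (locally 2) with (Rbar_locally (Rbar_plus 2 0)) by (simpl; rewrite Rplus_0_r; reflexivity).
      apply (is_lim_seq_plus' (fun _ => 2) (fun n => / INR n) 2 0); [apply is_lim_seq_const|].
      apply (is_lim_seq_inv INR p_infty is_lim_seq_INR). discriminate.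
  - apply (ex_derive_continuous ln). exists (/ 2). apply is_derive_ln; lra.
Qed.

Lemma filterlim_2n1 : filterlim (fun n => 2 * n + 1)%nat eventually eventually.
Proof. intros P [N HN]. exists N. intros n Hn. apply HN. lia. Qed.

Lemma rGamma_duplication_aux (s : C) :
  (rGamma s * rGamma (s + / 2) = rGamma (2 * s) * Cexp (2 * s * ln 2) * (rGamma (/ 2) / 2))%C.
Proof.
  set (w := fun n : nat => (INR (fact (2 * n + 1)) / (4 ^ (S n) * INR (fact n) ^ 2 * Cexp (/ 2 * ln (INR n))))%C).
  assert (HG : forall s, Clim eventually (fun n => gauss_prod (2 * n + 1) s) (rGamma s)).
  { intros t. apply (Clim_comp eventually eventually (fun n => 2 * n + 1)%nat (fun n => gauss_prod n t)); [apply filterlim_2n1|apply gauss_prod_cv]. }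
  assert (Hw : Clim eventually w (rGamma (/ 2) / 2)%C).
  (* The limit of w is read off at s = 1/2, where s + 1/2 = 2 s = 1; the value of 1/Gamma at 1/2
     stays unknown until [rGamma_half]. *)
  { assert (H := Clim_mult _ _ _ _ (HG 1%C) (Clim_double_factor (/ 2)%C)).
    replace (2 * / 2 * ln 2)%C with (RtoC (ln 2)) in H by field.
    rewrite rGamma_1, Cexp_RtoC, exp_ln in H by lra. replace (1 * 2)%C with (RtoC 2) in H by ring.
    assert (H2 : RtoC 2 <> 0) by (intros E; apply RtoC_inj in E; lra).
    assert (H1 := Clim_mult _ _ _ _ (gauss_prod_cv (/ 2)%C) (gauss_prod_cv 1%C)).
    rewrite rGamma_1 in H1. replace (rGamma (/ 2) * 1)%C with (rGamma (/ 2)) in H1 by ring.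
    assert (H3 := Clim_div _ _ _ _ H2 H1 H). revert H3.
    apply Clim_ext.
    generalize (filter_and (F := eventually) _ _ (Clim_neq0 _ _ H2 H) (ex_intro (fun N => forall n, (N <= n)%nat -> (1 <= n)%nat) 1%nat (fun n h => h))).
    apply filter_imp. intros n [[Hn0 _] Hn].
    replace (RtoC 1) with (/ 2 + / 2)%C by field.
    rewrite gauss_double by exact Hn. fold (w n).
    replace (2 * / 2)%C with (RtoC 1) in * by field. replace (/ 2 + / 2)%C with (RtoC 1) by field.
    field. split.
    - intros E; apply Hn0; rewrite E; ring.
    - intros E; apply Hn0; rewrite E; ring. }
  apply (Clim_unique (F := eventually) (fun n => gauss_prod n s * gauss_prod n (s + / 2))%C).
  - apply Clim_mult; [|]; apply gauss_prod_cv.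
  - apply Clim_ext with (fun n => gauss_prod (2 * n + 1) (2 * s) * Cexp (2 * s * ln (INR (2 * n + 1) / INR n)) * w n)%C.
    + exists 1%nat. intros n Hn. symmetry. apply gauss_double, Hn.
    + apply Clim_mult; [|exact Hw]. apply Clim_mult; [apply HG|apply Clim_double_factor].
Qed.

(** * Cauchy's cosine integral *)

(** A concrete form of the improper integral of the definitions: only the upper end moves, and the
    partial integrals form a function F of it, so that linearity and comparison reduce to rules for
    limits of F. *)
Definition is_improper (f : R -> C) (l : C) : Prop :=
  exists F : R -> C,
    (forall b, 0 <= b < PI -> is_RInt (V := C_R_NormedModule) f 0 b (F b)) /\
    Clim (at_left PI) F l.

Lemma at_left_PI_range (a : R) : a < PI -> at_left PI (fun b => a < b < PI).
Proof.
  intros Ha. exists (mkposreal (PI - a) ltac:(lra)). intros y Hy Hlt.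
  unfold ball in Hy; simpl in Hy. unfold AbsRing_ball, abs, minus, plus, opp in Hy; simpl in Hy.
  apply Rabs_def2 in Hy. lra.
Qed.

Lemma is_improper_RInt_gen (f : R -> C) (l : C) :
  is_improper f l -> is_RInt_gen (V := C_R_NormedModule) f (at_point 0) (at_left PI) l.
Proof.
  intros [F [HF HL]]. apply Clim_iff in HL.
  intros P HP.
  apply (Filter_prod _ _ _ (fun a => a = 0) (fun b => 0 < b < PI /\ P (F b))).
  - reflexivity.
  - apply filter_and; [apply at_left_PI_range, PI_RGT_0|]. apply HL, HP.
  - intros a b -> [Hb HPb]. exists (F b). split; [apply HF; lra|exact HPb].
Qed.

Lemma is_improper_convergent (f : R -> C) (l : C) : is_improper f l -> is_convergent_0_PI f.
Proof. intros H. exists l. apply is_improper_RInt_gen, H. Qed.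

Lemma is_improper_integral (f : R -> C) (l : C) : is_improper f l -> integral_0_PI f = l.
Proof.
  intros H. unfold integral_0_PI.
  apply (@is_RInt_gen_unique C_R_CompleteNormedModule (at_point 0) (at_left PI) _ _ f l).
  apply (is_improper_RInt_gen f l H).
Qed.

Lemma is_improper_unique (f : R -> C) (l m : C) : is_improper f l -> is_improper f m -> l = m.
Proof. intros H1 H2. rewrite <- (is_improper_integral _ _ H1). apply is_improper_integral, H2. Qed.

Lemma is_improper_ext (f g : R -> C) (l : C) :
  (forall t, 0 <= t < PI -> f t = g t) -> is_improper f l -> is_improper g l.
Proof.
  intros H [F [HF HL]]. exists F; split; [|exact HL].
  intros b Hb. apply is_RInt_ext with f; [|apply HF, Hb].
  intros x Hx. rewrite Rmin_left, Rmax_right in Hx by lra. apply H; lra.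
Qed.

Lemma is_RInt_C_scal (c : C) (f : R -> C) (a b : R) (l : C) :
  is_RInt (V := C_R_NormedModule) f a b l ->
  is_RInt (V := C_R_NormedModule) (fun t => c * f t)%C a b (c * l)%C.
Proof.
  intros H.
  assert (H1 := is_RInt_fct_extend_fst (U := R_NormedModule) (V := R_NormedModule) f a b l H).
  assert (H2 := is_RInt_fct_extend_snd (U := R_NormedModule) (V := R_NormedModule) f a b l H).
  apply (is_RInt_fct_extend_pair (U := R_NormedModule) (V := R_NormedModule)).
  - simpl. apply (is_RInt_minus (V := R_NormedModule)); apply (is_RInt_scal (V := R_NormedModule)); assumption.
  - simpl. apply (is_RInt_plus (V := R_NormedModule)); apply (is_RInt_scal (V := R_NormedModule)); assumption.
Qed.

Lemma is_improper_scal (c : C) (f : R -> C) (l : C) :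
  is_improper f l -> is_improper (fun t => c * f t)%C (c * l)%C.
Proof.
  intros [F [HF HL]]. exists (fun b => c * F b)%C. split.
  - intros b Hb. apply is_RInt_C_scal, HF, Hb.
  - apply Clim_mult; [apply Clim_const|exact HL].
Qed.

Lemma is_improper_plus (f g : R -> C) (l m : C) :
  is_improper f l -> is_improper g m -> is_improper (fun t => f t + g t)%C (l + m)%C.
Proof.
  intros [F [HF HL]] [G [HG HM]]. exists (fun b => F b + G b)%C. split.
  - intros b Hb. apply (is_RInt_plus (V := C_R_NormedModule)); auto.
  - apply Clim_plus; [exact HL|exact HM].
Qed.

Lemma is_improper_minus (f g : R -> C) (l m : C) :
  is_improper f l -> is_improper g m -> is_improper (fun t => f t - g t)%C (l - m)%C.
Proof.
  intros Hf Hg. apply is_improper_ext with (fun t => f t + (-1) * g t)%C; [intros; ring|].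
  replace (l - m)%C with (l + (-1) * m)%C by ring. apply is_improper_plus; [exact Hf|]. apply is_improper_scal, Hg.
Qed.

Lemma is_improper_le (f : R -> C) (g : R -> R) (l : C) (m : R) :
  (forall t, 0 <= t < PI -> Cmod (f t) <= g t) ->
  is_improper f l -> is_improper (fun t => RtoC (g t)) (RtoC m) -> Cmod l <= m.
Proof.
  intros Hle [F [HF HL]] [G [HG HM]].
  assert (H : Cmod l - Cmod m <= 0 -> Cmod l <= m \/ m < 0).
  { intros H. rewrite Cmod_R in H. destruct (Rle_lt_dec 0 m); [left; rewrite Rabs_pos_eq in H by assumption; lra|right; assumption]. }
  apply Rnot_lt_le. intros Hlt.
  assert (He : 0 < (Cmod l - m) / 2) by lra.
  destruct (filter_ex _ (filter_and (F := at_left PI) _ _ (at_left_PI_range 0 PI_RGT_0) (filter_and (F := at_left PI) _ _ (HL _ He) (HM _ He)))) as [b [Hb [H1 H2]]].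
  assert (HG' := is_RInt_fct_extend_fst (U := R_NormedModule) (V := R_NormedModule) _ 0 b _ (HG b ltac:(lra))).
  simpl in HG'.
  assert (H3 : Cmod (F b) <= fst (G b)).
  { rewrite <- norm_C_R. apply (norm_RInt_le (V := C_R_NormedModule) f g 0 b (F b) (fst (G b))); [lra| |apply HF; lra|exact HG'].
    intros x Hx. rewrite norm_C_R. apply Hle; lra. }
  assert (H4 := Cmod_triangle (F b) (- (F b - l))%C). rewrite Cmod_opp in H4.
  replace (F b + - (F b - l))%C with l in H4 by ring.
  assert (H5 := re_le_Cmod (G b - m)%C).
  replace (Re (G b - m)%C) with (fst (G b) - m) in H5 by (simpl; unfold Re; simpl; ring).
  assert (H6 := Rle_abs (fst (G b) - m)). lra.
Qed.

(** The partial integrals are Lipschitz in the upper end with constant M, hence Cauchy at PI. *)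
Lemma is_improper_bounded (f : R -> C) (M : R) :
  (forall t, 0 <= t < PI -> continuous (U := C_R_NormedModule) f t) ->
  (forall t, 0 <= t < PI -> Cmod (f t) <= M) ->
  exists l, is_improper f l.
Proof.
  intros Hc HM.
  assert (Hex : forall a b, 0 <= a <= b -> b < PI -> ex_RInt (V := C_R_CompleteNormedModule) f a b).
  { intros a b Ha Hb. apply (ex_RInt_continuous (V := C_R_CompleteNormedModule)). intros z Hz.
    rewrite Rmin_left, Rmax_right in Hz by lra. apply Hc; lra. }
  set (F := fun b : R => RInt (V := C_R_CompleteNormedModule) f 0 b : C).
  assert (HF : forall b, 0 <= b < PI -> is_RInt (V := C_R_NormedModule) f 0 b (F b)).
  { intros b Hb. apply (RInt_correct (V := C_R_CompleteNormedModule)), Hex; lra. }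
  assert (HM0 : 0 <= M).
  { eapply Rle_trans; [apply Cmod_ge_0|apply (HM 0)]. generalize PI_RGT_0; lra. }
  assert (Hd : forall a b, 0 <= a <= b -> b < PI -> Cmod (F b - F a)%C <= M * (b - a)).
  { intros a b Ha Hb.
    destruct (Hex a b Ha Hb) as [J0 I]. pose (J := J0 : C). change J0 with J in I. clearbody J. clear J0.
    assert (E : F b = (F a + J)%C).
    { apply (is_RInt_unique (V := C_R_CompleteNormedModule)).
      apply (is_RInt_Chasles (V := C_R_NormedModule)) with a; [apply HF; lra|exact I]. }
    rewrite E. replace (F a + J - F a)%C with (J : C) by ring.
    rewrite <- norm_C_R. rewrite Rmult_comm. apply (norm_RInt_le_const (V := C_R_NormedModule) f a b); [lra| |exact I].
    intros x Hx. rewrite norm_C_R. apply HM; lra. }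
  destruct (Clim_cauchy (F := at_left PI) F) as [l Hl].
  - intros e He.
    set (a := Rmax 0 (PI - e / (M + 1))).
    assert (0 < e / (M + 1)) by (apply Rdiv_lt_0_compat; lra).
    assert (Ha0 : 0 <= a) by apply Rmax_l. assert (Ha1 : PI - e / (M + 1) <= a) by apply Rmax_r.
    assert (Ha : a < PI) by (unfold a; apply Rmax_lub_lt; [apply PI_RGT_0|lra]).
    exists (fun b => a < b < PI). split; [apply at_left_PI_range, Ha|].
    assert (K : forall u v, a < u < PI -> a < v < PI -> u <= v -> Cmod (F v - F u)%C < e).
    { intros u v Hu Hv Huv. eapply Rle_lt_trans; [apply Hd; lra|].
      apply Rle_lt_trans with ((M + 1) * (v - u)); [nra|].
      apply Rlt_le_trans with ((M + 1) * (e / (M + 1))); [apply Rmult_lt_compat_l; lra|]. apply Req_le; field; lra. }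
    intros u v Hu Hv. destruct (Rle_lt_dec u v).
    + replace (F u - F v)%C with (- (F v - F u))%C by ring. rewrite Cmod_opp. apply K; auto.
    + apply K; auto; lra.
  - exists l, F. split; assumption.
Qed.

Lemma is_improper_const (c : C) : is_improper (fun _ => c) (PI * c)%C.
Proof.
  exists (fun b => RtoC b * c)%C. split.
  - intros b Hb. assert (H := is_RInt_const (V := C_R_NormedModule) 0 b c).
    replace (RtoC b * c)%C with (scal (b - 0) (c : C_R_NormedModule)); [exact H|].
    rewrite scal_R_Cmult, Rminus_0_r. reflexivity.
  - apply Clim_mult; [|apply Clim_const].
    apply Clim_RtoC. intros P [e He]. exists e. intros y Hy _. apply He, Hy.
Qed.

(** * Cosine powers and integration by parts *)

Lemma Cmod_Ccos_le (w : C) : Cmod (Ccos w) <= exp (Rabs (Im w)).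
Proof.
  unfold Ccos. assert (H2 : RtoC 2 <> 0) by (intros E; apply RtoC_inj in E; lra).
  rewrite Cmod_div, Cmod_R, Rabs_pos_eq by (auto; lra). apply Rle_div_l; [lra|].
  eapply Rle_trans; [apply Cmod_triangle|]. rewrite !Cmod_Cexp.
  assert (E1 : Re (Ci * w)%C = - Im w) by (rewrite re_mult; simpl; unfold Im; ring).
  rewrite re_opp, E1.
  assert (exp (- Im w) <= exp (Rabs (Im w))) by (apply exp_le; rewrite <- Rabs_Ropp; apply Rle_abs).
  assert (exp (- - Im w) <= exp (Rabs (Im w))) by (apply exp_le; rewrite Ropp_involutive; apply Rle_abs).
  lra.
Qed.

Lemma Cmod_Csin_le (w : C) : Cmod (Csin w) <= exp (Rabs (Im w)).
Proof.
  unfold Csin. assert (H2 : RtoC 2 <> 0) by (intros E; apply RtoC_inj in E; lra).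
  rewrite Cmod_div by (apply Cmult_neq_0; [exact H2|apply Ci_nz]).
  rewrite Cmod_mult, Cmod_Ci, Cmod_R, Rabs_pos_eq by lra. apply Rle_div_l; [lra|].
  eapply Rle_trans; [apply Cmod_triangle|]. rewrite Cmod_opp, !Cmod_Cexp.
  assert (E1 : Re (Ci * w)%C = - Im w) by (rewrite re_mult; simpl; unfold Im; ring).
  rewrite re_opp, E1.
  assert (exp (- Im w) <= exp (Rabs (Im w))) by (apply exp_le; rewrite <- Rabs_Ropp; apply Rle_abs).
  assert (exp (- - Im w) <= exp (Rabs (Im w))) by (apply exp_le; rewrite Ropp_involutive; apply Rle_abs).
  lra.
Qed.

Lemma Ci2 : (Ci * Ci = -1)%C.
Proof. apply injective_projections; simpl; ring. Qed.

Lemma is_derive_Ccos_lin (nu : C) (x : R) :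
  is_derive (V := C_R_NormedModule) (fun t => Ccos (nu * RtoC t)) x (- nu * Csin (nu * RtoC x))%C.
Proof.
  assert (H := is_derive_Cscal (/ 2) _ _ _ (is_derive_Cplus _ _ _ _ _ (is_derive_Cexp_lin (Ci * nu) x) (is_derive_Cexp_lin (- (Ci * nu)) x))).
  replace (- nu * Csin (nu * x))%C with (/ 2 * (Ci * nu * Cexp (x * (Ci * nu)) + - (Ci * nu) * Cexp (x * - (Ci * nu))))%C.
  - revert H. apply is_derive_ext. intros t. unfold Ccos.
    replace (t * (Ci * nu))%C with (Ci * (nu * t))%C by ring. replace (t * - (Ci * nu))%C with (- (Ci * (nu * t)))%C by ring.
    unfold Cdiv. apply Cmult_comm.
  - unfold Csin. replace (x * (Ci * nu))%C with (Ci * (nu * x))%C by ring. replace (x * - (Ci * nu))%C with (- (Ci * (nu * x)))%C by ring.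
    set (A := Cexp (Ci * (nu * x))). set (B := Cexp (- (Ci * (nu * x)))).
    replace (- nu * ((A - B) / (2 * Ci)))%C with (- nu * ((A - B) / 2) * (/ Ci))%C by (field; apply Ci_nz).
    replace (/ Ci)%C with (- Ci)%C; [field|].
    transitivity (- (Ci * Ci) / Ci)%C; [field; apply Ci_nz|]. rewrite Ci2. field. apply Ci_nz.
Qed.

Lemma is_derive_Csin_lin (nu : C) (x : R) :
  is_derive (V := C_R_NormedModule) (fun t => Csin (nu * RtoC t)) x (nu * Ccos (nu * RtoC x))%C.
Proof.
  assert (H := is_derive_Cscal (/ (2 * Ci)) _ _ _ (is_derive_Cplus _ _ _ _ _ (is_derive_Cexp_lin (Ci * nu) x) (is_derive_Cscal (-1) _ _ _ (is_derive_Cexp_lin (- (Ci * nu)) x)))).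
  replace (nu * Ccos (nu * x))%C with (/ (2 * Ci) * (Ci * nu * Cexp (x * (Ci * nu)) + -1 * (- (Ci * nu) * Cexp (x * - (Ci * nu)))))%C.
  - revert H. apply is_derive_ext. intros t. unfold Csin. match goal with |- ?a = ?b => change (@eq C a b) end.
    replace (t * (Ci * nu))%C with (Ci * (nu * t))%C by ring. replace (t * - (Ci * nu))%C with (- (Ci * (nu * t)))%C by ring.
    field. apply Ci_nz.
  - unfold Ccos. replace (x * (Ci * nu))%C with (Ci * (nu * x))%C by ring. replace (x * - (Ci * nu))%C with (- (Ci * (nu * x)))%C by ring.
    field. apply Ci_nz.
Qed.

Lemma one_plus_cos_pos (t : R) : 0 <= t < PI -> 0 < 1 + cos t.
Proof.
  intros Ht. assert (H : cos PI < cos t) by (apply cos_decreasing_1; lra). rewrite cos_PI in H. lra.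
Qed.

(** The base 2 + 2 cos t is the square of 2 cos (t / 2) and positive on [0, PI), so its complex
    power is taken with the real logarithm and involves no choice of branch. *)
Definition cos_pow (s nu : C) (t : R) : C := (Cexp (s * ln (2 + 2 * cos t)) * Ccos (nu * t))%C.

Lemma is_derive_pow_part (s : C) (t : R) : 0 <= t < PI ->
  is_derive (V := C_R_NormedModule) (fun x => Cexp (s * ln (2 + 2 * cos x)))%C t
    (- (s * sin t) / (1 + cos t) * Cexp (s * ln (2 + 2 * cos t)))%C.
Proof.
  intros Ht. assert (Hp := one_plus_cos_pos t Ht).
  apply (is_derive_Cexp (fun x => s * ln (2 + 2 * cos x))%C).
  replace (- (s * sin t) / (1 + cos t))%C with (s * RtoC (- (sin t) / (1 + cos t)))%C.
  - apply is_derive_Cscal. apply is_derive_RtoC. auto_derive; [lra|]. field. lra.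
  - assert (N : (1 + cos t)%C <> 0) by (rewrite <- RtoC_plus; intros E; apply RtoC_inj in E; lra).
    rewrite RtoC_div, RtoC_opp, RtoC_plus by lra. field. exact N.
Qed.

Lemma continuous_cos_pow (s nu : C) (t : R) : 0 <= t < PI ->
  continuous (U := C_R_NormedModule) (cos_pow s nu) t.
Proof.
  intros Ht. eapply is_derive_continuous_C. apply is_derive_Cmult; [apply is_derive_pow_part, Ht|apply is_derive_Ccos_lin].
Qed.

Lemma Cexp_ln_S (s : C) (x : R) : 0 < x -> Cexp ((s + 1) * ln x)%C = (x * Cexp (s * ln x))%C.
Proof.
  intros Hx. replace ((s + 1) * ln x)%C with (ln x + s * ln x)%C by ring.
  rewrite Cexp_plus, Cexp_RtoC, exp_ln by exact Hx. reflexivity.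
Qed.

(* Vanishes at both ends of [0, PI); its derivative links the exponents [s] and [s + 1]. *)
Definition cos_pow_prim (s nu : C) (t : R) : C :=
  (Cexp (s * ln (2 + 2 * cos t)) *
    (sin t * Ccos (nu * t) + - (nu / (2 * (s + 1))) * ((2 + 2 * cos t)%R * Csin (nu * t))))%C.

(** The second summand of [cos_pow_prim] is chosen so that the terms with sin (nu t) cancel. The
    remaining sin^2 t is divisible by 1 + cos t, which leaves only the exponents s and s + 1. *)
Lemma is_derive_cos_pow_prim (s nu : C) (t : R) : 0 <= t < PI -> (s + 1)%C <> 0 ->
  is_derive (V := C_R_NormedModule) (cos_pow_prim s nu) t
   (((s + 1) * (s + 1) - nu * nu) / (2 * (s + 1)) * cos_pow (s + 1) nu t + - (2 * s + 1) * cos_pow s nu t)%C.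
Proof.
  intros Ht Hs. assert (Hp := one_plus_cos_pos t Ht).
  assert (D1 := is_derive_Cplus _ _ _ _ _
     (is_derive_Cmult _ _ _ _ _ (is_derive_RtoC _ _ _ (is_derive_sin t)) (is_derive_Ccos_lin nu t))
     (is_derive_Cscal (- (nu / (2 * (s + 1)))) _ _ _
       (is_derive_Cmult _ _ _ _ _ (is_derive_RtoC (fun x => 2 + 2 * cos x) t (- 2 * sin t) ltac:(auto_derive; [trivial|ring])) (is_derive_Csin_lin nu t)))).
  assert (D := is_derive_Cmult _ _ _ _ _ (is_derive_pow_part s t Ht) D1). cbv beta in D.
  replace (((s + 1) * (s + 1) - nu * nu) / (2 * (s + 1)) * cos_pow (s + 1) nu t + - (2 * s + 1) * cos_pow s nu t)%C with
   (- (s * sin t) / (1 + cos t) * Cexp (s * ln (2 + 2 * cos t)) *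
       (sin t * Ccos (nu * t) + - (nu / (2 * (s + 1))) * (RtoC (2 + 2 * cos t) * Csin (nu * t))) +
       Cexp (s * ln (2 + 2 * cos t)) *
       (cos t * Ccos (nu * t) + sin t * (- nu * Csin (nu * t)) +
        - (nu / (2 * (s + 1))) *
        (RtoC (-2 * sin t) * Csin (nu * t) + RtoC (2 + 2 * cos t) * (nu * Ccos (nu * t)))))%C.
  - exact D.
  - unfold cos_pow. rewrite Cexp_ln_S by lra.
    set (e := Cexp (s * ln (2 + 2 * cos t))). set (c := Ccos (nu * t)). set (d := Csin (nu * t)).
    assert (E : (RtoC (sin t) * RtoC (sin t) = 1 - RtoC (cos t) * RtoC (cos t))%C).
    { rewrite <- !RtoC_mult, <- RtoC_minus. f_equal. generalize (sin2_cos2 t); unfold Rsqr; lra. }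
    rewrite RtoC_plus, !RtoC_mult.
    assert (Hx : (1 + RtoC (cos t))%C <> 0) by (rewrite <- RtoC_plus; intros E'; apply RtoC_inj in E'; lra).
    set (S := RtoC (sin t)) in *. set (x := RtoC (cos t)) in *.
    apply Ceq_minus.
    (* The two sides agree modulo sin^2 t = 1 - cos^2 t; the cofactor of this relation is written
       out. *)
    match goal with |- (?l - ?r)%C = _ =>
      replace (l - r)%C with (- (s * e * c / (1 + x)) * (S * S - (1 - x * x)))%C end.
    + rewrite E. ring.
    + field. split; [exact Hs|exact Hx].
Qed.

Lemma cos_pow_prim_0 (s nu : C) : cos_pow_prim s nu 0 = 0.
Proof.
  unfold cos_pow_prim. rewrite sin_0. replace (Csin (nu * 0)) with (RtoC 0); [ring|].
  unfold Csin. replace (- (Ci * (nu * 0)))%C with (Ci * (nu * 0))%C by ring. field. apply Ci_nz.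
Qed.

Lemma filterlim_cos_left_PI : filterlim (fun b => 2 + 2 * cos b) (at_left PI) (at_right 0).
Proof.
  intros P [e He].
  assert (Hc : continuous (fun b => 2 + 2 * cos b) PI).
  { apply (ex_derive_continuous (fun b => 2 + 2 * cos b)). auto_derive. trivial. }
  assert (H1 : locally PI (fun b => Rabs (2 + 2 * cos b - 0) < e)).
  { apply (Hc (fun y => Rabs (y - 0) < e)). exists e. intros y Hy. rewrite cos_PI in Hy.
    replace (y - 0) with (y - (2 + 2 * -1)) by ring. exact Hy. }
  assert (H2 : at_left PI (fun b => Rabs (2 + 2 * cos b - 0) < e)).
  { destruct H1 as [e1 H1]. exists e1. intros y Hy _. apply H1, Hy. }
  change (at_left PI (fun b => P (2 + 2 * cos b))). generalize (filter_and (F := at_left PI) _ _ H2 (at_left_PI_range 0 PI_RGT_0)). apply filter_imp.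
  intros b [Hb1 Hb2]. apply He; [exact Hb1|]. generalize (one_plus_cos_pos b); intros. lra.
Qed.

Lemma filterlim_exp_ln_0 (p : R) : 0 < p -> filterlim (fun b => exp (p * ln (2 + 2 * cos b))) (at_left PI) (locally 0).
Proof.
  intros Hp. apply (filterlim_comp _ _ _ (fun b => 2 + 2 * cos b) (fun x => exp (p * ln x)) (at_left PI) (at_right 0)); [apply filterlim_cos_left_PI|].
  intros P [e He].
  exists (mkposreal (exp (ln e / p)) (exp_pos _)). intros x Hx Hx0. apply He.
  unfold ball in *; simpl in *. unfold AbsRing_ball, abs, minus, plus, opp in *; simpl in *.
  rewrite Ropp_0, Rplus_0_r in *. rewrite Rabs_pos_eq in * by (try (left; apply exp_pos); lra).
  apply ln_increasing in Hx; [|exact Hx0]. rewrite ln_exp in Hx.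
  rewrite <- (exp_ln e) by apply cond_pos. apply exp_increasing.
  apply Rmult_lt_compat_l with (r := p) in Hx; [|exact Hp].
  replace (p * (ln e / p)) with (ln e) in Hx by (field; lra). exact Hx.
Qed.

Lemma Rabs_Im_scal_le (nu : C) (t : R) : 0 <= t <= PI -> Rabs (Im (nu * t)%C) <= PI * Cmod nu.
Proof.
  intros Ht. rewrite im_scal_r, Rabs_mult, (Rabs_pos_eq t) by lra.
  assert (Rabs (Im nu) <= Cmod nu).
  { eapply Rle_trans; [|apply Rmax_Cmod]. apply Rmax_r. }
  generalize (Rabs_pos (Im nu)). nra.
Qed.

Lemma Cmod_Cexp_scal (s : C) (x : R) : Cmod (Cexp (s * x)%C) = exp (Re s * x).
Proof. rewrite Cmod_Cexp, re_scal_r. reflexivity. Qed.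

(** From sin^2 t = (1 - cos t) (1 + cos t) <= 2 + 2 cos t. This half power is what lets the boundary
    term at PI vanish for all Re s > - 1/2. *)
Lemma sin_le_sqrt (t : R) : 0 <= t < PI -> Rabs (sin t) <= exp (/ 2 * ln (2 + 2 * cos t)).
Proof.
  intros Ht. assert (Hp := one_plus_cos_pos t Ht).
  assert (H0 : 0 <= sin t) by (apply sin_ge_0; lra). rewrite Rabs_pos_eq by exact H0.
  apply Rsqr_incr_0; [|exact H0|left; apply exp_pos]. unfold Rsqr. rewrite <- exp_plus.
  replace (/ 2 * ln (2 + 2 * cos t) + / 2 * ln (2 + 2 * cos t)) with (ln (2 + 2 * cos t)) by field.
  rewrite exp_ln by lra. generalize (sin2_cos2 t) (COS_bound t). unfold Rsqr. nra.
Qed.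

Lemma cos_pow_prim_lim (s nu : C) : - / 2 < Re s -> Clim (at_left PI) (cos_pow_prim s nu) 0.
Proof.
  intros Hs.
  set (E := exp (PI * Cmod nu)). set (K := Cmod (nu / (2 * (s + 1)))%C).
  apply Clim_squeeze with (g := fun b => E * exp ((Re s + / 2) * ln (2 + 2 * cos b)) + K * E * exp ((Re s + 1) * ln (2 + 2 * cos b))).
  - generalize (at_left_PI_range 0 PI_RGT_0). apply filter_imp. intros b Hb.
    assert (Hp := one_plus_cos_pos b ltac:(lra)).
    replace (cos_pow_prim s nu b - 0)%C with (cos_pow_prim s nu b) by ring.
    unfold cos_pow_prim. rewrite Cmod_mult, Cmod_Cexp_scal.
    set (x := ln (2 + 2 * cos b)).
    assert (HE : forall w, Rabs (Im w) <= PI * Cmod nu -> exp (Rabs (Im w)) <= E) by (intros; apply exp_le; assumption).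
    assert (C1 : Cmod (Ccos (nu * b)) <= E) by (eapply Rle_trans; [apply Cmod_Ccos_le|apply HE, Rabs_Im_scal_le; lra]).
    assert (C2 : Cmod (Csin (nu * b)) <= E) by (eapply Rle_trans; [apply Cmod_Csin_le|apply HE, Rabs_Im_scal_le; lra]).
    assert (C3 := sin_le_sqrt b ltac:(lra)). fold x in C3.
    assert (C4 : Cmod (RtoC (2 + 2 * cos b)) = exp x) by (unfold x; rewrite Cmod_R, Rabs_pos_eq, exp_ln; lra).
    replace ((Re s + / 2) * x) with (Re s * x + / 2 * x) by ring. replace ((Re s + 1) * x) with (Re s * x + x) by ring.
    rewrite !exp_plus.
    replace (E * (exp (Re s * x) * exp (/ 2 * x)) + K * E * (exp (Re s * x) * exp x)) with (exp (Re s * x) * (exp (/ 2 * x) * E + K * (exp x * E))) by ring.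
    apply Rmult_le_compat_l; [left; apply exp_pos|].
    eapply Rle_trans; [apply Cmod_triangle|]. rewrite !Cmod_mult, Cmod_opp, C4, Cmod_R. fold K.
    apply Rplus_le_compat.
    + apply Rmult_le_compat; [apply Rabs_pos|apply Cmod_ge_0|exact C3|exact C1].
    + apply Rmult_le_compat_l; [apply Cmod_ge_0|]. apply Rmult_le_compat_l; [left; apply exp_pos|exact C2].
  - assert (L1 := filterlim_exp_ln_0 (Re s + / 2) ltac:(lra)). assert (L2 := filterlim_exp_ln_0 (Re s + 1) ltac:(lra)).
    replace 0 with (plus (scal E 0) (scal (K * E) 0)) by (unfold plus, scal; simpl; unfold mult; simpl; ring).
    apply (filterlim_comp_2 (F := at_left PI) (G := locally (scal E 0)) (H := locally (scal (K * E) 0))).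
    + apply (filterlim_comp _ _ _ _ (fun y => scal E y) (at_left PI) (locally 0)); [exact L1|apply (filterlim_scal_r (V := R_NormedModule))].
    + apply (filterlim_comp _ _ _ _ (fun y => scal (K * E) y) (at_left PI) (locally 0)); [exact L2|apply (filterlim_scal_r (V := R_NormedModule))].
    + apply (filterlim_plus (V := R_NormedModule)).
Qed.

Lemma Cneq0_Re (z : C) : Re z <> 0 -> z <> 0.
Proof. intros H E. apply H. rewrite E. reflexivity. Qed.

(** [cos_pow_prim] vanishes at both ends, so its derivative has integral zero, and this is solved
    for the exponent s. Convergence for s is thereby deduced from convergence for s + 1. *)
Lemma cos_pow_step (s nu l : C) : - / 2 < Re s -> is_improper (cos_pow (s + 1) nu) l ->
  is_improper (cos_pow s nu) ((s + 1 - nu) * (s + 1 + nu) / ((2 * s + 1) * (2 * s + 2)) * l)%C.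
Proof.
  intros Hs Hl.
  assert (N1 : (s + 1)%C <> 0) by (apply Cneq0_Re; rewrite re_plus, re_RtoC; lra).
  assert (N2 : (2 * s + 1)%C <> 0) by (apply Cneq0_Re; rewrite re_plus, re_scal_l, re_RtoC; lra).
  assert (N3 : (2 * s + 2)%C <> 0) by (apply Cneq0_Re; rewrite re_plus, re_scal_l, re_RtoC; lra).
  set (k := (((s + 1) * (s + 1) - nu * nu) / (2 * (s + 1)))%C).
  assert (HP : is_improper (fun t => k * cos_pow (s + 1) nu t + - (2 * s + 1) * cos_pow s nu t)%C 0).
  { exists (cos_pow_prim s nu). split; [|apply cos_pow_prim_lim, Hs].
    intros b Hb.
    assert (H := is_RInt_derive (V := C_R_CompleteNormedModule) (cos_pow_prim s nu) (fun t => k * cos_pow (s + 1) nu t + - (2 * s + 1) * cos_pow s nu t)%C 0 b).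
    rewrite cos_pow_prim_0 in H.
    replace (cos_pow_prim s nu b) with (minus (cos_pow_prim s nu b) (RtoC 0 : C_R_NormedModule)).
    2:{ apply (minus_zero_r (G := C_R_NormedModule)). }
    apply H; intros x Hx; rewrite Rmin_left, Rmax_right in Hx by lra.
    - apply is_derive_cos_pow_prim; [lra|exact N1].
    - assert (D : forall s', exists m, is_derive (V := C_R_NormedModule) (cos_pow s' nu) x m).
      { intros s'. eexists. apply is_derive_Cmult; [apply is_derive_pow_part; lra|apply is_derive_Ccos_lin]. }
      destruct (D (s + 1)%C) as [m1 D1]. destruct (D s) as [m2 D2].
      eapply is_derive_continuous_C. apply is_derive_Cplus; apply is_derive_Cscal; eassumption. }
  assert (H := is_improper_scal (/ (2 * s + 1)) _ _ (is_improper_minus _ _ _ _ (is_improper_scal k _ _ Hl) HP)).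
  replace ((s + 1 - nu) * (s + 1 + nu) / ((2 * s + 1) * (2 * s + 2)) * l)%C with (/ (2 * s + 1) * (k * l - 0))%C.
  - revert H. apply is_improper_ext. intros t _. field. exact N2.
  - unfold k. field. repeat split; auto.
Qed.

(** * Moments and concentration for large exponents *)

Lemma ln_le_ln4 (t : R) : 0 <= t < PI -> ln (2 + 2 * cos t) <= ln 4.
Proof.
  intros Ht. assert (Hp := one_plus_cos_pos t Ht). apply ln_le; [lra|]. generalize (COS_bound t); lra.
Qed.

Lemma cos_pow_bound (s nu : C) (t : R) : 0 <= Re s -> 0 <= t < PI ->
  Cmod (cos_pow s nu t) <= exp (Re s * ln 4) * exp (PI * Cmod nu).
Proof.
  intros Hs Ht. unfold cos_pow. rewrite Cmod_mult, Cmod_Cexp_scal.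
  apply Rmult_le_compat; [left; apply exp_pos|apply Cmod_ge_0| |].
  - apply exp_le. apply Rmult_le_compat_l; [exact Hs|apply ln_le_ln4, Ht].
  - eapply Rle_trans; [apply Cmod_Ccos_le|]. apply exp_le, Rabs_Im_scal_le; lra.
Qed.

Lemma cos_pow_ex (s nu : C) : 0 <= Re s -> exists l, is_improper (cos_pow s nu) l.
Proof.
  intros Hs. apply is_improper_bounded with (exp (Re s * ln 4) * exp (PI * Cmod nu)).
  - intros t Ht. apply continuous_cos_pow, Ht.
  - intros t Ht. apply cos_pow_bound; assumption.
Qed.

(** PI times the central binomial coefficient: the integral of (2 + 2 cos t)^n over [0, PI]. *)
Definition cos_moment (n : nat) : R := PI * INR (fact (2 * n)) / INR (fact n) ^ 2.

Lemma cos_moment_pos (n : nat) : 0 < cos_moment n.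
Proof.
  unfold cos_moment. apply Rdiv_lt_0_compat; [|apply pow_lt, INR_fact_lt_0].
  apply Rmult_lt_0_compat; [apply PI_RGT_0|apply INR_fact_lt_0].
Qed.

Lemma cos_moment_S (n : nat) : cos_moment (S n) = cos_moment n * (2 * (2 * INR n + 1) / (INR n + 1)).
Proof.
  unfold cos_moment. replace (2 * S n)%nat with (S (S (2 * n))) by lia.
  rewrite !fact_simpl, !mult_INR, !S_INR, mult_INR. simpl (INR 2).
  assert (H := pos_INR n). field. split; [lra|apply INR_fact_neq_0].
Qed.

Lemma Ccos_0 : Ccos 0 = 1.
Proof.
  unfold Ccos. replace (- (Ci * 0))%C with (RtoC 0) by ring. replace (Ci * 0)%C with (RtoC 0) by ring.
  rewrite Cexp_0. field.
Qed.

Lemma cos_pow_nat (n : nat) (t : R) : 0 <= t < PI -> cos_pow (INR n) 0 t = RtoC ((2 + 2 * cos t) ^ n).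
Proof.
  intros Ht. assert (Hp := one_plus_cos_pos t Ht). unfold cos_pow.
  replace (0 * t)%C with (RtoC 0) by ring. rewrite Ccos_0, Cexp_nat, Cexp_RtoC, exp_ln by lra.
  rewrite RtoC_pow. ring.
Qed.

Lemma cos_moment_imp (n : nat) : is_improper (cos_pow (INR n) 0) (cos_moment n).
Proof.
  induction n as [|n IH].
  - apply is_improper_ext with (fun _ => RtoC 1).
    + intros t Ht. rewrite cos_pow_nat by exact Ht. reflexivity.
    + assert (H := is_improper_const 1).
      replace (RtoC (cos_moment 0)) with (PI * 1)%C; [exact H|].
      rewrite <- RtoC_mult. f_equal. unfold cos_moment. simpl. field.
  (* [cos_pow_step] goes from n + 1 down to n. Hence the integral for n + 1 is first some l, which
     is then solved from the known value for n. *)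
  - destruct (cos_pow_ex (INR (S n)) 0) as [l Hl].
    { rewrite re_RtoC. apply pos_INR. }
    assert (Hl' := Hl). rewrite S_INR, RtoC_plus in Hl'.
    assert (Hn := pos_INR n).
    apply cos_pow_step in Hl'; [|rewrite re_RtoC; lra].
    assert (E := is_improper_unique _ _ _ IH Hl').
    replace (RtoC (cos_moment (S n))) with l; [exact Hl|].
    rewrite cos_moment_S, RtoC_mult, E, RtoC_div, !RtoC_mult, !RtoC_plus, !RtoC_mult by lra.
    assert (M1 : (INR n + 1)%C <> 0) by (rewrite <- RtoC_plus; intros E'; apply RtoC_inj in E'; lra).
    assert (M2 : (2 * INR n + 1)%C <> 0) by (rewrite <- RtoC_mult, <- RtoC_plus; intros E'; apply RtoC_inj in E'; lra).
    field. repeat split; auto. rewrite <- RtoC_mult, <- RtoC_plus; intros E'; apply RtoC_inj in E'; lra.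
Qed.

Lemma cos_pow_add_nat (s nu : C) (n : nat) (t : R) : 0 <= t < PI ->
  cos_pow (s + INR n) nu t = (RtoC ((2 + 2 * cos t) ^ n) * cos_pow s nu t)%C.
Proof.
  intros Ht. rewrite <- cos_pow_nat by exact Ht. unfold cos_pow.
  replace ((s + INR n) * ln (2 + 2 * cos t))%C with (INR n * ln (2 + 2 * cos t) + s * ln (2 + 2 * cos t))%C by ring.
  replace (0 * t)%C with (RtoC 0) by ring. rewrite Cexp_plus, Ccos_0. ring.
Qed.

(* [(2 + 2 cos t)^n] is an approximate identity at [0]: its mass away from 0 is controlled by its integral
   against [1 - cos t], which is [cos_moment n / (n + 1)]. *)
Lemma cos_pow_concentration (s nu : C) : 0 <= Re s -> forall eps, 0 < eps ->
  exists K, forall n l, is_improper (cos_pow (s + INR n) nu) l ->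
    Cmod (l / cos_moment n - Cexp (s * ln 4))%C <= eps + K / (INR n + 1).
Proof.
  intros Hs eps He.
  set (M := exp (Re s * ln 4) * exp (PI * Cmod nu)).
  set (g0 := Cexp (s * ln 4)).
  assert (Hg0 : cos_pow s nu 0 = g0).
  { unfold cos_pow. rewrite cos_0. replace (nu * 0)%C with (RtoC 0) by ring. rewrite Ccos_0.
    replace (2 + 2 * 1) with 4 by ring. unfold g0. ring. }
  assert (Hpi := PI_RGT_0).
  assert (HM : forall t, 0 <= t < PI -> Cmod (cos_pow s nu t - g0)%C <= 2 * M).
  { intros t Ht. eapply Rle_trans; [apply Cmod_triangle|]. rewrite Cmod_opp, <- Hg0.
    assert (A := cos_pow_bound s nu t Hs Ht). assert (A0 := cos_pow_bound s nu 0 Hs ltac:(lra)). fold M in A, A0. lra. }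
  assert (Hloc : exists d, 0 < d < PI /\ forall t, 0 <= t < d -> Cmod (cos_pow s nu t - g0)%C <= eps).
  { assert (Hc := continuous_cos_pow s nu 0 ltac:(lra)).
    assert (Hc' : Clim (locally 0) (cos_pow s nu) (cos_pow s nu 0)) by (apply Clim_iff; [exact Hc]).
    destruct (Hc' eps He) as [d Hd]. exists (Rmin d (PI / 2)).
    assert (B1 := Rmin_l d (PI / 2)). assert (B2 := Rmin_r d (PI / 2)).
    split; [split; [apply Rmin_pos; [apply cond_pos|lra]|lra]|].
    intros t Ht. rewrite <- Hg0. left. apply Hd. unfold ball; simpl. unfold AbsRing_ball, abs, minus, plus, opp; simpl.
    rewrite Ropp_0, Rplus_0_r, Rabs_pos_eq; lra. }
  destruct Hloc as [d [Hd1 Hd2]].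
  assert (Hcd : 0 < 1 - cos d).
  { assert (cos d < cos 0) by (apply cos_decreasing_1; lra). rewrite cos_0 in H. lra. }
  assert (HM0 : 0 <= 2 * M) by (eapply Rle_trans; [apply Cmod_ge_0|apply (HM 0); lra]).
  (* For d <= t < PI the crude bound 2 M is at most K (1 - cos t). *)
  set (K := 2 * M / (1 - cos d)).
  assert (HK : 0 <= K) by (apply Rmult_le_pos; [exact HM0|left; apply Rinv_0_lt_compat, Hcd]).
  assert (Hdev : forall t, 0 <= t < PI -> Cmod (cos_pow s nu t - g0)%C <= eps + K * (1 - cos t)).
  { intros t Ht. destruct (Rlt_le_dec t d) as [H|H].
    - assert (B := Hd2 t ltac:(lra)). generalize (COS_bound t). nra.
    - assert (B := HM t Ht).
      assert (cos t <= cos d) by (apply cos_decr_1; lra).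
      assert (2 * M <= K * (1 - cos t)); [|lra].
      apply Rle_trans with (K * (1 - cos d)); [apply Req_le; unfold K; field; lra|].
      apply Rmult_le_compat_l; [exact HK|lra]. }
  exists K. intros n l Hl.
  assert (HA := cos_moment_pos n). assert (Hn := pos_INR n).
  assert (HAC : RtoC (cos_moment n) <> 0) by (intros E; apply RtoC_inj in E; lra).
  assert (I1 : is_improper (fun t => RtoC ((2 + 2 * cos t) ^ n) * (cos_pow s nu t - g0))%C (l - g0 * cos_moment n)%C).
  { apply is_improper_ext with (fun t => cos_pow (s + INR n) nu t - g0 * cos_pow (INR n) 0 t)%C.
    - intros t Ht. rewrite cos_pow_add_nat, cos_pow_nat by exact Ht. ring.
    - apply is_improper_minus; [exact Hl|]. apply is_improper_scal, cos_moment_imp. }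
  assert (I2 : is_improper (fun t => RtoC ((2 + 2 * cos t) ^ n * (eps + K * (1 - cos t)))) (RtoC (cos_moment n * (eps + K / (INR n + 1))))).
  (* As eps + K (1 - cos t) = (eps + 2 K) - (K / 2) (2 + 2 cos t), two moments give this integral
     exactly. *)
  { apply is_improper_ext with (fun t => ((eps + 2 * K)%R * cos_pow (INR n) 0 t - (K / 2)%R * cos_pow (INR (S n)) 0 t)%C).
    - intros t Ht. rewrite !cos_pow_nat by exact Ht. rewrite <- !RtoC_mult, <- RtoC_minus. f_equal. simpl. field.
    - replace (RtoC (cos_moment n * (eps + K / (INR n + 1)))) with ((eps + 2 * K)%R * cos_moment n - (K / 2)%R * cos_moment (S n))%C.
      + apply is_improper_minus; apply is_improper_scal, cos_moment_imp.
      + rewrite <- !RtoC_mult, <- RtoC_minus. f_equal. rewrite cos_moment_S. field. lra. }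
  replace (l / cos_moment n - g0)%C with ((l - g0 * cos_moment n) / cos_moment n)%C by (field; exact HAC).
  rewrite Cmod_div, (Cmod_R (cos_moment n)), Rabs_pos_eq by (auto; lra).
  apply Rle_div_l; [exact HA|]. rewrite (Rmult_comm _ (cos_moment n)).
  refine (is_improper_le _ _ _ _ _ I1 I2).
  intros t Ht. assert (Hp := one_plus_cos_pos t Ht). rewrite Cmod_mult, Cmod_R.
  assert (0 <= (2 + 2 * cos t) ^ n) by (apply pow_le; lra). rewrite Rabs_pos_eq by assumption.
  apply Rmult_le_compat_l; [assumption|apply Hdev, Ht].
Qed.

(** Each of the m integrations by parts contributes two factors to the rising factorial of 2 s + 1
    and one to each of the other two. *)
Lemma cos_pow_iterate (m : nat) : forall s nu l lm : C, 0 <= Re s ->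
  is_improper (cos_pow s nu) l -> is_improper (cos_pow (s + INR m) nu) lm ->
  (l * rising (2 * s + 1) (2 * m) = rising (s + 1 - nu) m * rising (s + 1 + nu) m * lm)%C.
Proof.
  induction m as [|m IH]; intros s nu l lm Hs Hl Hlm.
  - simpl in *. replace (s + 0)%C with s in Hlm by ring. rewrite (is_improper_unique _ _ _ Hl Hlm). ring.
  - assert (Hs1 : 0 <= Re (s + 1)%C) by (rewrite re_plus, re_RtoC; lra).
    destruct (cos_pow_ex (s + 1) nu Hs1) as [l1 Hl1].
    rewrite S_INR, RtoC_plus in Hlm. replace (s + (INR m + 1))%C with (s + 1 + INR m)%C in Hlm by ring.
    specialize (IH (s + 1)%C nu l1 lm Hs1 Hl1 Hlm).
    assert (H := cos_pow_step s nu l1 ltac:(lra) Hl1).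
    rewrite (is_improper_unique _ _ _ Hl H).
    replace (2 * S m)%nat with (S (S (2 * m))) by lia.
    rewrite (rising_shift (2 * s + 1)), (rising_shift (2 * s + 1 + 1)), (rising_shift (s + 1 - nu)), (rising_shift (s + 1 + nu)).
    assert (N2 : (2 * s + 1)%C <> 0) by (apply Cneq0_Re; rewrite re_plus, re_scal_l, re_RtoC; lra).
    assert (N3 : (2 * s + 2)%C <> 0) by (apply Cneq0_Re; rewrite re_plus, re_scal_l, re_RtoC; lra).
    replace (2 * s + 1 + 1 + 1)%C with (2 * (s + 1) + 1)%C by ring.
    replace (s + 1 - nu + 1)%C with (s + 1 + 1 - nu)%C by ring. replace (s + 1 + nu + 1)%C with (s + 1 + 1 + nu)%C by ring.
    transitivity ((s + 1 - nu) * (s + 1 + nu) * (l1 * rising (2 * (s + 1) + 1) (2 * m)))%C.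
    + field. split; assumption.
    + rewrite IH. ring.
Qed.

Lemma Clim_cos_pow_ratio (s nu : C) : 0 <= Re s ->
  Clim eventually (fun n => integral_0_PI (cos_pow (s + INR n) nu) / cos_moment n)%C (Cexp (s * ln 4)%C).
Proof.
  intros Hs e He. destruct (cos_pow_concentration s nu Hs (e / 2) ltac:(lra)) as [K HK].
  destruct (nat_ge (2 * Rabs K / e)) as [N HN].
  exists N. intros n Hn. assert (Hn0 := pos_INR n).
  destruct (cos_pow_ex (s + INR n) nu) as [l Hl].
  { rewrite re_plus, re_RtoC. lra. }
  rewrite (is_improper_integral _ _ Hl). eapply Rle_lt_trans; [apply HK, Hl|].
  assert (K / (INR n + 1) < e / 2); [|lra].
  apply Rlt_div_l; [lra|]. assert (A := Rle_abs K). apply le_INR in Hn.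
  assert (2 * Rabs K <= e * INR n).
  { apply Rle_trans with (e * (2 * Rabs K / e)); [apply Req_le; field; lra|apply Rmult_le_compat_l; lra]. }
  lra.
Qed.

Lemma rising_gauss (n : nat) (s : C) : (1 <= n)%nat ->
  rising s (S n) = (gauss_prod n s * INR (fact n) * Cexp (s * ln (INR n)))%C.
Proof.
  intros Hn. unfold gauss_prod. rewrite cpow_pos by (apply lt_0_INR; lia).
  field. split; [apply Cexp_neq0|apply INR_fact_neq0C].
Qed.

(** [cos_pow_iterate] with n + 1 steps, in terms of Euler-Gauss products; the 2 n + 2 factors of the
    rising factorial of 2 s + 1 give the index 2 n + 1. The exponent 2 s + 1 appears as 2 (s + 1/2)
    to fit [Clim_double_factor], so that every factor has a known limit. *)
Lemma cos_pow_integral_gauss (s nu l : C) (n : nat) : (1 <= n)%nat -> 0 <= Re s ->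
  is_improper (cos_pow s nu) l ->
  (l * gauss_prod (2 * n + 1) (2 * s + 1) =
   gauss_prod n (s + 1 - nu) * gauss_prod n (s + 1 + nu) *
   (2 * PI / ((1 + INR n) / INR n) / Cexp (2 * (s + / 2) * ln (INR (2 * n + 1) / INR n))) *
   (integral_0_PI (cos_pow (s + INR (S n)) nu) / cos_moment (S n)))%C.
Proof.
  intros Hn Hs Hl.
  destruct (cos_pow_ex (s + INR (S n)) nu) as [lm Hlm].
  { rewrite re_plus, re_RtoC. generalize (pos_INR (S n)); lra. }
  rewrite (is_improper_integral _ _ Hlm).
  assert (H := cos_pow_iterate (S n) s nu l lm Hs Hl Hlm).
  replace (2 * S n)%nat with (S (2 * n + 1)) in H by lia.
  rewrite !rising_gauss in H by lia.
  assert (Hp : 0 < INR n) by (apply lt_0_INR; lia). assert (Hp' : 0 < INR (2 * n + 1)) by (apply lt_0_INR; lia).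
  rewrite ln_div, RtoC_minus by assumption.
  replace (2 * (s + / 2) * (ln (INR (2 * n + 1)) - ln (INR n)))%C with ((2 * s + 1) * ln (INR (2 * n + 1)) - (2 * s + 1) * ln (INR n))%C by field.
  rewrite Cexp_minus.
  set (P := gauss_prod (2 * n + 1) (2 * s + 1)) in *.
  set (E := Cexp ((2 * s + 1) * ln (INR (2 * n + 1)))) in *.
  assert (HE : (Cexp ((s + 1 - nu) * ln (INR n)) * Cexp ((s + 1 + nu) * ln (INR n)) = Cexp ((2 * s + 1) * ln (INR n)) * INR n)%C).
  { rewrite <- Cexp_plus. transitivity (Cexp ((2 * s + 1) * ln (INR n)) * Cexp (ln (INR n)))%C.
    - rewrite <- Cexp_plus. f_equal. ring.
    - rewrite (Cexp_RtoC (ln (INR n))), exp_ln by assumption. reflexivity. }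
  set (E1 := Cexp ((s + 1 - nu) * ln (INR n))) in *. set (E2 := Cexp ((s + 1 + nu) * ln (INR n))) in *.
  set (E3 := Cexp ((2 * s + 1) * ln (INR n))) in *.
  assert (NE : E <> 0) by apply Cexp_neq0. assert (NE3 : E3 <> 0) by apply Cexp_neq0.
  assert (NF := INR_fact_neq0C (2 * n + 1)). assert (NFn := INR_fact_neq0C n). assert (Nn := RtoC_INR_neq0 n Hn).
  assert (N1 : (1 + INR n)%C <> 0) by (rewrite <- RtoC_plus; intros E'; apply RtoC_inj in E'; lra).
  assert (Npi : RtoC PI <> 0) by (intros E'; apply RtoC_inj in E'; generalize PI_RGT_0; lra).
  assert (HM : RtoC (cos_moment (S n)) = (2 * PI * INR (fact (2 * n + 1)) / (INR (fact n) * INR (fact n) * (1 + INR n)))%C).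
  { unfold cos_moment. replace (2 * S n)%nat with (S (2 * n + 1)) by lia.
    rewrite !fact_simpl, !mult_INR.
    rewrite <- RtoC_plus, <- !RtoC_mult, <- RtoC_div.
    - f_equal. rewrite !S_INR, plus_INR, mult_INR. simpl (INR 2). simpl (INR 1). field.
      split; [lra|apply INR_fact_neq_0].
    - apply Rmult_integral_contrapositive; split; [|lra]. apply Rmult_integral_contrapositive; split; apply INR_fact_neq_0. }
  rewrite HM.
  set (F := RtoC (INR (fact (2 * n + 1)))) in *. set (f := RtoC (INR (fact n))) in *.
  transitivity (l * (P * F * E) / (F * E))%C; [field; auto|]. rewrite H.
  set (g1 := gauss_prod n (s + 1 - nu)). set (g2 := gauss_prod n (s + 1 + nu)).
  transitivity (g1 * g2 * f * f * (E1 * E2) * lm / (F * E))%C; [field; auto|]. rewrite HE.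
  field. repeat split; auto.
Qed.

(** For Re s >= 0 the integrand is bounded, so the integral exists and the limit of
    [cos_pow_integral_gauss] determines it. One further integration by parts reaches Re s > -
    1/2. *)
Lemma cauchy_cos_integral (s nu : C) : - / 2 < Re s ->
  is_improper (cos_pow s nu) (PI * rGamma (s + 1 + nu) * rGamma (s + 1 - nu) / rGamma (2 * s + 1))%C.
Proof.
  assert (Main : forall s, 0 <= Re s -> is_improper (cos_pow s nu) (PI * rGamma (s + 1 + nu) * rGamma (s + 1 - nu) / rGamma (2 * s + 1))%C).
  { clear s. intros s Hs. destruct (cos_pow_ex s nu Hs) as [l Hl].
    assert (HG : rGamma (2 * s + 1) <> 0) by (apply rGamma_neq0_Re; rewrite re_plus, re_scal_l, re_RtoC; lra).
    assert (E : (l * rGamma (2 * s + 1) = rGamma (s + 1 - nu) * rGamma (s + 1 + nu) * (2 * PI / 1 / Cexp (2 * (s + / 2) * ln 2)) * Cexp (s * ln 4))%C).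
    { apply (Clim_unique (F := eventually) (fun n => l * gauss_prod (2 * n + 1) (2 * s + 1))%C).
      - apply Clim_mult; [apply Clim_const|].
        apply (Clim_comp eventually eventually (fun n => 2 * n + 1)%nat (fun n => gauss_prod n (2 * s + 1))); [apply filterlim_2n1|apply gauss_prod_cv].
      - apply Clim_ext with (fun n => gauss_prod n (s + 1 - nu) * gauss_prod n (s + 1 + nu) *
          (2 * PI / ((1 + INR n) / INR n) / Cexp (2 * (s + / 2) * ln (INR (2 * n + 1) / INR n))) *
          (integral_0_PI (cos_pow (s + INR (S n)) nu) / cos_moment (S n)))%C.
        + exists 1%nat. intros n Hn. symmetry. apply cos_pow_integral_gauss; assumption.
        + apply Clim_mult.
          * apply Clim_mult; [apply Clim_mult; [|]; apply gauss_prod_cv|].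
            apply Clim_div; [apply Cexp_neq0| |apply Clim_double_factor].
            apply Clim_div; [apply C1_nz|apply Clim_const|apply Clim_ratio_INR].
          * apply (Clim_comp eventually eventually S (fun n => integral_0_PI (cos_pow (s + INR n) nu) / cos_moment n)%C); [|apply Clim_cos_pow_ratio, Hs].
            intros P [N HN]. exists N. intros n Hn. apply HN. lia. }
    (* 2^(2 s + 1) is twice 4^s, so the limit 4^s of the concentrating integrals and the factor 2
       cancel against it. *)
    replace (2 * (s + / 2) * ln 2)%C with (s * ln 4 + ln 2)%C in E.
    2:{ replace 4 with (2 * 2) by ring. rewrite ln_mult, RtoC_plus by lra. field. }
    rewrite Cexp_plus, (Cexp_RtoC (ln 2)), exp_ln in E by lra.
    replace (PI * rGamma (s + 1 + nu) * rGamma (s + 1 - nu) / rGamma (2 * s + 1))%C with l; [exact Hl|].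
    transitivity (l * rGamma (2 * s + 1) / rGamma (2 * s + 1))%C; [field; exact HG|].
    rewrite E. field. split; [exact HG|apply Cexp_neq0]. }
  intros Hs.
  assert (Hs1 : 0 <= Re (s + 1)%C) by (rewrite re_plus, re_RtoC; lra).
  assert (H := cos_pow_step s nu _ Hs (Main _ Hs1)).
  assert (N2 : (2 * s + 1)%C <> 0) by (apply Cneq0_Re; rewrite re_plus, re_scal_l, re_RtoC; lra).
  assert (N3 : (2 * s + 2)%C <> 0) by (apply Cneq0_Re; rewrite re_plus, re_scal_l, re_RtoC; lra).
  rewrite (rGamma_rec (s + 1 + nu)), (rGamma_rec (s + 1 - nu)), (rGamma_rec (2 * s + 1)), (rGamma_rec (2 * s + 1 + 1)).
  replace (2 * s + 1 + 1 + 1)%C with (2 * (s + 1) + 1)%C by ring.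
  replace (s + 1 - nu + 1)%C with (s + 1 + 1 - nu)%C by ring. replace (s + 1 + nu + 1)%C with (s + 1 + 1 + nu)%C by ring.
  replace (2 * s + 1 + 1)%C with (2 * s + 2)%C by ring.
  assert (HG : rGamma (2 * (s + 1) + 1) <> 0) by (apply rGamma_neq0_Re; rewrite !re_plus, re_scal_l, !re_RtoC, re_plus, re_RtoC; lra).
  replace (PI * ((s + 1 + nu) * rGamma (s + 1 + 1 + nu)) * ((s + 1 - nu) * rGamma (s + 1 + 1 - nu)) / ((2 * s + 1) * ((2 * s + 2) * rGamma (2 * (s + 1) + 1))))%C
    with ((s + 1 - nu) * (s + 1 + nu) / ((2 * s + 1) * (2 * s + 2)) *
        (PI * rGamma (s + 1 + 1 + nu) * rGamma (s + 1 + 1 - nu) / rGamma (2 * (s + 1) + 1)))%C; [exact H|].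
  field. repeat split; assumption.
Qed.

Lemma gauss_prod_RtoC (n : nat) (x : R) : (1 <= n)%nat -> 0 <= x -> exists y, 0 <= y /\ gauss_prod n x = RtoC y.
Proof.
  intros Hn Hx.
  assert (HR : forall m, exists y, 0 <= y /\ rising x m = RtoC y).
  { induction m as [|m [y [Hy E]]]; [exists 1; split; [lra|reflexivity]|].
    exists (y * (x + INR m)). split; [apply Rmult_le_pos; [exact Hy|generalize (pos_INR m); lra]|].
    simpl. rewrite E, RtoC_mult, RtoC_plus. reflexivity. }
  destruct (HR (S n)) as [y [Hy E]].
  exists (y / (INR (fact n) * exp (x * ln (INR n)))).
  assert (P : 0 < INR (fact n) * exp (x * ln (INR n))) by (apply Rmult_lt_0_compat; [apply INR_fact_lt_0|apply exp_pos]).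
  split; [apply Rmult_le_pos; [exact Hy|left; apply Rinv_0_lt_compat, P]|].
  unfold gauss_prod. rewrite cpow_pos by (apply lt_0_INR; lia).
  rewrite E, <- RtoC_mult, Cexp_RtoC, <- RtoC_mult, <- RtoC_div by lra. reflexivity.
Qed.

(** The integral at s = 1/2 yields only the square of 1 / Gamma (1/2); this fixes the sign of the
    root. At x >= 0 the Euler-Gauss products are nonnegative reals. *)
Lemma rGamma_real_nonneg (x : R) : 0 <= x -> Im (rGamma x) = 0 /\ 0 <= Re (rGamma x).
Proof.
  intros Hx. assert (H := gauss_prod_cv x).
  assert (Hm : forall e, 0 < e -> exists y, 0 <= y /\ Cmod (RtoC y - rGamma x)%C < e).
  { intros e He. destruct (H e He) as [N HN]. destruct (gauss_prod_RtoC (S N) x ltac:(lia) Hx) as [y [Hy E]].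
    exists y. split; [exact Hy|]. rewrite <- E. apply HN. lia. }
  split.
  - destruct (Req_dec (Im (rGamma x)) 0) as [E|E]; [exact E|exfalso].
    destruct (Hm (Rabs (Im (rGamma x))) (Rabs_pos_lt _ E)) as [y [Hy Hc]].
    assert (A := Rmax_Cmod (RtoC y - rGamma x)%C).
    assert (B := Rmax_r (Rabs (fst (RtoC y - rGamma x)%C)) (Rabs (snd (RtoC y - rGamma x)%C))).
    replace (snd (RtoC y - rGamma x)%C) with (- Im (rGamma x)) in * by (simpl; unfold Im; ring).
    rewrite Rabs_Ropp in *. lra.
  - apply Rnot_lt_le. intros L. destruct (Hm (- Re (rGamma x)) ltac:(lra)) as [y [Hy Hc]].
    assert (A := re_le_Cmod (RtoC y - rGamma x)%C). assert (B := Rle_abs (Re (RtoC y - rGamma x)%C)).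
    replace (Re (RtoC y - rGamma x)%C) with (y - Re (rGamma x)) in * by (simpl; unfold Re; simpl; ring). lra.
Qed.

Lemma rGamma_half : rGamma (/ 2) = (/ sqrt PI)%C.
Proof.
  assert (Hpi := PI_RGT_0).
  (* The square root of 2 + 2 cos t is 2 cos (t / 2), with primitive 4 sin (t / 2). Comparison with
     Cauchy's formula gives the square of 1/Gamma at 3/2, hence at 1/2. *)
  assert (I : is_improper (cos_pow (/ 2) 0) 4).
  { apply is_improper_ext with (fun t => RtoC (2 * cos (t / 2))).
    - intros t Ht. unfold cos_pow. replace (0 * t)%C with (RtoC 0) by ring. rewrite Ccos_0.
      assert (Hc : 0 < cos (t / 2)) by (apply cos_gt_0; lra).
      replace (2 + 2 * cos t) with ((2 * cos (t / 2)) * (2 * cos (t / 2))).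
      + rewrite ln_mult, RtoC_plus by lra.
        replace (/ 2 * (ln (2 * cos (t / 2)) + ln (2 * cos (t / 2))))%C with (RtoC (ln (2 * cos (t / 2)))) by field.
        rewrite Cexp_RtoC, exp_ln by lra. ring.
      + replace t with (2 * (t / 2)) at 3 by field. rewrite cos_2a_cos. ring.
    - exists (fun b => RtoC (4 * sin (b / 2))). split.
      + intros b Hb.
        assert (H := is_RInt_derive (V := C_R_CompleteNormedModule) (fun b => RtoC (4 * sin (b / 2))) (fun t => RtoC (2 * cos (t / 2))) 0 b).
        replace (RtoC (4 * sin (b / 2))) with (minus (RtoC (4 * sin (b / 2)) : C_R_NormedModule) (RtoC (4 * sin (0 / 2)))).
        2:{ replace (0 / 2) with 0 by field. rewrite sin_0, Rmult_0_r. apply (minus_zero_r (G := C_R_NormedModule)). }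
        apply H; intros x _.
        * apply is_derive_RtoC. auto_derive; [trivial|]. unfold Rdiv. field.
        * eapply is_derive_continuous_C. apply is_derive_RtoC. auto_derive; [trivial|reflexivity].
      + apply Clim_RtoC.
        assert (Hc : continuous (fun b => 4 * sin (b / 2)) PI) by (apply (ex_derive_continuous (fun b => 4 * sin (b / 2))); auto_derive; trivial).
        unfold continuous in Hc. rewrite sin_PI2, Rmult_1_r in Hc.
        intros P HP. destruct (Hc P HP) as [e He]. exists e. intros y Hy _. apply He, Hy. }
  assert (H := cauchy_cos_integral (/ 2)%C 0 ltac:(rewrite <- RtoC_inv, re_RtoC by lra; lra)).
  apply (is_improper_unique _ _ _ I) in H.
  replace (/ 2 + 1 + 0)%C with (/ 2 + 1)%C in H by ring. replace (/ 2 + 1 - 0)%C with (/ 2 + 1)%C in H by ring.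
  replace (2 * / 2 + 1)%C with (1 + 1)%C in H by field.
  assert (G2 : rGamma (1 + 1)%C = 1).
  { assert (G := rGamma_rec 1). rewrite rGamma_1 in G. rewrite Cmult_1_l in G. symmetry. exact G. }
  rewrite G2 in H.
  assert (Gh := rGamma_rec (/ 2)).
  assert (Npi : RtoC PI <> 0) by (intros E'; apply RtoC_inj in E'; lra).
  assert (Sq : (rGamma (/ 2) * rGamma (/ 2) = RtoC (/ PI))%C).
  { rewrite Gh. transitivity (PI * rGamma (/ 2 + 1) * rGamma (/ 2 + 1) / 1 * / (4 * PI))%C.
    - field. exact Npi.
    - rewrite <- H. rewrite RtoC_inv by lra. field. exact Npi. }
  assert (E2 : (/ 2)%C = RtoC (/ 2)) by (rewrite RtoC_inv; [reflexivity|lra]).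
  destruct (rGamma_real_nonneg (/ 2) ltac:(lra)) as [A B]. rewrite <- E2 in A, B.
  set (g := Re (rGamma (/ 2))) in *.
  assert (Eg : rGamma (/ 2) = RtoC g) by (apply C_eq; [reflexivity|exact A]).
  rewrite Eg in Sq |- *. rewrite <- RtoC_mult in Sq. apply RtoC_inj in Sq.
  rewrite <- RtoC_inv by (apply Rgt_not_eq, sqrt_lt_R0; lra). f_equal.
  rewrite <- sqrt_inv, <- Sq. symmetry. apply sqrt_square. exact B.
Qed.

Lemma rGamma_duplication (s : C) :
  (rGamma s * rGamma (s + / 2) = rGamma (2 * s) * Cexp (2 * s * ln 2) / (2 * sqrt PI))%C.
Proof.
  rewrite rGamma_duplication_aux, rGamma_half. field.
  intros E; apply RtoC_inj in E. generalize (sqrt_lt_R0 PI PI_RGT_0); lra.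
Qed.

(** * Series and Kummer's transformation *)

Definition Cser (a : nat -> C) (l : C) : Prop := Clim eventually (fun n => sum_n a n : C) l.

Lemma Cser_Cseries (a : nat -> C) (l : C) : Cser a l -> Cseries a = l.
Proof. intros H. apply Climit_eq; [exact H]. Qed.

Lemma Cser_ext (a b : nat -> C) (l : C) : (forall n, a n = b n) -> Cser a l -> Cser b l.
Proof.
  intros H. apply Clim_ext. exists 0%nat. intros n _. apply sum_n_ext, H.
Qed.

Lemma Csum_scal (c : C) (a : nat -> C) (n : nat) : @eq C (sum_n (fun k => c * a k)%C n) (c * sum_n a n)%C.
Proof. induction n as [|n IH]; rewrite ?Csum_0, ?Csum_S, ?IH; [reflexivity|ring]. Qed.

Lemma Csum_plus (a b : nat -> C) (n : nat) : @eq C (sum_n (fun k => a k + b k)%C n) (sum_n a n + sum_n b n)%C.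
Proof. induction n as [|n IH]; rewrite ?Csum_0, ?Csum_S, ?IH; [reflexivity|ring]. Qed.

Lemma Csum_ext_le (a b : nat -> C) (n : nat) : (forall k, (k <= n)%nat -> a k = b k) -> @eq C (sum_n a n) (sum_n b n).
Proof. intros H. apply sum_n_ext_loc, H. Qed.

Lemma Csum_shift (a : nat -> C) (n : nat) : @eq C (sum_n a (S n)) (a 0%nat + sum_n (fun k => a (S k)) n)%C.
Proof. induction n as [|n IH]; [rewrite Csum_S, !Csum_0; reflexivity|]. rewrite Csum_S, IH, Csum_S. ring. Qed.

Lemma Cser_scal (c : C) (a : nat -> C) (l : C) : Cser a l -> Cser (fun n => c * a n)%C (c * l)%C.
Proof.
  intros H. apply Clim_ext with (fun n => c * sum_n a n)%C.
  - exists 0%nat. intros n _. symmetry. apply Csum_scal.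
  - apply Clim_mult; [apply Clim_const|exact H].
Qed.

Lemma Cser_unique (a : nat -> C) (l m : C) : Cser a l -> Cser a m -> l = m.
Proof. apply Clim_unique. Qed.

Lemma Cser_dominated (a : nat -> C) (b : nat -> R) :
  (forall n, Cmod (a n) <= b n) -> ex_series b -> exists l, Cser a l.
Proof.
  intros Hab Hb.
  destruct (ex_series_le (K := C_AbsRing) (V := C_CompleteNormedModule) a b Hab Hb) as [l Hl].
  exists l. apply Clim_iff. exact Hl.
Qed.

Lemma Cser_tail_le (a : nat -> C) (b : nat -> R) (l : C) (m : R) (N : nat) :
  (forall n, Cmod (a n) <= b n) -> is_series b m -> Cser a l ->
  Cmod (l - sum_n a N)%C <= m - sum_n b N.
Proof.
  intros Hab Hb Ha.
  assert (Hmono : forall n, (N <= n)%nat -> Cmod (sum_n a n - sum_n a N)%C <= sum_n b n - sum_n b N).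
  { intros n Hn. induction Hn as [|n Hn IH].
    - replace (sum_n a N - sum_n a N)%C with (RtoC 0) by ring. rewrite Cmod_0. lra.
    - rewrite Csum_S, sum_Sn. unfold plus; simpl.
      replace (sum_n a n + a (S n) - sum_n a N)%C with ((sum_n a n - sum_n a N) + a (S n))%C by ring.
      eapply Rle_trans; [apply Cmod_triangle|]. specialize (Hab (S n)). lra. }
  assert (Hup : forall n, (N <= n)%nat -> sum_n b n <= m).
  { assert (Hinc : forall n, sum_n b n <= sum_n b (S n)).
    { intros n. rewrite sum_Sn. unfold plus; simpl. generalize (Hab (S n)) (Cmod_ge_0 (a (S n))); lra. }
    intros n _. apply (is_lim_seq_incr_compare (fun n => sum_n b n) m); [exact Hb|exact Hinc]. }
  apply (Clim_le (F := eventually) (fun n => (sum_n a n - sum_n a N)%C)).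
  - exists N. intros n Hn. eapply Rle_trans; [apply Hmono, Hn|]. specialize (Hup n Hn). lra.
  - apply Clim_minus; [exact Ha|apply Clim_const].
Qed.

Lemma ex_series_exp (x : R) : ex_series (fun n => x ^ n / INR (fact n)).
Proof.
  exists (exp x). assert (H := is_exp_Reals x). unfold is_pseries in H.
  revert H. apply is_series_ext. intros n. rewrite pow_n_pow. unfold scal; simpl. unfold mult; simpl. reflexivity.
Qed.

Lemma Cser_exp (z : C) : Cser (exp_term z) (Cexp z).
Proof.
  apply Clim_squeeze with (g := fun n => exp (Cmod z) * (Cmod z ^ S n / INR (fact (S n)))).
  - exists 0%nat. intros n _. rewrite <- Cmod_opp.
    replace (- (sum_n (exp_term z) n - Cexp z))%C with (Cexp z - sum_n (exp_term z) n)%C by ring.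
    rewrite Rmult_comm. apply Cexp_taylor.
  - assert (H := ex_series_lim_0 _ (ex_series_exp (Cmod z))).
    apply (is_lim_seq_incr_1 (fun n => Cmod z ^ n / INR (fact n))) in H.
    apply (is_lim_seq_scal_l _ (exp (Cmod z))) in H. simpl in H. rewrite Rmult_0_r in H. exact H.
Qed.

Lemma Re_sum (a : nat -> C) (n : nat) : Re (sum_n a n) = sum_n (fun k => Re (a k)) n.
Proof. induction n as [|n IH]; [rewrite Csum_0, sum_O; reflexivity|]. rewrite Csum_S, sum_Sn, re_plus, IH. reflexivity. Qed.

Lemma Im_sum (a : nat -> C) (n : nat) : Im (sum_n a n) = sum_n (fun k => Im (a k)) n.
Proof. induction n as [|n IH]; [rewrite Csum_0, sum_O; reflexivity|]. rewrite Csum_S, sum_Sn, im_plus, IH. reflexivity. Qed.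

Lemma im_le_Cmod (c : C) : Rabs (Im c) <= Cmod c.
Proof. eapply Rle_trans; [|apply Rmax_Cmod]. apply Rmax_r. Qed.

Lemma Cser_components (a : nat -> C) (l : C) :
  Cser a l <-> is_series (fun n => Re (a n)) (Re l) /\ is_series (fun n => Im (a n)) (Im l).
Proof.
  split.
  - intros H. split; intros P [e He].
    + change (eventually (fun n => P (sum_n (fun n => Re (a n)) n))).
      generalize (H e (cond_pos e)). apply filter_imp. intros n Hn. apply He. rewrite <- Re_sum.
      unfold ball; simpl. unfold AbsRing_ball, abs, minus, plus, opp; simpl.
      eapply Rle_lt_trans; [|exact Hn]. assert (A := re_le_Cmod (sum_n a n - l)%C). exact A.
    + change (eventually (fun n => P (sum_n (fun n => Im (a n)) n))).
      generalize (H e (cond_pos e)). apply filter_imp. intros n Hn. apply He. rewrite <- Im_sum.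
      unfold ball; simpl. unfold AbsRing_ball, abs, minus, plus, opp; simpl.
      eapply Rle_lt_trans; [|exact Hn]. assert (A := im_le_Cmod (sum_n a n - l)%C). exact A.
  - intros [H1 H2].
    assert (E : forall z, z = (RtoC (Re z) + RtoC (Im z) * Ci)%C).
    { intros z. apply C_eq; rewrite ?re_plus, ?im_plus, ?re_scal_l, ?im_scal_l; simpl; ring. }
    apply Clim_ext with (fun n => RtoC (sum_n (fun k => Re (a k)) n) + RtoC (sum_n (fun k => Im (a k)) n) * Ci)%C.
    + exists 0%nat. intros n _. rewrite (E (sum_n a n)), Re_sum, Im_sum. reflexivity.
    + rewrite (E l). apply Clim_plus; [apply Clim_RtoC; [exact H1]|].
      apply Clim_mult; [apply Clim_RtoC; [exact H2]|apply Clim_const].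
Qed.

Definition Cconv (a b : nat -> C) (j : nat) : C := sum_n (fun n => a n * b (j - n)%nat)%C j.

Lemma sum_n_Rminus (a b : nat -> R) (n : nat) : sum_n (fun k => a k - b k) n = sum_n a n - sum_n b n.
Proof. induction n as [|n IH]; rewrite ?sum_O, ?sum_Sn, ?IH; unfold plus; simpl; ring. Qed.

Lemma sum_n_Rplus (a b : nat -> R) (n : nat) : sum_n (fun k => a k + b k) n = sum_n a n + sum_n b n.
Proof. induction n as [|n IH]; rewrite ?sum_O, ?sum_Sn, ?IH; unfold plus; simpl; ring. Qed.

(** Real and imaginary parts of both series converge absolutely, so the four real Cauchy products
    exist and combine to the complex one. *)
Lemma Cser_conv (a b : nat -> C) (la lb : C) (ba bb : nat -> R) :
  (forall n, Cmod (a n) <= ba n) -> (forall n, Cmod (b n) <= bb n) -> ex_series ba -> ex_series bb ->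
  Cser a la -> Cser b lb -> Cser (Cconv a b) (la * lb)%C.
Proof.
  intros Hba Hbb Eba Ebb Ha Hb.
  apply Cser_components in Ha, Hb. destruct Ha as [A1 A2], Hb as [B1 B2].
  assert (Ex : forall (p : C -> R) (c : nat -> C) (bc : nat -> R), (forall z, Rabs (p z) <= Cmod z) -> (forall n, Cmod (c n) <= bc n) -> ex_series bc -> ex_series (fun n => Rabs (p (c n)))).
  { intros p c bc Hp Hc E. apply (ex_series_le (K := R_AbsRing) (V := R_CompleteNormedModule) _ bc); [|exact E].
    intros n. unfold norm; simpl. unfold abs; simpl. rewrite Rabs_Rabsolu. eapply Rle_trans; [apply Hp|apply Hc]. }
  assert (EA1 := Ex Re a ba re_le_Cmod Hba Eba). assert (EA2 := Ex Im a ba im_le_Cmod Hba Eba).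
  assert (EB1 := Ex Re b bb re_le_Cmod Hbb Ebb). assert (EB2 := Ex Im b bb im_le_Cmod Hbb Ebb).
  assert (M11 := is_series_mult _ _ _ _ A1 B1 EA1 EB1). assert (M22 := is_series_mult _ _ _ _ A2 B2 EA2 EB2).
  assert (M12 := is_series_mult _ _ _ _ A1 B2 EA1 EB2). assert (M21 := is_series_mult _ _ _ _ A2 B1 EA2 EB1).
  apply Cser_components. split.
  - rewrite re_mult. assert (M := is_series_minus _ _ _ _ M11 M22). revert M. apply is_series_ext.
    intros n. unfold Cconv. rewrite Re_sum. rewrite <- !sum_n_Reals. unfold minus, plus, opp; simpl.
    match goal with |- ?x + - ?y = _ => change (x - y = sum_n (fun k => Re (a k * b (n - k)%nat)%C) n) end.
    rewrite <- sum_n_Rminus. apply sum_n_ext. intros k. rewrite re_mult. reflexivity.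
  - rewrite im_mult. assert (M := is_series_plus _ _ _ _ M12 M21). revert M. apply is_series_ext.
    intros n. unfold Cconv. rewrite Im_sum. rewrite <- !sum_n_Reals. symmetry.
    rewrite (sum_n_ext _ (fun k => Re (a k) * Im (b (n - k)%nat) + Im (a k) * Re (b (n - k)%nat))).
    + apply (sum_n_Rplus (fun k => Re (a k) * Im (b (n - k)%nat))).
    + intros k. apply im_mult.
Qed.

(** * Kummer's transformation on coefficients *)

Definition ex_Cderiv (f : C -> C) (s0 : C) : Prop := exists l, is_Cderiv f s0 l.

Lemma ex_Cderiv_mult (f g : C -> C) (s0 : C) : ex_Cderiv f s0 -> ex_Cderiv g s0 -> ex_Cderiv (fun s => f s * g s)%C s0.
Proof. intros [l Hl] [m Hm]. eexists. apply is_Cderiv_mult; eassumption. Qed.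

Lemma ex_Cderiv_const (c s0 : C) : ex_Cderiv (fun _ => c) s0.
Proof. eexists. apply is_Cderiv_const. Qed.

Lemma ex_Cderiv_affine (f : C -> C) (c d s0 : C) : c <> 0 -> ex_Cderiv f (c * s0 + d)%C -> ex_Cderiv (fun s => f (c * s + d)%C) s0.
Proof. intros Hc [l Hl]. eexists. apply is_Cderiv_affine; eassumption. Qed.

Lemma ex_Cderiv_ext (f g : C -> C) (s0 : C) : (forall s, f s = g s) -> ex_Cderiv f s0 -> ex_Cderiv g s0.
Proof. intros H [l Hl]. exists l. revert Hl. apply is_Cderiv_ext, H. Qed.

Lemma ex_Cderiv_sum (f : nat -> C -> C) (n : nat) (s0 : C) : (forall k, ex_Cderiv (f k) s0) ->
  ex_Cderiv (fun s => sum_n (fun k => f k s) n) s0.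
Proof.
  intros H. induction n as [|n [l IH]].
  - apply ex_Cderiv_ext with (f 0%nat); [|apply H]. intros s. symmetry. exact (Csum_0 (fun k => f k s)).
  - destruct (H (S n)) as [m Hm]. exists (l + m)%C.
    apply is_Cderiv_ext with (fun s => sum_n (fun k => f k s) n + f (S n) s)%C; [|apply is_Cderiv_plus; assumption].
    intros s. symmetry. exact (Csum_S (fun k => f k s) n).
Qed.

Lemma ex_Cderiv_rGamma_shift (d s0 : C) : ex_Cderiv (fun s => rGamma (s + d)) s0.
Proof.
  apply ex_Cderiv_ext with (fun s => rGamma (1 * s + d)%C).
  - intros s. f_equal. ring.
  - apply (ex_Cderiv_affine rGamma 1 d s0); [apply C1_nz|apply ex_Cderiv_rGamma].
Qed.

(** Removes isolated exceptional parameters: differentiable functions are continuous, so an identity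
    around s0 passes to s0. *)
Lemma eq_by_continuity (f g : C -> C) (s0 : C) : ex_Cderiv f s0 -> ex_Cderiv g s0 ->
  Cpunct s0 (fun s => f s = g s) -> f s0 = g s0.
Proof.
  intros [l Hl] [m Hm] H. apply is_Cderiv_cont in Hl, Hm.
  apply (Clim_unique (F := Cpunct s0) g); [|exact Hm]. revert Hl. apply Clim_ext; [exact H].
Qed.

(** The coefficient of x^j in 1F1 (mu + 1/2; 2 mu + 1; 4 x) / Gamma (mu + 1). In this form the
    denominator (2 mu + 1)_j is cancelled, so the coefficient makes sense and is differentiable for
    every mu. *)
Definition kummer_coef (j : nat) (mu : C) : C :=
  (rGamma (mu + INR j + 1) * rising (2 * mu + INR j + 1) j / INR (fact j))%C.

(* Coefficients of [x^n] in [sum_k x^(2 k) / (k! Gamma (mu + k + 1))]. *)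
Definition bessel_coef (mu : C) (n : nat) : C :=
  if Nat.even n then (rGamma (mu + INR (Nat.div2 n) + 1) / INR (fact (Nat.div2 n)))%C else RtoC 0.

(** The modified Bessel equation on coefficients: x^mu times the series is I_mu (2 x). *)
Lemma bessel_coef_rec (mu : C) (n : nat) :
  ((INR (S (S n))) * (INR (S (S n)) + 2 * mu) * bessel_coef mu (S (S n)) = 4 * bessel_coef mu n)%C.
Proof.
  unfold bessel_coef. change (Nat.even (S (S n))) with (Nat.even n). change (Nat.div2 (S (S n))) with (S (Nat.div2 n)).
  destruct (Nat.even n) eqn:E; [|ring].
  assert (Hn : n = (2 * Nat.div2 n)%nat).
  { rewrite (Nat.div2_odd n) at 1. rewrite <- Nat.negb_even, E. simpl. lia. }
  set (k := Nat.div2 n) in *. clearbody k. subst n.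
  rewrite (rGamma_rec (mu + INR k + 1)). rewrite fact_S_C. rewrite !S_INR, mult_INR. simpl (INR 2).
  rewrite !RtoC_plus, RtoC_mult. replace (1 + 1) with 2 by ring.
  replace (mu + (INR k + 1) + 1)%C with (mu + INR k + 1 + 1)%C by ring.
  assert (N : (INR k + 1)%C <> 0) by (rewrite <- RtoC_plus; intros H; apply RtoC_inj in H; generalize (pos_INR k); lra).
  field. split; [apply INR_fact_neq0C|exact N].
Qed.

Definition exp2_coef (l : nat) : C := exp_term 2 l.

Lemma exp2_coef_rec (l : nat) : (INR (S l) * exp2_coef (S l) = 2 * exp2_coef l)%C.
Proof.
  unfold exp2_coef, exp_term. rewrite fact_S_C. simpl Cpow. field.
  split; [apply INR_fact_neq0C|apply RtoC_INR_S_neq0].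
Qed.

Lemma Cconv_weight_right (a : nat -> C) (j : nat) :
  (Cconv a (fun l => INR l * exp2_coef l) (S j) = 2 * Cconv a exp2_coef j)%C.
Proof.
  unfold Cconv. rewrite Csum_S, Nat.sub_diag. simpl (INR 0). rewrite <- Csum_scal.
  rewrite (Csum_ext_le _ (fun k => 2 * (a k * exp2_coef (j - k)))%C).
  - ring.
  - intros k Hk. replace (S j - k)%nat with (S (j - k)) by lia. rewrite exp2_coef_rec. ring.
Qed.

Lemma Cconv_weight (a b : nat -> C) (j : nat) :
  (INR j * Cconv a b j = Cconv (fun n => INR n * a n) b j + Cconv a (fun l => INR l * b l) j)%C.
Proof.
  unfold Cconv. rewrite <- Csum_scal, <- Csum_plus. apply Csum_ext_le. intros k Hk.
  rewrite minus_INR by exact Hk. rewrite RtoC_minus. ring.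
Qed.

(* Kummer's differential equation for [e^(2 x) sum_n (bessel_coef mu n) x^n], coefficientwise. *)
Lemma Cconv_rec (mu : C) (j : nat) :
  (INR (S (S j)) * (INR (S (S j)) + 2 * mu) * Cconv (bessel_coef mu) exp2_coef (S (S j)) =
   2 * (2 * INR (S (S j)) - 1 + 2 * mu) * Cconv (bessel_coef mu) exp2_coef (S j))%C.
Proof.
  set (a := bessel_coef mu). set (b := exp2_coef).
  set (U := Cconv (fun n => INR n * a n)%C b). set (W := Cconv (fun n => INR n * (INR n * a n))%C b). set (c := Cconv a b).
  (* Let f be the series with coefficients a and theta = x d/dx. Then U and W belong to (theta f)
     e^(2 x) and (theta^2 f) e^(2 x); [H1] and [H2] are the product rule for theta, and [H3] is the
     equation theta (theta + 2 mu) f = 4 x^2 f. *)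
  assert (H1 : forall j, (INR (S j) * c (S j) = U (S j) + 2 * c j)%C).
  { intros i. unfold c. rewrite Cconv_weight. unfold b. rewrite Cconv_weight_right. reflexivity. }
  assert (H2 : forall j, (INR (S j) * U (S j) = W (S j) + 2 * U j)%C).
  { intros i. unfold U. rewrite Cconv_weight. unfold b. rewrite Cconv_weight_right. reflexivity. }
  assert (H3 : (W (S (S j)) + 2 * mu * U (S (S j)) = 4 * c j)%C).
  { unfold W, U, c, Cconv. rewrite <- Csum_scal, <- Csum_plus.
    rewrite (Csum_ext_le _ (fun n => INR n * (INR n + 2 * mu) * a n * b (S (S j) - n)%nat)%C) by (intros; ring).
    rewrite !Csum_shift, <- Csum_scal.
    rewrite (Csum_ext_le _ (fun n => 4 * (a n * b (j - n)%nat))%C).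
    - replace (a 1%nat) with (RtoC 0) by reflexivity. simpl (INR 0). ring.
    - intros k Hk. assert (R := bessel_coef_rec mu k). fold a in R. rewrite R. simpl Nat.sub. ring. }
  assert (E1 := H1 (S j)). assert (E2 := H2 (S j)). assert (E3 := H1 j).
  transitivity ((INR (S (S j)) + 2 * mu) * (INR (S (S j)) * c (S (S j))))%C; [ring|]. rewrite E1.
  transitivity ((INR (S (S j)) * U (S (S j))) + 2 * mu * U (S (S j)) + 2 * (INR (S (S j)) + 2 * mu) * c (S j))%C; [ring|].
  rewrite E2.
  transitivity ((W (S (S j)) + 2 * mu * U (S (S j))) + 2 * (INR (S j) * c (S j) - 2 * c j) + 2 * (INR (S (S j)) + 2 * mu) * c (S j))%C; [rewrite E3; ring|].
  rewrite H3. rewrite (S_INR (S j)), RtoC_plus. ring.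
Qed.

(** The recursion of [Cconv_rec] again. It holds because (2 mu + j + 1)_(j+2) can be split off at
    its first factor or at its last two. *)
Lemma kummer_coef_rec (mu : C) (j : nat) :
  (INR (S j) * (INR (S j) + 2 * mu) * kummer_coef (S j) mu = 2 * (2 * INR (S j) - 1 + 2 * mu) * kummer_coef j mu)%C.
Proof.
  unfold kummer_coef.
  assert (H : ((2 * mu + INR j + 1) * rising (2 * mu + INR (S j) + 1) (S j) = rising (2 * mu + INR j + 1) j * (2 * mu + 2 * INR j + 1) * (2 * mu + 2 * INR j + 2))%C).
  { transitivity (rising (2 * mu + INR j + 1) (S (S j))).
    - rewrite (rising_shift (2 * mu + INR j + 1)). rewrite S_INR, RtoC_plus.
      replace (2 * mu + (INR j + 1) + 1)%C with (2 * mu + INR j + 1 + 1)%C by ring. reflexivity.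
    - change (rising (2 * mu + INR j + 1) (S (S j))) with (rising (2 * mu + INR j + 1) j * (2 * mu + INR j + 1 + INR j) * (2 * mu + INR j + 1 + INR (S j)))%C.
      rewrite S_INR, RtoC_plus. ring. }
  rewrite (rGamma_rec (mu + INR j + 1)). rewrite fact_S_C.
  assert (N := RtoC_INR_S_neq0 j). assert (Nf := INR_fact_neq0C j).
  replace (mu + INR (S j) + 1)%C with (mu + INR j + 1 + 1)%C by (rewrite S_INR, RtoC_plus; ring).
  transitivity (rGamma (mu + INR j + 1 + 1) / INR (fact j) * ((2 * mu + INR j + 1) * rising (2 * mu + INR (S j) + 1) (S j)))%C.
  - replace (2 * mu + INR j + 1)%C with (INR (S j) + 2 * mu)%C by (rewrite S_INR, RtoC_plus; ring).
    field. split; assumption.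
  - rewrite H. rewrite S_INR, RtoC_plus. field. assumption.
Qed.

(** Two sequences with the same recursion and the same entries 0 and 1 agree as long as the leading
    factor i (i + 2 mu) does not vanish. Entry 1 is compared directly because [Cconv_rec] determines
    entries from index 2 on. *)
Lemma Cconv_bessel_generic (mu : C) : (forall i : nat, (2 <= i)%nat -> (INR i + 2 * mu)%C <> 0) ->
  forall j, Cconv (bessel_coef mu) exp2_coef j = kummer_coef j mu.
Proof.
  intros Hmu.
  assert (H : forall j, Cconv (bessel_coef mu) exp2_coef j = kummer_coef j mu /\ Cconv (bessel_coef mu) exp2_coef (S j) = kummer_coef (S j) mu).
  { induction j as [|j [IH1 IH2]].
    - split.
      + unfold Cconv. rewrite Csum_0. unfold kummer_coef, bessel_coef, exp2_coef, exp_term; simpl. field.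
      + unfold Cconv. rewrite Csum_S, Csum_0. unfold kummer_coef, bessel_coef, exp2_coef, exp_term; simpl.
        rewrite (rGamma_rec (mu + 0 + 1)). replace (mu + 0 + 1 + 1)%C with (mu + 1 + 1)%C by ring. field.
    - split; [exact IH2|].
      assert (R1 := Cconv_rec mu j). assert (R2 := kummer_coef_rec mu (S j)). rewrite IH2, <- R2 in R1.
      assert (N := RtoC_INR_S_neq0 (S j)). assert (N' := Hmu (S (S j)) ltac:(lia)).
      set (k := (INR (S (S j)) * (INR (S (S j)) + 2 * mu))%C) in *.
      assert (Nk : k <> 0) by (apply Cmult_neq_0; assumption).
      transitivity (k * Cconv (bessel_coef mu) exp2_coef (S (S j)) / k)%C; [field; exact Nk|]. rewrite R1. field; exact Nk. }
  intros j. apply H.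
Qed.

Lemma ex_Cderiv_kummer_coef (j : nat) (mu : C) : ex_Cderiv (kummer_coef j) mu.
Proof.
  unfold kummer_coef. apply ex_Cderiv_mult; [apply ex_Cderiv_mult|apply ex_Cderiv_const].
  - apply ex_Cderiv_ext with (fun s => rGamma (s + (INR j + 1))%C); [|apply ex_Cderiv_rGamma_shift].
    intros s. f_equal. ring.
  - apply ex_Cderiv_ext with (fun s => rising (2 * s + (INR j + 1))%C j).
    + intros s. f_equal. ring.
    + apply (ex_Cderiv_affine (fun s => rising s j)); [intros E; apply RtoC_inj in E; lra|apply ex_Cderiv_rising].
Qed.

(** The exceptional mu, those with 2 mu a nonpositive integer, are isolated, and both sides are
    differentiable in mu. *)
Lemma Cconv_bessel (mu : C) (j : nat) : Cconv (bessel_coef mu) exp2_coef j = kummer_coef j mu.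
Proof.
  destruct (classic (exists i : nat, INR i + 2 * mu = 0)%C) as [Hex|Hnex].
  2:{ apply Cconv_bessel_generic. intros i _ E. apply Hnex. exists i. exact E. }
  apply (eq_by_continuity (fun mu => Cconv (bessel_coef mu) exp2_coef j) (kummer_coef j) mu).
  - unfold Cconv. apply (ex_Cderiv_sum (fun n nu => bessel_coef nu n * exp2_coef (j - n)%nat)%C).
    intros k. apply ex_Cderiv_mult; [|apply ex_Cderiv_const]. unfold bessel_coef.
    destruct (Nat.even k); [|apply ex_Cderiv_const].
    apply ex_Cderiv_mult; [|apply ex_Cderiv_const].
    apply ex_Cderiv_ext with (fun s => rGamma (s + (INR (Nat.div2 k) + 1))%C); [|apply ex_Cderiv_rGamma_shift].
    intros s. f_equal. ring.
  - apply ex_Cderiv_kummer_coef.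
  - (* two distinct zeros of the factors [i + 2 nu] are at distance at least 1/2 *)
    assert (Hsep : forall nu, Cmod (nu - mu)%C < / 2 -> nu <> mu -> (exists i : nat, INR i + 2 * mu = 0)%C ->
       forall i : nat, (INR i + 2 * nu)%C <> 0).
    { intros nu Hnu Hne [i0 E0] i E.
      assert (D : (nu - mu = RtoC ((INR i0 - INR i) / 2))%C).
      { rewrite RtoC_div, RtoC_minus by lra.
        replace nu with ((INR i + 2 * nu - INR i) / 2)%C by field. replace mu with ((INR i0 + 2 * mu - INR i0) / 2)%C by field.
        rewrite E, E0. field. }
      rewrite D, Cmod_R in Hnu. apply Rabs_def2 in Hnu.
      assert (i = i0).
      { rewrite !INR_IZR_INZ in Hnu. rewrite <- minus_IZR in Hnu.
        assert (A1 : (Z.of_nat i0 - Z.of_nat i < 1)%Z) by (apply lt_IZR; lra).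
        assert (A2 : (-1 < Z.of_nat i0 - Z.of_nat i)%Z) by (apply lt_IZR; lra). lia. }
      subst i0. apply Hne. replace nu with (nu - mu + mu)%C by ring. rewrite D.
      replace ((INR i - INR i) / 2) with 0 by field. ring. }
    apply Cpunct_intro with (/ 2); [lra|]. intros nu Hnu Hne. apply Cconv_bessel_generic.
    intros i _. apply Hsep; assumption.
Qed.

Lemma fact_double_le (k : nat) : INR (fact (2 * k)) <= 4 ^ k * INR (fact k) ^ 2.
Proof.
  induction k as [|k IH]; [simpl; lra|].
  replace (2 * S k)%nat with (S (S (2 * k))) by lia. rewrite !fact_simpl, !mult_INR, !S_INR, mult_INR. simpl (INR 2).
  assert (H := pos_INR k). assert (Hf := INR_fact_lt_0 k). assert (Hf2 := INR_fact_lt_0 (2 * k)).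
  apply Rle_trans with (((1 + 1) * INR k + 1 + 1) * (((1 + 1) * INR k + 1) * (4 ^ k * INR (fact k) ^ 2))).
  - apply Rmult_le_compat_l; [lra|]. apply Rmult_le_compat_l; [lra|exact IH].
  - simpl (4 ^ S k).
    replace (4 * 4 ^ k * ((INR k + 1) * INR (fact k)) ^ 2) with ((4 * (INR k + 1) ^ 2) * (4 ^ k * INR (fact k) ^ 2)) by ring.
    rewrite <- Rmult_assoc. apply Rmult_le_compat_r; [|nra].
    apply Rmult_le_pos; [apply pow_le; lra|apply pow_le; lra].
Qed.

(** At n = 2 k the decay 2^k / k! of 1/Gamma and (2 k)! <= 4^k (k!)^2 leave 8^k, which is at most
    3^(2 k). *)
Lemma bessel_coef_le (mu : C) : exists K, 0 < K /\
  forall n, Cmod (bessel_coef mu n) <= K * (3 ^ n / INR (fact n)).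
Proof.
  destruct (rGamma_decay mu) as [K [HK HB]]. exists K. split; [exact HK|]. intros n.
  assert (Hpos : 0 <= 3 ^ n / INR (fact n)) by (left; apply Rdiv_lt_0_compat; [apply pow_lt; lra|apply INR_fact_lt_0]).
  unfold bessel_coef. destruct (Nat.even n) eqn:E; [|rewrite Cmod_0; nra].
  assert (Hn : n = (2 * Nat.div2 n)%nat).
  { rewrite (Nat.div2_odd n) at 1. rewrite <- Nat.negb_even, E. simpl. lia. }
  set (k := Nat.div2 n) in *. clearbody k. subst n.
  rewrite Cmod_div, Cmod_R, Rabs_pos_eq by (try apply INR_fact_neq0C; apply pos_INR).
  assert (Hf := INR_fact_lt_0 k). assert (Hf2 := INR_fact_lt_0 (2 * k)).
  apply Rle_div_l; [exact Hf|]. eapply Rle_trans; [apply HB|].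
  rewrite Rmult_assoc. apply Rmult_le_compat_l; [lra|].
  assert (F := fact_double_le k). rewrite pow_mult.
  assert (P8 : 2 ^ k * 4 ^ k <= (3 ^ 2) ^ k).
  { rewrite <- Rpow_mult_distr. apply pow_incr. lra. }
  assert (P2 : 0 < 2 ^ k) by (apply pow_lt; lra).
  apply Rle_div_l; [exact Hf|].
  replace ((3 ^ 2) ^ k / INR (fact (2 * k)) * INR (fact k) * INR (fact k)) with ((3 ^ 2) ^ k * INR (fact k) ^ 2 / INR (fact (2 * k))) by (field; lra).
  apply Rle_div_r; [exact Hf2|].
  apply Rle_trans with (2 ^ k * (4 ^ k * INR (fact k) ^ 2)); [apply Rmult_le_compat_l; lra|].
  rewrite <- Rmult_assoc. apply Rmult_le_compat_r; [apply pow_le; lra|exact P8].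
Qed.

Lemma Cser_even (a : nat -> C) (l : C) : (forall k, a (2 * k + 1)%nat = 0) ->
  Cser a l -> Cser (fun k => a (2 * k)%nat) l.
Proof.
  intros Hodd H.
  assert (E : forall N, @eq C (sum_n a (2 * N)) (sum_n (fun k => a (2 * k)%nat) N)).
  { induction N as [|N IH]; [change (2 * 0)%nat with 0%nat; rewrite !Csum_0; reflexivity|].
    rewrite (Csum_S (fun k => a (2 * k)%nat)), <- IH.
    replace (2 * S N)%nat with (S (S (2 * N))) by lia. rewrite !Csum_S.
    replace (S (2 * N)) with (2 * N + 1)%nat by lia. rewrite Hodd. ring. }
  apply Clim_ext with (fun N => sum_n a (2 * N) : C).
  - exists 0%nat. intros N _. apply E.
  - apply (Clim_comp eventually eventually (fun N => 2 * N)%nat (fun n => sum_n a n)); [|exact H].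
    intros P [N HN]. exists N. intros n Hn. apply HN. lia.
Qed.

Lemma bessel_series (mu x : C) : exists l, Cser (fun n => bessel_coef mu n * x ^ n)%C l /\
  Cser (fun k => x ^ (2 * k) / INR (fact k) * rGamma (mu + INR k + 1))%C l.
Proof.
  destruct (bessel_coef_le mu) as [K [HK HB]].
  destruct (Cser_dominated (fun n => bessel_coef mu n * x ^ n)%C (fun n => K * ((3 * Cmod x) ^ n / INR (fact n)))) as [l Hl].
  - intros n. rewrite Cmod_mult, Cmod_pow, Rpow_mult_distr.
    replace (K * (3 ^ n * Cmod x ^ n / INR (fact n))) with (K * (3 ^ n / INR (fact n)) * Cmod x ^ n) by (field; apply INR_fact_neq_0).
    apply Rmult_le_compat_r; [apply pow_le, Cmod_ge_0|apply HB].
  - apply (ex_series_scal (V := R_NormedModule) K), ex_series_exp.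
  - exists l. split; [exact Hl|].
    apply Cser_even in Hl.
    + revert Hl. apply Cser_ext. intros k. unfold bessel_coef.
      replace (Nat.even (2 * k)) with true by (symmetry; apply Nat.even_spec; exists k; reflexivity).
      rewrite Nat.div2_double. unfold Cdiv. ring.
    + intros k. unfold bessel_coef.
      replace (Nat.even (2 * k + 1)) with false; [ring|].
      rewrite Nat.add_1_r, Nat.even_succ. symmetry. rewrite <- Nat.negb_even.
      replace (Nat.even (2 * k)) with true by (symmetry; apply Nat.even_spec; exists k; reflexivity). reflexivity.
Qed.

Lemma BesselJ_series (mu z : C) : exists l,
  Cser (fun k => (RtoC ((-1) ^ k) * (z / 2) ^ (2 * k) / INR (fact k) * rGamma (mu + INR k + 1)))%C l /\
  Cser (fun n => bessel_coef mu n * (- (Ci * z / 2)) ^ n)%C l /\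
  BesselJ mu z = (cpow (z / 2) mu * l)%C.
Proof.
  destruct (bessel_series mu (- (Ci * z / 2))%C) as [l [H1 H2]].
  assert (H3 : Cser (fun k => (RtoC ((-1) ^ k) * (z / 2) ^ (2 * k) / INR (fact k) * rGamma (mu + INR k + 1)))%C l).
  { revert H2. apply Cser_ext. intros k. f_equal. f_equal.
    rewrite !Cpow_mult_r, RtoC_pow, <- Cpow_mult_l. f_equal.
    simpl. replace (- (Ci * z / 2) * (- (Ci * z / 2) * 1))%C with ((Ci * Ci) * (z / 2) * (z / 2))%C by field.
    rewrite Ci2. ring. }
  exists l. split; [exact H3|]. split; [exact H1|].
  unfold BesselJ. rewrite (Cser_Cseries _ _ H3). reflexivity.
Qed.

Definition kummer_term (mu z : C) (j : nat) : C :=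
  (Cexp (Ci * z) * cpow (z / 2) mu * ((- (Ci * z / 2)) ^ j * kummer_coef j mu))%C.

(* Kummer's transformation of the series of [J_mu], as a Cauchy product with [exp (- i z)]. *)
Lemma BesselJ_kummer (mu z : C) : Cser (kummer_term mu z) (BesselJ mu z).
Proof.
  destruct (BesselJ_series mu z) as [l [_ [H1 ->]]].
  set (x := (- (Ci * z / 2))%C) in *.
  destruct (bessel_coef_le mu) as [K [HK HB]].
  assert (HC := Cser_conv (fun n => bessel_coef mu n * x ^ n)%C (exp_term (2 * x)) l (Cexp (2 * x))
    (fun n => K * ((3 * Cmod x) ^ n / INR (fact n))) (fun n => Cmod (2 * x)%C ^ n / INR (fact n))).
  assert (HC' : Cser (Cconv (fun n => bessel_coef mu n * x ^ n)%C (exp_term (2 * x))) (l * Cexp (2 * x))%C).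
  { apply HC; [| | | |exact H1|apply Cser_exp].
    - intros n. rewrite Cmod_mult, Cmod_pow, Rpow_mult_distr.
      replace (K * (3 ^ n * Cmod x ^ n / INR (fact n))) with (K * (3 ^ n / INR (fact n)) * Cmod x ^ n) by (field; apply INR_fact_neq_0).
      apply Rmult_le_compat_r; [apply pow_le, Cmod_ge_0|apply HB].
    - intros n. unfold exp_term. rewrite Cmod_div, Cmod_pow, Cmod_R, Rabs_pos_eq by (try apply INR_fact_neq0C; apply pos_INR). lra.
    - apply (ex_series_scal (V := R_NormedModule) K), ex_series_exp.
    - apply ex_series_exp. }
  apply (Cser_scal (Cexp (Ci * z) * cpow (z / 2) mu)%C) in HC'.
  replace (Cexp (Ci * z) * cpow (z / 2) mu * (l * Cexp (2 * x)))%C with (cpow (z / 2) mu * l)%C in HC'.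
  - revert HC'. apply Cser_ext. intros j. unfold kummer_term. fold x. f_equal.
    rewrite <- Cconv_bessel. unfold Cconv. rewrite <- Csum_scal. apply Csum_ext_le. intros k Hk.
    unfold exp2_coef, exp_term. rewrite Cpow_mult_l.
    replace (x ^ j)%C with (x ^ k * x ^ (j - k))%C by (rewrite <- Cpow_add_r; f_equal; lia).
    unfold Cdiv. ring.
  - assert (E : (Cexp (Ci * z) * Cexp (2 * x) = 1)%C).
    { rewrite <- Cexp_plus. replace (Ci * z + 2 * x)%C with (RtoC 0) by (unfold x; field). apply Cexp_0. }
    transitivity (cpow (z / 2) mu * l * (Cexp (Ci * z) * Cexp (2 * x)))%C; [rewrite E; ring|ring].
Qed.

(** * Termwise integration *)

Lemma continuous_Csum (f : nat -> R -> C) (t : R) (n : nat) :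
  (forall k, continuous (U := C_R_NormedModule) (f k) t) ->
  Clim (locally t) (fun x => sum_n (fun k => f k x) n : C) (sum_n (fun k => f k t) n).
Proof.
  intros H. assert (H' : forall k, Clim (locally t) (f k) (f k t)) by (intros k; apply Clim_iff; [apply H]).
  assert (E : forall x, @eq C (sum_n (fun k => f k x) 0) (f 0%nat x)) by (intros x; exact (Csum_0 (fun k => f k x))).
  induction n as [|n IH].
  - rewrite E. apply Clim_ext with (f 0%nat); [|apply H'].
    apply filter_forall. intros x. symmetry. apply E.
  - rewrite Csum_S. apply Clim_ext with (fun x => sum_n (fun k => f k x) n + f (S n) x)%C.
    + apply filter_forall. intros x. symmetry. exact (Csum_S (fun k => f k x) n).
    + apply Clim_plus; [exact IH|apply H'].
Qed.

Lemma is_improper_sum (f : nat -> R -> C) (I : nat -> C) (n : nat) : (forall k, is_improper (f k) (I k)) ->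
  is_improper (fun t => sum_n (fun k => f k t) n : C) (sum_n I n).
Proof.
  intros H. induction n as [|n IH].
  - rewrite Csum_0. apply is_improper_ext with (f 0%nat); [|apply H]. intros t _. symmetry. exact (Csum_0 (fun k => f k t)).
  - rewrite Csum_S. apply is_improper_ext with (fun t => sum_n (fun k => f k t) n + f (S n) t)%C.
    + intros t _. symmetry. exact (Csum_S (fun k => f k t) n).
    + apply is_improper_plus; [exact IH|apply H].
Qed.

Lemma series_tail_small (m : nat -> R) (M : R) (e : R) : is_series m M -> 0 < e ->
  exists N0, forall N, (N0 <= N)%nat -> M - sum_n m N < e.
Proof.
  intros H He. specialize (H (fun y => Rabs (y - M) < e)). destruct H as [N0 HN].
  - exists (mkposreal e He). intros y Hy. exact Hy.
  - exists N0. intros N HNN. specialize (HN N HNN). cbv beta in HN. apply Rabs_def2 in HN.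
    assert (X : forall q : R, (q - M < e /\ - e < q - M) -> M - q < e) by (intros; lra). exact (X _ HN).
Qed.

(** Weierstrass' test. The interval is symmetric about 0 so that 0 is an interior point, where
    continuity is two-sided. *)
Lemma is_improper_series_dominated (f : nat -> R -> C) (g : R -> C) (I : nat -> C) (m : nat -> R) :
  (forall k t, - PI < t < PI -> continuous (U := C_R_NormedModule) (f k) t) ->
  (forall k t, - PI < t < PI -> Cmod (f k t) <= m k) -> ex_series m ->
  (forall t, - PI < t < PI -> Cser (fun k => f k t) (g t)) ->
  (forall k, is_improper (f k) (I k)) ->
  exists l, is_improper g l /\ Cser I l.
Proof.
  intros Hc Hm [M HM] Hg HI. assert (Hpi := PI_RGT_0).
  assert (Hm0 : forall k, 0 <= m k) by (intros k; eapply Rle_trans; [apply Cmod_ge_0|apply (Hm k 0); lra]).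
  assert (Htail : forall N t, - PI < t < PI -> Cmod (g t - sum_n (fun k => f k t) N)%C <= M - sum_n m N).
  { intros N t Ht. apply Cser_tail_le; [intros k; apply Hm, Ht|exact HM|apply Hg, Ht]. }
  (* M - m 0 bounds the tail after the first term, and m 0 bounds the first term itself. *)
  destruct (is_improper_bounded g (M - m 0%nat + m 0%nat)) as [l Hl].
  - intros t Ht. apply Clim_iff. intros e He.
    destruct (series_tail_small m M (e / 3) HM ltac:(lra)) as [N HN]. specialize (HN N (le_n N)).
    assert (HS := continuous_Csum f t N (fun k => Hc k t ltac:(lra)) (e / 3) ltac:(lra)).
    assert (Hloc : locally t (fun x => - PI < x < PI)).
    { apply (locally_open (fun x => - PI < x < PI)); [|auto|lra].
      apply open_and; [apply open_gt|apply open_lt]. }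
    generalize (filter_and (F := locally t) _ _ HS Hloc). apply filter_imp. intros x [H1 H2].
    assert (T1 := Htail N t ltac:(lra)). assert (T2 := Htail N x H2).
    replace (g x - g t)%C with ((g x - sum_n (fun k => f k x) N) + (sum_n (fun k => f k x) N - sum_n (fun k => f k t) N) + - (g t - sum_n (fun k => f k t) N))%C by ring.
    eapply Rle_lt_trans; [apply Cmod_triangle|]. rewrite Cmod_opp.
    eapply Rle_lt_trans; [apply Rplus_le_compat_r, Cmod_triangle|]. lra.
  - intros t Ht. assert (T := Htail 0%nat t ltac:(lra)). rewrite (sum_O m) in T.
    replace (g t) with ((g t - sum_n (fun k => f k t) 0) + f 0%nat t)%C.
    + eapply Rle_trans; [apply Cmod_triangle|]. specialize (Hm 0%nat t ltac:(lra)). lra.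
    + assert (E : @eq C (sum_n (fun k => f k t) 0) (f 0%nat t)) by exact (Csum_0 (fun k => f k t)). rewrite E. ring.
  - exists l. split; [exact Hl|]. intros e He.
    destruct (series_tail_small m M (e / PI) HM ltac:(apply Rdiv_lt_0_compat; lra)) as [N0 HN0].
    exists N0. intros N HN. specialize (HN0 N HN).
    assert (HD := is_improper_minus _ _ _ _ Hl (is_improper_sum f I N HI)).
    assert (HK := is_improper_const (RtoC (M - sum_n m N))). rewrite <- RtoC_mult in HK.
    rewrite <- Cmod_opp. replace (- (sum_n I N - l))%C with (l - sum_n I N)%C by ring.
    eapply Rle_lt_trans; [refine (is_improper_le _ (fun _ => M - sum_n m N) _ _ _ HD HK)|].
    + intros t Ht. apply Htail. lra.
    + apply Rmult_lt_compat_l with (r := PI) in HN0; [|lra]. replace (PI * (e / PI)) with e in HN0 by (field; lra). exact HN0.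
Qed.

Lemma Cser_shift (a : nat -> C) (l : C) : Cser (fun k => a (S k)) l <-> Cser a (a 0%nat + l)%C.
Proof.
  split; intros H.
  - assert (H' : Clim eventually (fun n => sum_n a (S n) : C) (a 0%nat + l)%C).
    { apply Clim_ext with (fun n => a 0%nat + sum_n (fun k => a (S k)) n)%C.
      - exists 0%nat. intros n _. symmetry. apply Csum_shift.
      - apply Clim_plus; [apply Clim_const|exact H]. }
    intros e He. destruct (H' e He) as [N HN]. exists (S N). intros [|n] Hn; [lia|]. apply HN. lia.
  - assert (H' : Clim eventually (fun n => sum_n a (S n) : C) (a 0%nat + l)%C).
    { apply (Clim_comp eventually eventually S (fun n => sum_n a n : C)); [|exact H].
      intros P [N HN]. exists N. intros n Hn. apply HN. lia. }
    apply Clim_ext with (fun n => sum_n a (S n) - a 0%nat)%C.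
    + exists 0%nat. intros n _. rewrite Csum_shift. ring.
    + replace l with (a 0%nat + l - a 0%nat)%C by ring.
      apply Clim_minus; [exact H'|apply Clim_const].
Qed.

Fixpoint Csum_lt (a : nat -> C) (n : nat) : C :=
  match n with O => RtoC 0 | S n' => (Csum_lt a n' + a n')%C end.

Lemma Cser_drop (a : nat -> C) (n : nat) (l : C) : Cser (fun k => a (n + k)%nat) l <-> Cser a (Csum_lt a n + l)%C.
Proof.
  revert l; induction n as [|n IH]; intros l.
  - simpl. replace (0 + l)%C with l by ring. reflexivity.
  - simpl Csum_lt. replace (Csum_lt a n + a n + l)%C with (Csum_lt a n + (a n + l))%C by ring.
    rewrite <- IH. assert (E := Cser_shift (fun k => a (n + k)%nat) l). cbv beta in E. rewrite Nat.add_0_r in E. rewrite <- E.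
    split; apply Cser_ext; intros k; f_equal; lia.
Qed.

(** The first term is kept out of the domination: with an exponent {mu} of negative real part it can
    be unbounded near PI, although its integral converges. *)
Lemma is_improper_series (f : nat -> R -> C) (g : R -> C) (I : nat -> C) (m : nat -> R) :
  (forall k t, - PI < t < PI -> continuous (U := C_R_NormedModule) (f k) t) ->
  (forall k t, - PI < t < PI -> Cmod (f (S k) t) <= m k) -> ex_series m ->
  (forall t, - PI < t < PI -> Cser (fun k => f k t) (g t)) ->
  (forall k, is_improper (f k) (I k)) ->
  exists l, is_improper g l /\ Cser I l.
Proof.
  intros Hc Hm Hs Hg HI.
  destruct (is_improper_series_dominated (fun k => f (S k)) (fun t => g t - f 0%nat t)%C (fun k => I (S k)) m) as [l [H1 H2]]; auto.
  - intros t Ht. apply (Cser_shift (fun k => f k t)). replace (f 0%nat t + (g t - f 0%nat t))%C with (g t) by ring. apply Hg, Ht.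
  - exists (I 0%nat + l)%C. split; [|exact (proj1 (Cser_shift I l) H2)].
    apply is_improper_ext with (fun t => f 0%nat t + (g t - f 0%nat t))%C; [intros; ring|]. apply is_improper_plus; auto.
Qed.

Lemma Ccos_opp (w : C) : Ccos (- w) = Ccos w.
Proof. unfold Ccos. replace (Ci * - w)%C with (- (Ci * w))%C by ring. replace (- - (Ci * w))%C with (Ci * w)%C by ring. f_equal. ring. Qed.

(** Evenness in t carries continuity and bounds from [0, PI) to the symmetric interval. *)
Lemma cos_pow_abs (s nu : C) (t : R) : cos_pow s nu t = cos_pow s nu (Rabs t).
Proof.
  unfold Rabs. destruct (Rcase_abs t); [|reflexivity].
  unfold cos_pow. rewrite cos_neg. f_equal. rewrite <- Ccos_opp. f_equal. rewrite RtoC_opp. ring.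
Qed.

Lemma continuous_cos_pow_sym (s nu : C) (t : R) : - PI < t < PI -> continuous (U := C_R_NormedModule) (cos_pow s nu) t.
Proof.
  intros Ht. apply (continuous_ext (fun x => cos_pow s nu (Rabs x))).
  - intros x. symmetry. apply cos_pow_abs.
  - apply (continuous_comp (V := R_UniformSpace) (W := C_R_NormedModule) Rabs (cos_pow s nu)).
    + apply continuous_Rabs.
    + apply continuous_cos_pow. split; [apply Rabs_pos|apply Rabs_def1; lra].
Qed.

(** * The principal logarithm and the series of B *)

Lemma Cexp_Clog (z : C) : z <> 0 -> Cexp (Clog z) = z.
Proof.
  intros Hz. assert (Hm := proj1 (Cmod_gt_0 z) Hz).
  set (c := Re z / Cmod z).
  assert (Hc : -1 <= c <= 1).
  { apply Rabs_le_between. unfold c, Rdiv. rewrite Rabs_mult, (Rabs_pos_eq (/ Cmod z)) by (left; apply Rinv_0_lt_compat, Hm).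
    apply Rle_div_l; [exact Hm|]. rewrite Rmult_1_l. apply re_le_Cmod. }
  assert (Hs : sqrt (1 - c ^ 2) = Rabs (Im z) / Cmod z).
  { assert (E : 1 - c ^ 2 = (Rabs (Im z) / Cmod z) ^ 2).
    { unfold c. assert (A := Cmod2_alt z).
      replace ((Rabs (Im z) / Cmod z) ^ 2) with (Rabs (Im z) ^ 2 / Cmod z ^ 2) by (field; lra).
      rewrite pow2_abs. replace (Im z ^ 2) with (Cmod z ^ 2 - Re z ^ 2) by lra. field. lra. }
    rewrite E. apply sqrt_pow2. apply Rmult_le_pos; [apply Rabs_pos|left; apply Rinv_0_lt_compat, Hm]. }
  unfold Clog. rewrite Cexp_plus, Cexp_RtoC, exp_ln by exact Hm.
  assert (HA : cos (Carg z) = c /\ sin (Carg z) = Im z / Cmod z).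
  { unfold Carg. fold c. destruct (Rle_dec 0 (Im z)) as [H|H].
    - rewrite cos_acos, sin_acos by exact Hc. rewrite Rsqr_pow2, Hs, Rabs_pos_eq by exact H. auto.
    - rewrite cos_neg, sin_neg, cos_acos, sin_acos by exact Hc. rewrite Rsqr_pow2, Hs, Rabs_left by lra.
      split; [reflexivity|]. field. lra. }
  destruct HA as [HA1 HA2].
  assert (R0 : Re (Ci * Carg z)%C = 0) by (rewrite re_scal_r; simpl; ring).
  assert (I0 : Im (Ci * Carg z)%C = Carg z) by (rewrite im_scal_r; simpl; ring).
  apply C_eq; rewrite ?re_scal_l, ?im_scal_l, ?Re_Cexp, ?Im_Cexp, R0, I0, exp_0, ?HA1, ?HA2; unfold c; field; lra.
Qed.

(** Halving changes the modulus but neither Re z / Cmod z nor the sign of Im z, so the argument is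
    the same and no branch is crossed. *)
Lemma Clog_half (z : C) : z <> 0 -> Clog (z / 2) = (Clog z - ln 2)%C.
Proof.
  intros Hz. assert (Hm := proj1 (Cmod_gt_0 z) Hz).
  assert (E : (z / 2 = RtoC (/ 2) * z)%C) by (rewrite RtoC_inv by lra; field).
  assert (Em : Cmod (z / 2) = Cmod z / 2) by (rewrite E, Cmod_mult, Cmod_R, Rabs_pos_eq by lra; field).
  assert (Ea : Carg (z / 2) = Carg z).
  { unfold Carg. rewrite Em, E, re_scal_l, im_scal_l.
    replace (/ 2 * Re z / (Cmod z / 2)) with (Re z / Cmod z) by (field; lra).
    destruct (Rle_dec 0 (/ 2 * Im z)), (Rle_dec 0 (Im z)); try reflexivity; exfalso; lra. }
  unfold Clog. rewrite Ea, Em, ln_div, RtoC_minus by lra. ring.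
Qed.

Lemma Cexp_mi : Cexp (- (Ci * PI / 2)) = (- Ci)%C.
Proof.
  replace (- (Ci * PI / 2))%C with ((- (PI / 2))%R * Ci)%C by (rewrite RtoC_opp, RtoC_div by lra; field).
  apply C_eq.
  - rewrite Re_Cexp, re_scal_l, im_scal_l. simpl. rewrite Rmult_1_r, cos_neg, cos_PI2. ring.
  - rewrite Im_Cexp, re_scal_l, im_scal_l. simpl. rewrite Rmult_1_r, Rmult_0_r, exp_0, sin_neg, sin_PI2. ring.
Qed.

(** With w = - i z (1 + cos t), the factors e^(- i z cos t) and e^(- w) multiply to e^(i z), and (1
    + cos t)^(a + k) is 2^(- a - k) times the power in [cos_pow]. What does not depend on t is
    collected here. *)
Definition B_coef (a z : C) (k : nat) : C :=
  (Cexp (Ci * z) * Cexp (- (Ci * PI * a / 2)) * cpow z a * (- (Ci * z)) ^ k * rGamma (a + INR k + 1)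
   * Cexp (- ((a + INR k) * ln 2)))%C.

Lemma B_integrand_series (mu z : C) (t : R) : - PI < t < PI ->
  Cser (fun k => B_coef (cfrac mu) z k * cos_pow (cfrac mu + INR k) mu t)%C (B_integrand mu z t).
Proof.
  intros Ht. set (a := cfrac mu).
  assert (Hc : 0 < 1 + cos t).
  { replace (cos t) with (cos (Rabs t)).
    - apply one_plus_cos_pos. split; [apply Rabs_pos|apply Rabs_def1; lra].
    - unfold Rabs. destruct (Rcase_abs t); [apply cos_neg|reflexivity]. }
  set (c := 1 + cos t) in *. set (w := (- (Ci * c * z))%C).
  destruct (rGamma_decay a) as [K [HK HB]].
  destruct (Cser_dominated (fun k => w ^ k * rGamma (a + INR k + 1))%C (fun k => K * ((2 * Cmod w) ^ k / INR (fact k)))) as [l Hl].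
  - intros k. rewrite Cmod_mult, Cmod_pow, Rpow_mult_distr.
    replace (K * (2 ^ k * Cmod w ^ k / INR (fact k))) with (Cmod w ^ k * (K * (2 ^ k / INR (fact k)))) by (field; apply INR_fact_neq_0).
    apply Rmult_le_compat_l; [apply pow_le, Cmod_ge_0|apply HB].
  - apply (ex_series_scal (V := R_NormedModule) K), ex_series_exp.
  - set (p := (Cexp (- (Ci * z * cos t)) * (Cexp (- (Ci * PI * a / 2)) * cpow c a * cpow z a * Cexp (- w)) * Ccos (mu * t))%C).
    replace (B_integrand mu z t) with (p * l)%C.
    + generalize (Cser_scal p _ _ Hl). apply Cser_ext. intros k.
      unfold p, B_coef, cos_pow. rewrite cpow_pos by exact Hc.
      replace (2 + 2 * cos t) with (2 * c) by (unfold c; ring).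
      rewrite ln_mult, RtoC_plus by lra.
      replace ((a + INR k) * (ln 2 + ln c))%C with ((a + INR k) * ln 2 + (a * ln c + INR k * ln c))%C by ring.
      rewrite !Cexp_plus, Cexp_nat, Cexp_RtoC, exp_ln by exact Hc.
      assert (Ez : (Cexp (- (Ci * z * cos t)) * Cexp (- w) = Cexp (Ci * z))%C).
      { rewrite <- Cexp_plus. f_equal. unfold w, c. rewrite RtoC_plus. ring. }
      rewrite <- Ez, Cexp_opp.
      replace (w ^ k)%C with ((- (Ci * z)) ^ k * RtoC c ^ k)%C by (rewrite <- Cpow_mult_l; f_equal; unfold w; ring).
      assert (N1 := Cexp_neq0 ((a + INR k) * ln 2)%C). rewrite (Cexp_opp ((a + INR k) * ln 2)).
      field. split; [exact N1|]. apply Cexp_neq0.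
    + unfold B_integrand, Pmic, micpow, gammastar. fold a c w. unfold p.
      rewrite (Cser_Cseries _ _ Hl). ring.
Qed.

Definition cauchy_value (s nu : C) : C := (PI * rGamma (s + 1 + nu) * rGamma (s + 1 - nu) / rGamma (2 * s + 1))%C.

Lemma Re_cfrac (mu : C) : - / 2 < Re (cfrac mu) <= / 2.
Proof.
  unfold cfrac, Cminus. rewrite re_plus, re_opp, re_RtoC. unfold nint.
  generalize (Zceil_bound (Re mu - / 2)); lra.
Qed.

(** From k = 1 on the exponents {mu} + k have positive real part, so the cosine powers are bounded
    and the series is dominated by an exponential one. The term k = 0 is where Cauchy's formula for
    Re s > - 1/2 is used to its full extent. *)
Lemma B_integral_series (mu z : C) : exists l, is_improper (B_integrand mu z) l /\
  Cser (fun k => B_coef (cfrac mu) z k * cauchy_value (cfrac mu + INR k) mu)%C l.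
Proof.
  set (a := cfrac mu). assert (Ha : - / 2 < Re a <= / 2) by apply Re_cfrac.
  assert (Hln2 : 0 < ln 2) by (rewrite <- ln_1; apply ln_increasing; lra).
  assert (Hln4 : ln 4 = ln 2 + ln 2) by (replace 4 with (2 * 2) by ring; apply ln_mult; lra).
  destruct (rGamma_decay a) as [K [HK HB]].
  set (Q := Cmod (Cexp (Ci * z) * Cexp (- (Ci * PI * a / 2)) * cpow z a)%C).
  set (E := exp (Re a * ln 2) * exp (PI * Cmod mu)).
  assert (HQ : 0 <= Q) by apply Cmod_ge_0.
  assert (HE : 0 <= E) by (left; apply Rmult_lt_0_compat; apply exp_pos).
  apply (is_improper_series (fun k t => B_coef a z k * cos_pow (a + INR k) mu t)%C _ _
    (fun k => (Q * K * E) * ((4 * Cmod z) ^ (S k) / INR (fact (S k))))).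
  - intros k t Ht. assert (H1 := continuous_cos_pow_sym (a + INR k) mu t Ht).
    apply Clim_iff in H1. apply Clim_iff.
    apply Clim_mult; [apply Clim_const|exact H1].
  - intros k t Ht. rewrite cos_pow_abs, Cmod_mult.
    assert (HS := pos_INR k). assert (HS1 := S_INR k).
    assert (B1 : Cmod (cos_pow (a + INR (S k)) mu (Rabs t)) <= exp ((Re a + INR (S k)) * ln 4) * exp (PI * Cmod mu)).
    { replace (Re a + INR (S k)) with (Re (a + INR (S k))%C) by (rewrite re_plus, re_RtoC; reflexivity).
      apply cos_pow_bound; [rewrite re_plus, re_RtoC; lra|]. split; [apply Rabs_pos|apply Rabs_def1; lra]. }
    assert (B2 : Cmod (B_coef a z (S k)) <= Q * Cmod z ^ S k * (K * (2 ^ S k / INR (fact (S k)))) * exp (- ((Re a + INR (S k)) * ln 2))).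
    { unfold B_coef. rewrite (Cmod_mult _ (Cexp (- ((a + INR (S k)) * ln 2)))), (Cmod_mult _ (rGamma _)), (Cmod_mult _ ((- (Ci * z)) ^ S k)%C).
      fold Q. rewrite Cmod_pow, Cmod_opp, Cmod_mult, Cmod_Ci, Rmult_1_l, (Cmod_Cexp (- ((a + INR (S k)) * ln 2))), re_opp, re_scal_r, re_plus, re_RtoC.
      apply Rmult_le_compat_r; [left; apply exp_pos|]. apply Rmult_le_compat_l; [|apply HB].
      apply Rmult_le_pos; [exact HQ|apply pow_le, Cmod_ge_0]. }
    eapply Rle_trans; [apply Rmult_le_compat; [apply Cmod_ge_0|apply Cmod_ge_0|exact B2|exact B1]|].
    apply Req_le.
    (* In modulus, 2^(- a - k) from [B_coef] against the bound 4^(a + k) of the cosine power leaves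
       2^(a + k); with the 2^k of [rGamma_decay] this makes (4 Cmod z)^k / k!, at the index S k. *)
    assert (X : exp (- ((Re a + INR (S k)) * ln 2)) * exp ((Re a + INR (S k)) * ln 4) = exp (Re a * ln 2) * 2 ^ S k).
    { rewrite <- exp_plus, Hln4.
      replace (- ((Re a + INR (S k)) * ln 2) + (Re a + INR (S k)) * (ln 2 + ln 2)) with (Re a * ln 2 + INR (S k) * ln 2) by ring.
      rewrite exp_plus. f_equal. rewrite <- ln_pow, exp_ln; [reflexivity|apply pow_lt; lra|lra]. }
    replace (4 * Cmod z) with (2 * 2 * Cmod z) by ring. rewrite !Rpow_mult_distr. unfold E.
    set (e1 := exp (- ((Re a + INR (S k)) * ln 2))) in *. set (e2 := exp ((Re a + INR (S k)) * ln 4)) in *.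
    transitivity (Q * Cmod z ^ S k * K * (2 ^ S k / INR (fact (S k))) * exp (PI * Cmod mu) * (e1 * e2)); [ring|].
    rewrite X. field. apply INR_fact_neq_0.
  - apply (ex_series_scal (V := R_NormedModule) (Q * K * E)).
    apply (ex_series_incr_1 (fun k => (4 * Cmod z) ^ k / INR (fact k))), ex_series_exp.
  - intros t Ht. apply B_integrand_series, Ht.
  - intros k. apply is_improper_scal. apply cauchy_cos_integral. rewrite re_plus, re_RtoC. generalize (pos_INR k); lra.
Qed.

(** With s = mu + j, Cauchy's value contains 1 / Gamma (j + 1) = 1 / j!, and the quotient of 1/Gamma
    at 2 mu + j + 1 by 1/Gamma at 2 s + 1 is (2 mu + j + 1)_j. The shift j - k is the integer {mu} -
    mu, which also settles the powers of i. *)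
Lemma B_term_kummer (mu z a : C) (k j : nat) : z <> 0 -> (a + INR k = mu + INR j)%C -> - / 2 < Re (a + INR k)%C ->
  (ipow mu / PI * (B_coef a z k * cauchy_value (a + INR k) mu) = kummer_term mu z j)%C.
Proof.
  intros Hz E Hre. unfold cauchy_value, B_coef, kummer_term, kummer_coef. rewrite E. rewrite E in Hre.
  assert (HG : rGamma (2 * (mu + INR j) + 1) <> 0).
  { apply rGamma_neq0_Re. rewrite re_plus, re_scal_l, re_RtoC. lra. }
  replace (mu + INR j + 1 - mu)%C with (INR j + 1)%C by ring. rewrite rGamma_nat.
  replace (mu + INR j + 1 + mu)%C with (2 * mu + INR j + 1)%C by ring.
  rewrite (rGamma_rising (2 * mu + INR j + 1) j).
  replace (2 * mu + INR j + 1 + INR j)%C with (2 * (mu + INR j) + 1)%C by ring.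
  assert (Npi : RtoC PI <> 0) by (intros E'; apply RtoC_inj in E'; generalize PI_RGT_0; lra).
  (* All powers become one exponential in [Clog z]; integer powers of - i z enter through - i = e^(-
     i PI / 2). *)
  assert (P : (ipow mu * Cexp (- (Ci * PI * a / 2)) * cpow z a * (- (Ci * z)) ^ k * Cexp (- ((mu + INR j) * ln 2))
    = cpow (z / 2) mu * (- (Ci * z / 2)) ^ j)%C).
  { unfold ipow, cpow. rewrite Clog_half by exact Hz.
    assert (Em : (- (Ci * z))%C = Cexp (Clog z - Ci * PI / 2)).
    { unfold Cminus. rewrite Cexp_plus, Cexp_mi, Cexp_Clog by exact Hz. ring. }
    assert (Em2 : (- (Ci * z / 2))%C = Cexp (Clog z - Ci * PI / 2 - ln 2)).
    { unfold Cminus at 1. rewrite Cexp_plus, <- Em, Cexp_opp, Cexp_RtoC, exp_ln by lra. field. }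
    rewrite Em, Em2, <- !Cexp_nat, <- !Cexp_plus. f_equal.
    replace a with (mu + INR j - INR k)%C by (rewrite <- E; ring). field. }
  transitivity ((ipow mu * Cexp (- (Ci * PI * a / 2)) * cpow z a * (- (Ci * z)) ^ k * Cexp (- ((mu + INR j) * ln 2))) *
     (Cexp (Ci * z) * rGamma (mu + INR j + 1) * rising (2 * mu + INR j + 1) j / INR (fact j)))%C.
  - field. repeat split; [apply INR_fact_neq0C|exact HG|exact Npi].
  - rewrite P. field. apply INR_fact_neq0C.
Qed.

Lemma B_convergent (mu z : C) : is_convergent_0_PI (B_integrand mu z).
Proof. destruct (B_integral_series mu z) as [l [H _]]. eapply is_improper_convergent, H. Qed.

Lemma B_series (mu z : C) : Cser (fun k => ipow mu / PI * (B_coef (cfrac mu) z k * cauchy_value (cfrac mu + INR k) mu))%C (B mu z).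
Proof.
  destruct (B_integral_series mu z) as [l [H1 H2]]. unfold B. rewrite (is_improper_integral _ _ H1). apply Cser_scal, H2.
Qed.

Lemma B_nonneg (mu z : C) (n : nat) : z <> 0 -> nint (Re mu) = Z.of_nat n -> B mu z = BesselJ mu z.
Proof.
  intros Hz Hn. assert (HS := B_series mu z).
  assert (Ea : cfrac mu = (mu - INR n)%C) by (unfold cfrac; rewrite Hn, <- INR_IZR_INZ; reflexivity).
  assert (Hre := Re_cfrac mu).
  assert (H0 : Csum_lt (fun k => ipow mu / PI * (B_coef (cfrac mu) z k * cauchy_value (cfrac mu + INR k) mu))%C n = 0).
  { assert (Z : forall m, (m <= n)%nat -> Csum_lt (fun k => ipow mu / PI * (B_coef (cfrac mu) z k * cauchy_value (cfrac mu + INR k) mu))%C m = 0).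
    { induction m as [|m IH]; intros Hm; [reflexivity|]. simpl. rewrite IH by lia.
      unfold cauchy_value. rewrite Ea.
      (* Since m < n, this argument of 1/Gamma is a nonpositive integer and the term vanishes. *)
      replace (mu - INR n + INR m + 1 - mu)%C with (- INR (n - S m))%C.
      - rewrite rGamma_neg_nat. unfold Cdiv. ring.
      - rewrite minus_INR by lia. rewrite S_INR, RtoC_minus, RtoC_plus. ring. }
    apply Z. lia. }
  apply (Cser_unique (kummer_term mu z)); [|apply BesselJ_kummer].
  replace (B mu z) with (0 + B mu z)%C in HS by ring. rewrite <- H0 in HS. apply Cser_drop in HS.
  revert HS. apply Cser_ext. intros j.
  apply B_term_kummer; [exact Hz| |].
  - rewrite Ea, plus_INR, RtoC_plus. ring.
  - rewrite re_plus, re_RtoC. generalize (pos_INR (n + j)); lra.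
Qed.

Lemma B_neg (mu z : C) (n : nat) : z <> 0 -> nint (Re mu) = (- Z.of_nat n)%Z ->
  (BesselJ mu z = B mu z + Csum_lt (kummer_term mu z) n)%C.
Proof.
  intros Hz Hn. assert (HS := B_series mu z).
  assert (Ea : cfrac mu = (mu + INR n)%C).
  { unfold cfrac. rewrite Hn, opp_IZR, <- INR_IZR_INZ, RtoC_opp. ring. }
  assert (Hre := Re_cfrac mu).
  apply (Cser_unique (kummer_term mu z)); [apply BesselJ_kummer|].
  rewrite Cplus_comm. apply (proj1 (Cser_drop (kummer_term mu z) n (B mu z))). revert HS. apply Cser_ext. intros k.
  apply B_term_kummer; [exact Hz| |].
  - rewrite Ea, plus_INR, RtoC_plus. ring.
  - rewrite re_plus, re_RtoC. generalize (pos_INR k); lra.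
Qed.

(** * The residual sum *)

Lemma Csum_lt_sum_n_m (a : nat -> C) (n : nat) : @eq C (sum_n_m a 1 n) (Csum_lt (fun j => a (S j)) n).
Proof.
  induction n as [|n IH].
  - rewrite sum_n_m_zero by lia. reflexivity.
  - rewrite sum_n_Sm by lia. simpl. rewrite <- IH. reflexivity.
Qed.

Lemma Csum_lt_ext (a b : nat -> C) (n : nat) : (forall k, (k < n)%nat -> a k = b k) -> Csum_lt a n = Csum_lt b n.
Proof.
  induction n as [|n IH]; intros H; [reflexivity|]. simpl. rewrite IH, H by (intros; try apply H; lia). reflexivity.
Qed.

Lemma Csum_lt_scal (c : C) (a : nat -> C) (n : nat) : Csum_lt (fun k => c * a k)%C n = (c * Csum_lt a n)%C.
Proof. induction n as [|n IH]; simpl; [ring|]. rewrite IH. ring. Qed.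

(** This and [rising_half_nat] evaluate the terms of [chi] at half-integral mu, where [chi_coef] is
    given by a limit value. *)
Lemma rising_neg_nat (q j : nat) :
  (rising (- INR (q + j)) j * INR (fact q) = RtoC ((-1) ^ j) * INR (fact (q + j)))%C.
Proof.
  induction j as [|j IH].
  - rewrite Nat.add_0_r. simpl. ring.
  - rewrite rising_shift. replace (q + S j)%nat with (S (q + j)) by lia.
    replace (- INR (S (q + j)) + 1)%C with (- INR (q + j))%C by (rewrite S_INR, RtoC_plus; ring).
    rewrite fact_S_C. simpl ((-1) ^ S j). rewrite RtoC_mult.
    transitivity (- INR (S (q + j)) * (rising (- INR (q + j)) j * INR (fact q)))%C; [ring|]. rewrite IH.
    ring.
Qed.

Lemma rising_half_nat (p : nat) :
  (rising (/ 2 - INR p) p * (4 ^ p * INR (fact p)) = RtoC ((-1) ^ p) * INR (fact (2 * p)))%C.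
Proof.
  induction p as [|p IH]; [simpl; ring|].
  rewrite rising_shift. replace (/ 2 - INR (S p) + 1)%C with (/ 2 - INR p)%C by (rewrite S_INR, RtoC_plus; ring).
  replace (2 * S p)%nat with (S (S (2 * p))) by lia. rewrite !fact_S_C. simpl ((-1) ^ S p). simpl Cpow. rewrite RtoC_mult.
  transitivity ((/ 2 - INR (S p)) * 4 * INR (S p) * (rising (/ 2 - INR p) p * (4 ^ p * INR (fact p))))%C; [ring|]. rewrite IH.
  rewrite !S_INR, mult_INR, !RtoC_plus, RtoC_mult. simpl (INR 2). rewrite RtoC_plus. field.
Qed.

Lemma powerRZ_m1_neg (k : nat) : powerRZ (-1) (- Z.of_nat k) = (-1) ^ k.
Proof.
  rewrite powerRZ_neg by lra. rewrite <- pow_powerRZ.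
  induction k as [|k IH]; simpl; [field|]. rewrite <- IH. field.
Qed.

Lemma Gamma_nat (n : nat) : Gamma (IZR (Z.of_nat (S n))) = INR (fact n).
Proof.
  unfold Gamma. rewrite <- INR_IZR_INZ, S_INR, RtoC_plus, rGamma_nat. field.
  apply INR_fact_neq0C.
Qed.

Lemma nint_half (k : Z) : nint (IZR k + / 2) = k.
Proof. unfold nint. apply Zceil_eq. lra. Qed.

Lemma sqrt_PI_neq0 : RtoC (sqrt PI) <> 0.
Proof. intros E; apply RtoC_inj in E. generalize (sqrt_lt_R0 PI PI_RGT_0); lra. Qed.

Lemma Cexp_double_ln2 (w : C) : Cexp (2 * w * ln 2)%C = Cexp (w * ln 4)%C.
Proof. replace 4 with (2 * 2) by ring. rewrite ln_mult, RtoC_plus by lra. f_equal. ring. Qed.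

(** Duplication at x = mu + j + 1/2, divided by 1 / Gamma (x). The division fails only if x is a
    nonpositive integer, which forces mu = m + 1/2 with m the nearest integer to Re mu; there both
    sides are computed in factorials. *)
Lemma chi_coef_eq (mu : C) (n j : nat) : nint (Re mu) = (- Z.of_nat n)%Z -> (j < n)%nat ->
  (chi_coef mu (S j) * Cexp ((mu + INR j) * ln 4) / sqrt PI = rGamma (mu + INR j + 1) * rising (2 * mu + INR j + 1) j)%C.
Proof.
  intros Hn Hj. unfold chi_coef. rewrite Hn.
  assert (NP := sqrt_PI_neq0).
  destruct (Ceq_dec mu (IZR (- Z.of_nat n) + / 2)%R) as [E|NE].
  (* Here mu + j + 1/2 = - p and 2 mu + j + 1 = - (2 p + j), so p and j index all the factorials
     that occur. *)
  - set (p := (n - j - 1)%nat).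
    replace (- Z.of_nat (S j) - 2 * - Z.of_nat n)%Z with (Z.of_nat (S (2 * p + j))) by lia.
    replace (- Z.of_nat (S j) - - Z.of_nat n + 1)%Z with (Z.of_nat (S p)) by lia.
    replace (- Z.of_nat n + 1)%Z with (- Z.of_nat (p + j))%Z by lia.
    rewrite !Gamma_nat, powerRZ_m1_neg.
    assert (Emu : (mu = / 2 - INR p - INR j - 1)%C).
    { rewrite E, opp_IZR, <- INR_IZR_INZ. replace n with (S (p + j)) by lia.
      rewrite S_INR, plus_INR, RtoC_plus, RtoC_opp, !RtoC_plus, RtoC_inv by lra. ring. }
    replace (mu + INR j + 1)%C with (/ 2 - INR p)%C by (rewrite Emu; ring).
    replace (2 * mu + INR j + 1)%C with (- INR (2 * p + j))%C by (rewrite Emu, plus_INR, mult_INR, RtoC_plus, RtoC_mult; simpl (INR 2); rewrite RtoC_plus; field).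
    assert (E4 : Cexp ((mu + INR j) * ln 4) = (/ (2 * 4 ^ p))%C).
    { replace ((mu + INR j) * ln 4)%C with (- (INR p * ln 4 + ln 2))%C.
      - rewrite Cexp_opp, Cexp_plus, Cexp_nat, !Cexp_RtoC, !exp_ln by lra. f_equal. ring.
      - rewrite Emu. replace 4 with (2 * 2) by ring. rewrite ln_mult, RtoC_plus by lra. field. }
    rewrite E4, (rGamma_rising (/ 2 - INR p) p). replace (/ 2 - INR p + INR p)%C with (/ 2)%C by ring.
    rewrite rGamma_half.
    assert (R1 := rising_half_nat p). assert (R2 := rising_neg_nat (2 * p) j).
    rewrite pow_add, RtoC_mult.
    assert (F1 := INR_fact_neq0C p). assert (F2 := INR_fact_neq0C (2 * p)).
    assert (N4 : (4 ^ p)%C <> 0) by (apply Cpow_nz; intros E'; apply RtoC_inj in E'; lra).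
    set (r1 := rising (/ 2 - INR p) p) in *. set (r2 := rising (- INR (2 * p + j)) j) in *.
    transitivity ((RtoC ((-1) ^ p) * INR (fact (2 * p))) * (RtoC ((-1) ^ j) * INR (fact (2 * p + j))) / (4 ^ p * INR (fact p) * INR (fact (2 * p)) * sqrt PI))%C.
    + field. repeat split; assumption.
    + rewrite <- R1, <- R2. field. repeat split; assumption.
  - set (x := (mu + INR j + / 2)%C).
    assert (Hx : rGamma x <> 0).
    { apply rGamma_neq0. intros m Em. apply NE.
      assert (Emu : mu = RtoC (IZR (- Z.of_nat (S (m + j))) + / 2)).
      { replace mu with (x - INR j - / 2)%C by (unfold x; ring). rewrite Em.
        rewrite opp_IZR, <- INR_IZR_INZ, S_INR, plus_INR, RtoC_plus, RtoC_opp, !RtoC_plus, RtoC_inv by lra. field. }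
      assert (Hk : nint (Re mu) = (- Z.of_nat (S (m + j)))%Z) by (rewrite Emu, re_RtoC; apply nint_half).
      rewrite Hn in Hk. rewrite Hk. exact Emu. }
    replace (INR (S j) + mu - / 2)%C with x by (unfold x; rewrite S_INR, RtoC_plus; field).
    replace (INR (S j) + 2 * mu)%C with (2 * mu + INR j + 1)%C by (rewrite S_INR, RtoC_plus; ring).
    assert (D := rGamma_duplication x).
    replace (x + / 2)%C with (mu + INR j + 1)%C in D by (unfold x; field).
    rewrite Cexp_double_ln2 in D.
    replace (2 * x)%C with (2 * mu + INR j + 1 + INR j)%C in D by (unfold x; field).
    replace (x * ln 4)%C with ((mu + INR j) * ln 4 + ln 2)%C in D.
    2:{ unfold x. replace 4 with (2 * 2) by ring. rewrite ln_mult, RtoC_plus by lra. field. }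
    rewrite Cexp_plus, (Cexp_RtoC (ln 2)), exp_ln in D by lra.
    rewrite (rGamma_rising (2 * mu + INR j + 1) j). unfold Gamma.
    set (G := rGamma (mu + INR j + 1)) in *. set (r := rising (2 * mu + INR j + 1) j).
    transitivity (r * (rGamma x * G) / rGamma x)%C; [rewrite D|]; field; repeat split; assumption.
Qed.

Lemma chi_neg (mu z : C) (n : nat) : z <> 0 -> (1 <= n)%nat -> nint (Re mu) = (- Z.of_nat n)%Z ->
  chi mu z = Csum_lt (kummer_term mu z) n.
Proof.
  intros Hz Hn1 Hn. unfold chi.
  destruct (Rle_dec (Re mu) (- / 2)) as [_|H].
  2:{ exfalso. apply H. unfold nint in Hn. assert (A := Zceil_bound (Re mu - / 2)). rewrite Hn in A.
      assert (IZR (- Z.of_nat n) <= -1) by (apply (IZR_le _ (-1)); lia). lra. }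
  rewrite Hn, Z.opp_involutive, Nat2Z.id, Csum_lt_sum_n_m, <- Csum_lt_scal.
  apply Csum_lt_ext. intros j Hj.
  assert (EG : (/ Gamma (INR (S j)) = / INR (fact j))%C).
  { rewrite INR_IZR_INZ, Gamma_nat. reflexivity. }
  unfold Cdiv at 2. rewrite EG.
  replace (INR (S j) + mu - 1)%C with (mu + INR j)%C by (rewrite S_INR, RtoC_plus; ring).
  unfold kummer_term, kummer_coef. rewrite <- (chi_coef_eq mu n j Hn Hj).
  (* i^mu (- 2 i z)^(mu + j) = 4^(mu + j) (z/2)^mu (- i z/2)^j; the power of 4 is the one in
     [chi_coef_eq]. *)
  assert (P : (ipow mu * micpow 2 z (mu + INR j) = Cexp ((mu + INR j) * ln 4) * (cpow (z / 2) mu * (- (Ci * z / 2)) ^ j))%C).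
  { unfold ipow, micpow. rewrite cpow_pos by lra. unfold cpow. rewrite Clog_half by exact Hz.
    assert (Em2 : (- (Ci * z / 2))%C = Cexp (Clog z - Ci * PI / 2 - ln 2)).
    { unfold Cminus. rewrite !Cexp_plus, Cexp_mi, Cexp_Clog, Cexp_opp, Cexp_RtoC, exp_ln by (auto; lra). field. }
    rewrite Em2, <- Cexp_nat, <- !Cexp_plus. f_equal.
    replace 4 with (2 * 2) by ring. rewrite ln_mult, RtoC_plus by lra. field. }
  transitivity ((ipow mu * micpow 2 z (mu + INR j)) * (Cexp (Ci * z) * chi_coef mu (S j) / sqrt PI / INR (fact j)))%C.
  - field. split; first [apply INR_fact_neq0C|apply sqrt_PI_neq0].
  - rewrite P. field. split; first [apply INR_fact_neq0C|apply sqrt_PI_neq0].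
Qed.

Lemma chi_pos (mu z : C) : - / 2 < Re mu -> chi mu z = 0.
Proof. intros H. unfold chi. destruct (Rle_dec (Re mu) (- / 2)); [lra|reflexivity]. Qed.

Lemma BesselJ_B_chi (mu z : C) : z <> 0 -> BesselJ mu z = (B mu z + chi mu z)%C.
Proof.
  intros Hz. assert (A := Zceil_bound (Re mu - / 2)).
  (* Halves are rounded down, so Re mu = - 1/2 has nearest integer - 1 and falls on the side where
     [chi] has a term. *)
  destruct (Rlt_le_dec (- / 2) (Re mu)) as [H|H].
  - rewrite chi_pos, Cplus_0_r by exact H. symmetry. apply (B_nonneg _ _ (Z.to_nat (nint (Re mu)))); [exact Hz|].
    rewrite Z2Nat.id; [reflexivity|]. unfold nint.
    assert (-1 < Zceil (Re mu - / 2))%Z by (apply lt_IZR; lra). lia.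
  - assert (Hc : (Zceil (Re mu - / 2) < 0)%Z) by (apply lt_IZR; lra).
    assert (Hn : nint (Re mu) = (- Z.of_nat (Z.to_nat (- nint (Re mu))))%Z) by (unfold nint; lia).
    rewrite (chi_neg mu z (Z.to_nat (- nint (Re mu)))); [|exact Hz|unfold nint; lia|exact Hn].
    apply B_neg; assumption.
Qed.

(** * Limits at integers *)

Definition bessel_weight (z : C) (k : nat) : C := (RtoC ((-1) ^ k) * (z / 2) ^ (2 * k) / INR (fact k))%C.

Lemma Cmod_bessel_weight (z : C) (k : nat) :
  Cmod (bessel_weight z k) = (Cmod (z / 2) ^ 2) ^ k / INR (fact k).
Proof.
  unfold bessel_weight. rewrite Cmod_div by apply INR_fact_neq0C.
  rewrite Cmod_mult, Cmod_pow, !Cmod_R, pow_1_abs, Rmult_1_l, (Rabs_pos_eq (INR _)), pow_mult by apply pos_INR. reflexivity.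
Qed.

Lemma S_le_pow2 (k : nat) : INR k + 1 <= 2 ^ k.
Proof. induction k as [|k IH]; [simpl; lra|]. rewrite S_INR. simpl. generalize (pos_INR k); lra. Qed.

Lemma ex_Cderiv_cpow (w s0 : C) : ex_Cderiv (cpow w) s0.
Proof. eexists. apply is_Cderiv_Cexp_lin. Qed.

(** [Clim_switch] with the partial sums of the series. The Lipschitz constant of the remainder is a
    tail of the sum of L (k + 1) q^k / k!, and k + 1 <= 2^k turns this into an exponential
    series. *)
Lemma ex_Cderiv_BesselJ (z s0 : C) : ex_Cderiv (fun nu => BesselJ nu z) s0.
Proof.
  set (F := fun nu => Cseries (fun k => bessel_weight z k * rGamma (nu + INR k + 1))%C).
  assert (HF : forall nu, Cser (fun k => bessel_weight z k * rGamma (nu + INR k + 1))%C (F nu)).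
  { intros nu. destruct (BesselJ_series nu z) as [l [H _]].
    replace (F nu) with l; [exact H|]. symmetry. apply (Cser_Cseries _ _ H). }
  apply (ex_Cderiv_mult (cpow (z / 2)) F); [apply ex_Cderiv_cpow|].
  set (r := Cmod s0 + 1). assert (Hs0 := Cmod_ge_0 s0).
  destruct (rGamma_shift_lipschitz r ltac:(unfold r; lra)) as [L [HL HLip]].
  set (q := Cmod (z / 2) ^ 2). assert (Hq : 0 <= q) by (apply pow_le, Cmod_ge_0).
  set (m := fun k => L * ((2 * q) ^ k / INR (fact k))).
  destruct (ex_series_scal (V := R_NormedModule) L _ (ex_series_exp (2 * q))) as [M HM].
  change (is_series m M) in HM.
  apply Clim_switch. intros e He.
  destruct (series_tail_small m M e HM He) as [N HN]. specialize (HN N (le_n N)).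
  destruct (ex_Cderiv_sum (fun k nu => bessel_weight z k * rGamma (nu + INR k + 1))%C N s0) as [l Hl].
  { intros k. apply ex_Cderiv_mult; [apply ex_Cderiv_const|].
    apply ex_Cderiv_ext with (fun s => rGamma (s + (INR k + 1))%C); [|apply ex_Cderiv_rGamma_shift].
    intros s. f_equal. ring. }
  exists (fun nu => sum_n (fun k => bessel_weight z k * rGamma (nu + INR k + 1))%C N), l. split; [exact Hl|].
  exists 1. split; [lra|]. intros s Hs.
  assert (Hsr : Cmod s <= r).
  { replace s with ((s - s0) + s0)%C by ring. eapply Rle_trans; [apply Cmod_triangle|]. unfold r; lra. }
  set (D := Cmod (s - s0)%C) in *. assert (HD : 0 <= D) by apply Cmod_ge_0.
  set (d := fun k => (bessel_weight z k * rGamma (s + INR k + 1) - bessel_weight z k * rGamma (s0 + INR k + 1))%C).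
  assert (Es : forall n, @eq C (sum_n d n) (sum_n (fun k => bessel_weight z k * rGamma (s + INR k + 1))%C n - sum_n (fun k => bessel_weight z k * rGamma (s0 + INR k + 1))%C n)%C).
  { intros n. induction n as [|n IH]; rewrite ?Csum_0, ?Csum_S, ?IH; unfold d; [reflexivity|ring]. }
  assert (Hd : Cser d (F s - F s0)%C).
  { apply Clim_ext with (fun n => sum_n (fun k => bessel_weight z k * rGamma (s + INR k + 1))%C n - sum_n (fun k => bessel_weight z k * rGamma (s0 + INR k + 1))%C n)%C.
    - exists 0%nat. intros n _. symmetry. apply Es.
    - apply Clim_minus; [|]; apply HF. }
  assert (Hbd : forall k, Cmod (d k) <= D * m k).
  { intros k. unfold d.
    replace (bessel_weight z k * rGamma (s + INR k + 1) - bessel_weight z k * rGamma (s0 + INR k + 1))%C with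
      (bessel_weight z k * (rGamma (s + INR k + 1) - rGamma (s0 + INR k + 1)))%C by ring.
    rewrite Cmod_mult, Cmod_bessel_weight. fold q.
    assert (P0 : 0 <= q ^ k / INR (fact k)) by (apply Rmult_le_pos; [apply pow_le, Hq|left; apply Rinv_0_lt_compat, INR_fact_lt_0]).
    assert (A := HLip k s s0 Hsr ltac:(unfold r; lra)). fold D in A.
    eapply Rle_trans; [apply Rmult_le_compat_l; [exact P0|exact A]|].
    unfold m. rewrite Rpow_mult_distr.
    replace (D * (L * (2 ^ k * q ^ k / INR (fact k)))) with ((q ^ k / INR (fact k)) * (L * 2 ^ k * D)) by (field; apply INR_fact_neq_0).
    apply Rmult_le_compat_l; [exact P0|]. apply Rmult_le_compat_r; [exact HD|]. apply Rmult_le_compat_l; [lra|apply S_le_pow2]. }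
  assert (HDM := is_series_scal (V := R_NormedModule) D m M HM).
  assert (T := Cser_tail_le d (fun k => D * m k) _ (D * M) N Hbd HDM Hd).
  rewrite Es in T.
  match goal with |- Cmod ?x <= _ => match type of T with Cmod ?y <= _ => replace x with y by ring end end.
  eapply Rle_trans; [exact T|].
  assert (E2 : sum_n (fun k => D * m k) N = D * sum_n m N).
  { clear. induction N as [|N IH]; rewrite ?sum_O, ?sum_Sn, ?IH; unfold plus; simpl; ring. }
  rewrite E2. replace (D * M - D * sum_n m N) with ((M - sum_n m N) * D) by ring.
  apply Rmult_le_compat_r; [exact HD|]. left. exact HN.
Qed.

Lemma cpow_nat (w : C) (n : nat) : w <> 0 -> cpow w (INR n) = (w ^ n)%C.
Proof. intros Hw. unfold cpow. rewrite Cexp_nat, Cexp_Clog by exact Hw. reflexivity. Qed.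

Lemma Cpow_sqr_m1 (n : nat) : (RtoC ((-1) ^ n) * RtoC ((-1) ^ n) = 1)%C.
Proof. rewrite <- RtoC_mult, <- Rpow_mult_distr. replace (-1 * -1) with 1 by ring. rewrite pow1. reflexivity. Qed.

(** The first n terms vanish with 1/Gamma. In term n + k of the one series and term k of the other,
    the two factorials k! and (n + k)! merely change places. *)
Lemma BesselJ_neg_nat (z : C) (n : nat) : z <> 0 ->
  BesselJ (- INR n) z = (RtoC ((-1) ^ n) * BesselJ (INR n) z)%C.
Proof.
  intros Hz. destruct (BesselJ_series (- INR n) z) as [l1 [H1 [_ E1]]]. destruct (BesselJ_series (INR n) z) as [l2 [H2 [_ E2]]].
  assert (Hw : (z / 2)%C <> 0).
  { intros E. apply Hz. replace z with (2 * (z / 2))%C by field. rewrite E. ring. }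
  set (t := fun k => (RtoC ((-1) ^ k) * (z / 2) ^ (2 * k) / INR (fact k) * rGamma (- INR n + INR k + 1))%C) in H1.
  assert (Z : forall m, (m <= n)%nat -> Csum_lt t m = 0).
  { induction m as [|m IH]; intros Hm; [reflexivity|]. simpl. rewrite IH by lia. unfold t.
    replace (- INR n + INR m + 1)%C with (- INR (n - S m))%C.
    - rewrite rGamma_neg_nat. ring.
    - rewrite minus_INR by lia. rewrite S_INR, RtoC_minus, RtoC_plus. ring. }
  assert (El : l1 = (RtoC ((-1) ^ n) * (z / 2) ^ (2 * n) * l2)%C).
  { apply (Cser_unique (fun k => t (n + k)%nat)).
    - apply (proj2 (Cser_drop t n l1)). rewrite (Z n (le_n n)), Cplus_0_l. exact H1.
    - generalize (Cser_scal (RtoC ((-1) ^ n) * (z / 2) ^ (2 * n))%C _ _ H2). apply Cser_ext. intros k. unfold t.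
      replace (- INR n + INR (n + k) + 1)%C with (INR k + 1)%C by (rewrite plus_INR, RtoC_plus; ring).
      replace (INR n + INR k + 1)%C with (INR (n + k) + 1)%C by (rewrite plus_INR, RtoC_plus; ring).
      rewrite !rGamma_nat, pow_add, RtoC_mult. replace (2 * (n + k))%nat with (2 * n + 2 * k)%nat by lia. rewrite Cpow_add_r.
      field. split; apply INR_fact_neq0C. }
  rewrite E1, E2, El.
  assert (Ec : cpow (z / 2) (- INR n) = (/ (z / 2) ^ n)%C).
  { rewrite <- cpow_nat by exact Hw. unfold cpow. rewrite <- Cexp_opp. f_equal. ring. }
  rewrite Ec, cpow_nat by exact Hw.
  replace ((z / 2) ^ (2 * n))%C with ((z / 2) ^ n * (z / 2) ^ n)%C by (rewrite <- Cpow_add_r; f_equal; lia).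
  assert (Np : ((z / 2) ^ n)%C <> 0) by (apply Cpow_nz, Hw).
  set (p := ((z / 2) ^ n)%C) in *. field. exact Np.
Qed.

Lemma Ccos_RtoC (x : R) : Ccos x = RtoC (cos x).
Proof.
  assert (R0 : Re (Ci * x)%C = 0) by (rewrite re_scal_r; simpl; ring).
  assert (I0 : Im (Ci * x)%C = x) by (rewrite im_scal_r; simpl; ring).
  assert (E : (Cexp (Ci * x) + Cexp (- (Ci * x)) = RtoC 2 * RtoC (cos x))%C).
  { apply C_eq; rewrite ?re_plus, ?im_plus, ?Re_Cexp, ?Im_Cexp, ?re_opp, ?im_opp, ?R0, ?I0, ?re_scal_l, ?im_scal_l, ?Ropp_0, ?exp_0, ?cos_neg, ?sin_neg; simpl; ring. }
  unfold Ccos. rewrite E. field.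
Qed.

Lemma Csin_RtoC (x : R) : Csin x = RtoC (sin x).
Proof.
  assert (R0 : Re (Ci * x)%C = 0) by (rewrite re_scal_r; simpl; ring).
  assert (I0 : Im (Ci * x)%C = x) by (rewrite im_scal_r; simpl; ring).
  assert (E : (Cexp (Ci * x) - Cexp (- (Ci * x)) = RtoC (2 * sin x) * Ci)%C).
  { apply C_eq; unfold Cminus; rewrite ?re_plus, ?im_plus, ?re_opp, ?im_opp, ?Re_Cexp, ?Im_Cexp, ?re_opp, ?im_opp, ?R0, ?I0, ?re_scal_l, ?im_scal_l, ?Ropp_0, ?exp_0, ?cos_neg, ?sin_neg; simpl; ring. }
  unfold Csin. rewrite E, RtoC_mult. field. apply Ci_nz.
Qed.

(** Equality of the two exponentials forces equal moduli, hence Im mu = 0, and the zeros of the real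
    sine remain. *)
Lemma Csin_eq_0 (mu : C) : Csin (mu * PI) = 0 -> exists k : Z, mu = IZR k.
Proof.
  intros H. assert (Hpi := PI_RGT_0).
  assert (E : Cexp (Ci * (mu * PI)) = Cexp (- (Ci * (mu * PI)))).
  { replace (Cexp (Ci * (mu * PI))) with (2 * Ci * Csin (mu * PI) + Cexp (- (Ci * (mu * PI))))%C.
    - rewrite H. ring.
    - unfold Csin. field. apply Ci_nz. }
  assert (R0 : Re (Ci * (mu * PI))%C = - (Im mu * PI)) by (rewrite re_mult, im_scal_r; simpl; ring).
  assert (EI : Im mu = 0).
  { apply (f_equal Cmod) in E. rewrite !Cmod_Cexp, re_opp, R0 in E. apply exp_inv in E. nra. }
  assert (Em : mu = RtoC (Re mu)) by (apply C_eq; [reflexivity|exact EI]).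
  rewrite Em, <- RtoC_mult, Csin_RtoC in H. apply RtoC_inj in H.
  destruct (sin_eq_0_0 _ H) as [k Hk]. exists k. rewrite Em. f_equal. apply Rmult_eq_reg_r with PI; lra.
Qed.

Lemma cos_INR_PI (n : nat) : cos (INR n * PI) = (-1) ^ n.
Proof.
  induction n as [|n IH]; [simpl; rewrite Rmult_0_l; apply cos_0|].
  rewrite S_INR, Rmult_plus_distr_r, Rmult_1_l, neg_cos, IH. simpl. ring.
Qed.

Lemma sin_IZR_PI (k : Z) : sin (IZR k * PI) = 0.
Proof. apply sin_eq_0_1. exists k. reflexivity. Qed.

Lemma is_Cderiv_Csin_PI (s0 : C) : is_Cderiv (fun nu => Csin (nu * PI)) s0 (PI * Ccos (s0 * PI))%C.
Proof.
  assert (H := is_Cderiv_scal (/ (2 * Ci)) _ _ _ (is_Cderiv_plus _ _ _ _ _ (is_Cderiv_Cexp_lin (Ci * PI) s0) (is_Cderiv_scal (-1) _ _ _ (is_Cderiv_Cexp_lin (- (Ci * PI)) s0)))).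
  replace (PI * Ccos (s0 * PI))%C with (/ (2 * Ci) * (Ci * PI * Cexp (s0 * (Ci * PI)) + -1 * (- (Ci * PI) * Cexp (s0 * - (Ci * PI)))))%C.
  - revert H. apply is_Cderiv_ext. intros s. unfold Csin.
    replace (s * (Ci * PI))%C with (Ci * (s * PI))%C by ring. replace (s * - (Ci * PI))%C with (- (Ci * (s * PI)))%C by ring.
    field. apply Ci_nz.
  - unfold Ccos. replace (s0 * (Ci * PI))%C with (Ci * (s0 * PI))%C by ring. replace (s0 * - (Ci * PI))%C with (- (Ci * (s0 * PI)))%C by ring.
    field. apply Ci_nz.
Qed.

Lemma ex_Cderiv_Ccos_PI (s0 : C) : ex_Cderiv (fun nu => Ccos (nu * PI)) s0.
Proof.
  eexists. apply is_Cderiv_ext with (fun s => / 2 * (Cexp (s * (Ci * PI)) + Cexp (s * - (Ci * PI))))%C.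
  - intros s. unfold Ccos.
    replace (s * (Ci * PI))%C with (Ci * (s * PI))%C by ring. replace (s * - (Ci * PI))%C with (- (Ci * (s * PI)))%C by ring. field.
  - apply is_Cderiv_scal, is_Cderiv_plus; apply is_Cderiv_Cexp_lin.
Qed.

Lemma ex_Cderiv_opp (f : C -> C) (s0 : C) : ex_Cderiv f (- s0)%C -> ex_Cderiv (fun s => f (- s)%C) s0.
Proof.
  intros H. apply ex_Cderiv_ext with (fun s => f (-1 * s + 0)%C); [intros s; f_equal; ring|].
  apply ex_Cderiv_affine; [intros E; apply RtoC_inj in E; lra|]. replace (-1 * s0 + 0)%C with (- s0)%C by ring. exact H.
Qed.

Lemma ex_Cderiv_minus (f g : C -> C) (s0 : C) : ex_Cderiv f s0 -> ex_Cderiv g s0 -> ex_Cderiv (fun s => f s - g s)%C s0.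
Proof.
  intros [l Hl] [m Hm]. eexists. apply is_Cderiv_ext with (fun s => f s + (-1) * g s)%C; [intros; ring|].
  apply is_Cderiv_plus; [exact Hl|apply is_Cderiv_scal, Hm].
Qed.

(** The zeros of sin (nu PI) are simple, so a differentiable numerator that vanishes there
    suffices. *)
Lemma quot_Csin_PI_lim (f : C -> C) (k : Z) : ex_Cderiv f (IZR k) -> f (IZR k) = 0 ->
  exists l, Clim (Cpunct (RtoC (IZR k))) (fun nu => f nu / Csin (nu * PI))%C l.
Proof.
  intros [l Hl] H0. eexists.
  apply (Cderiv_quot f (fun nu => Csin (nu * PI)) (IZR k) l (PI * Ccos (IZR k * PI))%C); [exact H0| | |exact Hl|apply is_Cderiv_Csin_PI].
  - rewrite <- RtoC_mult, Csin_RtoC, sin_IZR_PI. reflexivity.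
  - rewrite <- RtoC_mult, Ccos_RtoC, <- RtoC_mult. intros E. apply RtoC_inj in E.
    apply Rmult_integral in E. destruct E as [E|E]; [generalize PI_RGT_0; lra|].
    generalize (sin2_cos2 (IZR k * PI)). rewrite sin_IZR_PI, E. unfold Rsqr. lra.
Qed.

Lemma IZR_nat_cases (k : Z) : exists n : nat, k = Z.of_nat n \/ k = (- Z.of_nat n)%Z.
Proof. exists (Z.abs_nat k). lia. Qed.

Lemma RtoC_IZR_neg_nat (n : nat) : RtoC (IZR (- Z.of_nat n)) = (- INR n)%C.
Proof. rewrite opp_IZR, <- INR_IZR_INZ, RtoC_opp. reflexivity. Qed.

Definition BesselY_quot (z nu : C) : C := ((BesselJ nu z * Ccos (nu * PI) - BesselJ (- nu) z) / Csin (nu * PI))%C.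

(** The numerator vanishes at an integer by [BesselJ_neg_nat]. *)
Lemma BesselY_quot_lim (z : C) (k : Z) : z <> 0 -> exists y, Clim (Cpunct (RtoC (IZR k))) (BesselY_quot z) y.
Proof.
  intros Hz. apply (quot_Csin_PI_lim (fun nu => BesselJ nu z * Ccos (nu * PI) - BesselJ (- nu) z)%C k).
  - apply ex_Cderiv_minus; [apply ex_Cderiv_mult; [apply ex_Cderiv_BesselJ|apply ex_Cderiv_Ccos_PI]|].
    apply (ex_Cderiv_opp (fun s => BesselJ s z)), ex_Cderiv_BesselJ.
  - rewrite <- RtoC_mult, Ccos_RtoC. destruct (IZR_nat_cases k) as [n [->| ->]].
    + rewrite <- INR_IZR_INZ, cos_INR_PI, BesselJ_neg_nat by exact Hz. ring.
    + rewrite RtoC_IZR_neg_nat, opp_IZR, <- INR_IZR_INZ.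
      replace (- INR n * PI) with (- (INR n * PI)) by ring. rewrite cos_neg, cos_INR_PI, BesselJ_neg_nat by exact Hz.
      replace (- - INR n)%C with (RtoC (INR n)) by ring.
      transitivity ((RtoC ((-1) ^ n) * RtoC ((-1) ^ n)) * BesselJ (INR n) z - BesselJ (INR n) z)%C; [ring|].
      rewrite Cpow_sqr_m1. ring.
Qed.

Lemma nint_near (x : R) (k : Z) : IZR k - / 2 < x <= IZR k + / 2 -> nint x = k.
Proof. intros H. unfold nint. apply Zceil_eq. lra. Qed.

Lemma Re_near (nu s0 : C) (d : R) : Cmod (nu - s0)%C < d -> Re s0 - d < Re nu < Re s0 + d.
Proof.
  intros H. assert (A := re_le_Cmod (nu - s0)%C). unfold Cminus in A. rewrite re_plus, re_opp in A. fold (Cminus nu s0) in A.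
  assert (B : Rabs (Re nu + - Re s0) < d) by lra. apply Rabs_def2 in B. lra.
Qed.

Lemma ex_Cderiv_kummer_sum (z s0 : C) (n : nat) : ex_Cderiv (fun s => Csum_lt (kummer_term s z) n) s0.
Proof.
  induction n as [|n [l IH]]; [exact (ex_Cderiv_const 0 s0)|].
  assert (H : ex_Cderiv (fun s => kummer_term s z n) s0).
  { unfold kummer_term. apply ex_Cderiv_mult; [apply ex_Cderiv_mult; [apply ex_Cderiv_const|apply ex_Cderiv_cpow]|].
    apply ex_Cderiv_mult; [apply ex_Cderiv_const|apply ex_Cderiv_kummer_coef]. }
  destruct H as [m Hm]. exists (l + m)%C. apply (is_Cderiv_plus _ (fun s => kummer_term s z n) _ _ _ IH Hm).
Qed.

(** Each term contains 1 / Gamma (m - n + 1) with m < n. This is the zero that compensates sin (nu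
    PI) in the chi term. *)
Lemma kummer_sum_neg_nat (z : C) (n : nat) : Csum_lt (kummer_term (- INR n) z) n = 0.
Proof.
  assert (Z : forall m, (m <= n)%nat -> Csum_lt (kummer_term (- INR n) z) m = 0).
  { induction m as [|m IH]; intros Hm; [reflexivity|]. simpl. rewrite IH by lia. unfold kummer_term, kummer_coef.
    replace (- INR n + INR m + 1)%C with (- INR (n - S m))%C.
    - rewrite rGamma_neg_nat. unfold Cdiv. ring.
    - rewrite minus_INR by lia. rewrite S_INR, RtoC_minus, RtoC_plus. ring. }
  apply Z. lia.
Qed.

(** If k <> 0, the sign of Re nu and the number of terms of [chi] are constant within distance 1/2
    of k, so the numerator is built from one finite sum of [kummer_term], differentiable in nu and
    zero at k. Around 0 the sign varies, but [chi] is zero throughout. *)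
Lemma chi_quot_lim (z : C) (k : Z) : z <> 0 -> exists c, Clim (Cpunct (RtoC (IZR k))) (chi_quot z) c.
Proof.
  intros Hz. destruct (Z.eq_dec k 0) as [->|Hk].
  - exists 0. apply Clim_ext with (fun _ => RtoC 0); [|apply Clim_const].
    apply Cpunct_intro with (/ 2); [lra|]. intros s Hs _. apply Re_near in Hs. rewrite re_RtoC in Hs.
    unfold chi_quot. rewrite chi_pos; [unfold Cdiv; ring|].
    rewrite re_opp, re_scal_r.
    destruct (Rtotal_order (Re s) 0) as [H|[H|H]]; [rewrite sign_eq_m1 by lra|rewrite H, sign_0|rewrite sign_eq_1 by lra]; lra.
  - destruct (IZR_nat_cases k) as [n [->| ->]].
    + assert (Hn : 1 <= INR n) by (apply (le_INR 1); lia).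
      destruct (quot_Csin_PI_lim (fun nu => Csum_lt (kummer_term (- nu) z) n) (Z.of_nat n)) as [l Hl].
      * apply (ex_Cderiv_opp (fun s => Csum_lt (kummer_term s z) n)), ex_Cderiv_kummer_sum.
      * rewrite <- INR_IZR_INZ. apply kummer_sum_neg_nat.
      * exists (-1 * l)%C. apply Clim_ext with (fun nu => (-1 * (Csum_lt (kummer_term (- nu) z) n / Csin (nu * PI)))%C).
        -- apply Cpunct_intro with (/ 2); [lra|]. intros s Hs _. apply Re_near in Hs. rewrite re_RtoC, <- INR_IZR_INZ in Hs.
           unfold chi_quot, Tminus. destruct (Rlt_dec (Re s) 0) as [H|H]; [lra|].
           rewrite sign_eq_1 by lra. replace (- (s * 1))%C with (- s)%C by ring.
           rewrite (chi_neg _ _ n); [reflexivity|exact Hz|lia|].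
           apply nint_near. rewrite re_opp, opp_IZR, <- INR_IZR_INZ. lra.
        -- apply Clim_mult; [apply Clim_const|exact Hl].
    + assert (Hn : 1 <= INR n) by (apply (le_INR 1); lia).
      destruct (quot_Csin_PI_lim (fun nu => Csum_lt (kummer_term nu z) n) (- Z.of_nat n)) as [l Hl].
      * apply ex_Cderiv_kummer_sum.
      * rewrite RtoC_IZR_neg_nat. apply kummer_sum_neg_nat.
      * eexists. apply Clim_ext with (fun nu => (Cexp (- (Ci * nu * PI)) * (Csum_lt (kummer_term nu z) n / Csin (nu * PI)))%C).
        -- apply Cpunct_intro with (/ 2); [lra|]. intros s Hs _. apply Re_near in Hs. rewrite re_RtoC, opp_IZR, <- INR_IZR_INZ in Hs.
           unfold chi_quot, Tminus. destruct (Rlt_dec (Re s) 0) as [H|H]; [|lra].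
           rewrite sign_eq_m1 by lra. replace (- (s * -1))%C with s by ring.
           rewrite (chi_neg _ _ n); [reflexivity|exact Hz|lia|].
           apply nint_near. rewrite opp_IZR, <- INR_IZR_INZ. lra.
        -- apply Clim_mult; [|exact Hl].
           apply Clim_ext with (fun nu => Cexp (nu * - (Ci * PI))%C).
           ++ apply filter_forall. intros nu. f_equal. ring.
           ++ eapply is_Cderiv_cont, is_Cderiv_Cexp_lin.
Qed.

(** * Values at integers read as limits *)

Definition is_Cint (mu : C) : Prop := mu = RtoC (IZR (nint (Re mu))).

Lemma nint_IZR (k : Z) : nint (IZR k) = k.
Proof. apply nint_near. lra. Qed.

Lemma is_int_lim_iff (f : C -> C) (mu l : C) :
  is_int_lim f mu l <-> (is_Cint mu -> Clim (Cpunct mu) f l) /\ (~ is_Cint mu -> f mu = l).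
Proof.
  unfold is_int_lim, is_Cint. destruct (Ceq_dec mu (IZR (nint (Re mu)))) as [E|E].
  - rewrite <- (Clim_iff (F := Cpunct mu) f l). tauto.
  - tauto.
Qed.

Lemma int_lim_eq (f : C -> C) (mu l : C) : is_int_lim f mu l -> int_lim f mu = l.
Proof.
  intros H. apply (iota_unique (V := C_R_CompleteNormedModule)); [|exact H].
  intros y Hy. apply is_int_lim_iff in H, Hy. destruct H as [H1 H2], Hy as [Y1 Y2].
  destruct (classic (is_Cint mu)) as [I|I].
  - apply (Clim_unique (F := Cpunct mu) f); auto.
  - rewrite <- (H2 I). symmetry. exact (Y2 I).
Qed.

Lemma Csin_PI_neq0 (mu : C) : ~ is_Cint mu -> Csin (mu * PI) <> 0.
Proof.
  intros H E. destruct (Csin_eq_0 mu E) as [k Hk]. apply H. unfold is_Cint. rewrite Hk, re_RtoC, nint_IZR. reflexivity.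
Qed.

Lemma Cpunct_not_int (k : Z) : Cpunct (RtoC (IZR k)) (fun nu => ~ is_Cint nu).
Proof.
  apply Cpunct_intro with (/ 2); [lra|]. intros s Hs Hne HI. apply Hne. rewrite HI. f_equal.
  apply Re_near in Hs. rewrite re_RtoC in Hs. rewrite (nint_near (Re s) k); [reflexivity|lra].
Qed.

(** By e^(- i nu PI) = cos (nu PI) - i sin (nu PI), the expression - i (J + i Y) is the quotient in
    [calH_quot] with J in place of B; substituting J = B + chi leaves the chi terms. *)
Lemma calH_quot_eq (z nu : C) : z <> 0 -> ~ is_Cint nu ->
  calH_quot z nu = (- Ci * (BesselJ nu z + Ci * BesselY_quot z nu) - chi_quot z nu)%C.
Proof.
  intros Hz HI. assert (HS := Csin_PI_neq0 nu HI).
  assert (J1 := BesselJ_B_chi nu z Hz). assert (J2 := BesselJ_B_chi (- nu) z Hz).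
  (* At most one of chi_nu and chi_(- nu) is nonzero, which is why a single term with [Tminus]
     represents both. *)
  assert (HT : (Tminus nu * chi (- (nu * sign (Re nu))) z = Cexp (- (Ci * nu * PI)) * chi nu z - chi (- nu) z)%C).
  { unfold Tminus. destruct (Rlt_dec (Re nu) 0) as [H|H].
    - rewrite sign_eq_m1 by exact H. replace (- (nu * -1))%C with nu by ring.
      rewrite (chi_pos (- nu)) by (rewrite re_opp; lra). ring.
    - rewrite (chi_pos nu) by lra. destruct (Req_dec (Re nu) 0) as [H0|H0].
      + rewrite H0, sign_0, !chi_pos by (rewrite ?re_opp, ?re_scal_r, ?H0; lra). ring.
      + rewrite sign_eq_1 by lra. replace (- (nu * 1))%C with (- nu)%C by ring. ring. }
  assert (HE : Cexp (- (Ci * nu * PI)) = (Ccos (nu * PI) - Ci * Csin (nu * PI))%C).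
  { unfold Ccos, Csin. replace (Ci * (nu * PI))%C with (Ci * nu * PI)%C by ring. field. apply Ci_nz. }
  unfold calH_quot, chi_quot, BesselY_quot.
  replace (Tminus nu * (chi (- (nu * sign (Re nu))) z / Csin (nu * PI)))%C with ((Tminus nu * chi (- (nu * sign (Re nu))) z) / Csin (nu * PI))%C by (unfold Cdiv; ring).
  rewrite HT.
  replace (B nu z) with (BesselJ nu z - chi nu z)%C by (rewrite J1; ring).
  replace (B (- nu) z) with (BesselJ (- nu) z - chi (- nu) z)%C by (rewrite J2; ring).
  rewrite HE. set (S := Csin (nu * PI)) in *. set (c := Ccos (nu * PI)).
  apply Ceq_minus.
  transitivity ((1 + Ci * Ci) * (BesselJ nu z * c - BesselJ (- nu) z) / S)%C; [field; exact HS|]. rewrite Ci2. field. exact HS.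
Qed.

(** cos (mu t) is even in mu, so the integrands of B at mu and - mu can be subtracted under one
    cosine. *)
Lemma diff_integrand_imp (mu z l1 l2 : C) : is_improper (B_integrand mu z) l1 -> is_improper (B_integrand (- mu) z) l2 ->
  is_improper (diff_integrand mu (cfrac (- mu)) z) (l1 - l2)%C.
Proof.
  intros H1 H2. generalize (is_improper_minus _ _ _ _ H1 H2). apply is_improper_ext. intros t _.
  unfold B_integrand, diff_integrand. replace (- mu * t)%C with (- (mu * t))%C by ring. rewrite Ccos_opp. ring.
Qed.

Lemma calH_integral_eq (z nu : C) : ~ is_Cint nu -> calH_integral nu (cfrac (- nu)) z = calH_quot z nu.
Proof.
  intros HI. assert (HS := Csin_PI_neq0 nu HI).
  destruct (B_integral_series nu z) as [l1 [H1 _]]. destruct (B_integral_series (- nu) z) as [l2 [H2 _]].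
  unfold calH_integral, calH_quot, B.
  rewrite (is_improper_integral _ _ H1), (is_improper_integral _ _ H2), (is_improper_integral _ _ (diff_integrand_imp _ _ _ _ H1 H2)).
  assert (E : (Cexp (- (Ci * nu * PI)) * ipow nu = ipow (- nu))%C).
  { unfold ipow. rewrite <- Cexp_plus. f_equal. field. }
  rewrite <- E.
  assert (Npi : RtoC PI <> 0) by (intros E'; apply RtoC_inj in E'; generalize PI_RGT_0; lra).
  field. split; assumption.
Qed.

(** Rounding commutes with negation except at half-integers, where {mu} and {- mu} both have real
    part 1/2. *)
Lemma cfrac_opp (mu : C) : (forall n : Z, Re mu <> IZR n + / 2) -> cfrac (- mu) = (- cfrac mu)%C.
Proof.
  intros H. unfold cfrac. rewrite re_opp.
  assert (A := Zceil_bound (Re mu - / 2)). fold (nint (Re mu)) in A. assert (B := H (nint (Re mu))).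
  rewrite (nint_near (- Re mu) (- nint (Re mu))) by (rewrite opp_IZR; lra).
  rewrite opp_IZR, RtoC_opp. ring.
Qed.

Lemma is_int_lim_ext (f g : C -> C) (mu l : C) :
  (is_Cint mu -> Cpunct mu (fun nu => f nu = g nu)) -> (~ is_Cint mu -> f mu = g mu) ->
  is_int_lim f mu l -> is_int_lim g mu l.
Proof.
  intros H1 H2 H. apply is_int_lim_iff in H. apply is_int_lim_iff. destruct H as [A B]. split.
  - intros HI. apply Clim_ext with f; [apply H1, HI|apply A, HI].
  - intros HI. rewrite <- H2 by exact HI. apply B, HI.
Qed.

Lemma Cpunct_int_filter (mu : C) (P : C -> Prop) : (forall nu, ~ is_Cint nu -> P nu) -> is_Cint mu -> Cpunct mu P.
Proof.
  intros H HI. rewrite HI. generalize (Cpunct_not_int (nint (Re mu))). apply filter_imp. exact H.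
Qed.

(** At an integer [calH_quot] inherits its limit from J, Y and chi, through [calH_quot_eq] on a
    punctured neighbourhood; the dependence of B on its order does not enter. *)
Lemma int_lims (mu z : C) : z <> 0 -> exists y c,
  is_int_lim (BesselY_quot z) mu y /\ is_int_lim (chi_quot z) mu c /\
  is_int_lim (calH_quot z) mu (- Ci * (BesselJ mu z + Ci * y) - c)%C.
Proof.
  intros Hz. destruct (classic (is_Cint mu)) as [HI|HI].
  - assert (E := HI). unfold is_Cint in E. set (k := nint (Re mu)) in *.
    destruct (BesselY_quot_lim z k Hz) as [y Hy]. destruct (chi_quot_lim z k Hz) as [c Hc].
    rewrite <- E in Hy, Hc.
    exists y, c. rewrite !is_int_lim_iff. split; [split; tauto|]. split; [split; tauto|]. split; [|tauto]. intros _.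
    apply Clim_ext with (fun nu => (- Ci * (BesselJ nu z + Ci * BesselY_quot z nu) - chi_quot z nu)%C).
    + apply Cpunct_int_filter; [|exact HI]. intros nu Hnu. symmetry. apply calH_quot_eq; assumption.
    + apply Clim_minus; [|exact Hc].
      apply Clim_mult; [apply Clim_const|].
      apply Clim_plus.
      * destruct (ex_Cderiv_BesselJ z mu) as [l Hl]. exact (is_Cderiv_cont _ _ _ Hl).
      * apply Clim_mult; [apply Clim_const|exact Hy].
  - exists (BesselY_quot z mu), (chi_quot z mu). rewrite !is_int_lim_iff.
    repeat split; try tauto. intros _. apply calH_quot_eq; assumption.
Qed.

Theorem mainTheorem5 (mu z : C) (hz : ~ (Re z <= 0 /\ Im z = 0)) :
  (- Ci * Hankel1 mu z)%C = (calH mu z + chi_term mu z)%C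
  /\ is_convergent_0_PI (B_integrand mu z)
  /\ is_int_lim (calH_quot z) mu (calH mu z)
  /\ is_int_lim (chi_quot z) mu (chi_term mu z)
  /\ is_convergent_0_PI (diff_integrand mu (cfrac (- mu)) z)
  /\ is_int_lim (fun nu => calH_integral nu (cfrac (- nu)) z) mu (calH mu z)
  /\ ((forall n : Z, Re mu <> IZR n + / 2) ->
      is_convergent_0_PI (diff_integrand mu (- cfrac mu)%C z)
      /\ is_int_lim (fun nu => calH_integral nu (- cfrac nu)%C z) mu (calH mu z)).
Proof.
  assert (Hz : z <> 0).
  { intros E. apply hz. rewrite E. simpl. split; [apply Rle_refl|reflexivity]. }
  destruct (int_lims mu z Hz) as [y [c [HY [Hc HH]]]].
  assert (EY : BesselY mu z = y) by (apply (int_lim_eq (BesselY_quot z)), HY).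
  assert (Ec : chi_term mu z = c) by (apply int_lim_eq, Hc).
  assert (EH := int_lim_eq _ _ _ HH). fold (calH mu z) in EH.
  assert (Hdiff : is_convergent_0_PI (diff_integrand mu (cfrac (- mu)) z)).
  { destruct (B_integral_series mu z) as [l1 [H1 _]]. destruct (B_integral_series (- mu) z) as [l2 [H2 _]].
    eapply is_improper_convergent, diff_integrand_imp; eassumption. }
  assert (Hint : is_int_lim (fun nu => calH_integral nu (cfrac (- nu)) z) mu (calH mu z)).
  { rewrite EH. revert HH. apply is_int_lim_ext.
    - apply Cpunct_int_filter. intros nu Hnu. symmetry. apply calH_integral_eq, Hnu.
    - intros HI. symmetry. apply calH_integral_eq, HI. }
  split; [unfold Hankel1; rewrite EY, EH, Ec; ring|].
  split; [apply B_convergent|].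
  split; [rewrite EH; exact HH|].
  split; [rewrite Ec; exact Hc|].
  split; [exact Hdiff|].
  split; [exact Hint|].
  intros Hhalf. split.
  - rewrite <- cfrac_opp by exact Hhalf. exact Hdiff.
  - revert Hint. apply is_int_lim_ext.
    (* Near an integer Re nu stays strictly within 1/2 of it and meets no half-integer, so
       [cfrac_opp] applies on the whole punctured disc. *)
    + intros HI. unfold is_Cint in HI. apply Cpunct_intro with (/ 2); [lra|]. intros nu Hnu _. rewrite cfrac_opp; [reflexivity|].
      rewrite HI in Hnu. apply Re_near in Hnu. rewrite re_RtoC in Hnu. intros n En. rewrite En in Hnu.
      set (k := nint (Re mu)) in *.
      assert (A1 : (k - 1 < n)%Z) by (apply lt_IZR; rewrite minus_IZR; lra).
      assert (A2 : (n < k)%Z) by (apply lt_IZR; lra). lia.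
    + intros _. rewrite cfrac_opp by exact Hhalf. reflexivity.
Qed.
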